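(* Let $\boldsymbol{\ell}$ be a set of edge lengths of a spherical octahedron and let $\Gamma$ be an essential one-dimensional irreducible component of the configuration space $\Sigma(\boldsymbol{\ell})$. Put $t_1=t_{\mathbf{a}_2\mathbf{a}_3}$, $t_2=t_{\mathbf{a}_3\mathbf{a}_1}$, $t_3=t_{\mathbf{a}_1\mathbf{a}_2}$. Then the following two conditions are equivalent: (i) $\mathbb{R}(t_3)=\mathbb{R}(t_1)\cap\mathbb{R}(t_2)$, $|\mathbb{R}(\Gamma)/\mathbb{R}(t_3)|=4$, and $|\mathbb{R}(\Gamma)/\mathbb{R}(t_1)|=|\mathbb{R}(\Gamma)/\mathbb{R}(t_2)|=|\mathbb{R}(t_1)/\mathbb{R}(t_3)|=|\mathbb{R}(t_2)/\mathbb{R}(t_3)|=2$; (ii) up to rotation of $\mathbb{S}^3$ and simultaneous renaming of vertices $\mathbf{a}_1\leftrightarrow\mathbf{a}_2$ and $\mathbf{b}_1\leftrightarrow\mathbf{b}_2$, the flexion of the octahedron corresponding to $\Gamma$ admits a parametrization of the form $$\begin{aligned} \mathbf{a}_1&=\Bigl(\tfrac{p_1}{\cos\theta},\delta_1\sqrt{1-\tfrac{p_1^2}{\cos^2\theta}},0,0\Bigr),& \mathbf{b}_1&=\Bigl(\tfrac{p_2}{\cos\theta},\delta_2\sqrt{1-\tfrac{p_2^2}{\cos^2\theta}},0,0\Bigr),\\ \mathbf{a}_2&=\Bigl(0,0,\tfrac{q_1}{\sin\theta},\varepsilon_1\sqrt{1-\tfrac{q_1^2}{\sin^2\theta}}\Bigr),&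 \mathbf{b}_2&=\Bigl(0,0,\tfrac{q_2}{\sin\theta},\varepsilon_2\sqrt{1-\tfrac{q_2^2}{\sin^2\theta}}\Bigr),\\ \mathbf{a}_3&=(\cos\theta,0,\sin\theta,0),&\mathbf{b}_3&=(\cos\theta,0,-\sin\theta,0), \end{aligned}$$ with constants $p_1,p_2,q_1,q_2\in\mathbb{R}$ such that $|p_1|\ne|p_2|$ and $|q_1|\ne|q_2|$, signs $\delta_1,\delta_2,\varepsilon_1,\varepsilon_2\in\{-1,1\}$, and $\theta\in(0,\pi/2)$ the parameter of the flexion.
   Context: **Octahedra.** $\mathbb{S}^3$ is the unit sphere centered at the origin in Euclidean space $\mathbb{E}^4$. An octahedron in $\mathbb{S}^3$ is a (possibly self-intersecting) polyhedral surface with the combinatorial type of a regular octahedron: it has 6 vertices $\mathbf{a}_1,\mathbf{a}_2,\mathbf{a}_3,\mathbf{b}_1,\mathbf{b}_2,\mathbf{b}_3$, 12 edges (shortest great-circle arcs) joining all pairs of vertices except the three pairs $\{\mathbf{a}_i,\mathbf{b}_i\}$, and 8 triangular faces $\mathbf{u}_1\mathbf{u}_2\mathbf{u}_3$ with $\mathbf{u}_i\in\{\mathbf{a}_i,\mathbf{b}_i\}$. All faces are non-degenerate (the vertices of a face do not lie on a great circle). A flex is a continuous family of octahedra with all edge lengths constant that is not induced by a continuous family of isometries of $\mathbb{S}^3$. **Oriented dihedral angles.** Orient the surface so that the face $\mathbf{a}_1\mathbf{a}_2\mathbf{a}_3$ has the orientation given by this order of vertices. Let $\mathbf{u}\mathbf{v}$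 be an edge, $\mathbf{u}\mathbf{v}\mathbf{w}_1$, $\mathbf{u}\mathbf{v}\mathbf{w}_2$ the two faces containing it, and $\mathbf{p}$ a point on it. Let $\mathbf{m}_i\in T_{\mathbf{p}}\mathbb{S}^3$ be the exterior unit normal to the face $\mathbf{u}\mathbf{v}\mathbf{w}_i$ (the orientation of the normal followed by the positive orientation of the face is the positive orientation of $\mathbb{S}^3$) and $\mathbf{n}_i\in T_{\mathbf{p}}\mathbb{S}^3$ the unit vector orthogonal to the edge, tangent to the face $\mathbf{u}\mathbf{v}\mathbf{w}_i$ and pointing inside it. Choose the positive direction of rotation around $\mathbf{u}\mathbf{v}$ so that $\mathbf{n}_1$ is obtained from $\mathbf{m}_1$ by rotation through $\pi/2$ in the positive direction. The oriented dihedral angle $\varphi_{\mathbf{u}\mathbf{v}}\in\mathbb{R}/2\pi\mathbb{Z}$ is the rotation angle from $\mathbf{n}_1$ to $\mathbf{n}_2$ in this direction. Put $t_{\mathbf{u}\mathbf{v}}=\tan(\varphi_{\mathbf{u}\mathbf{v}}/2)\in\mathbb{R}\cup\{\infty\}=\mathbb{RP}^1$. **Configuration space.** Let $\boldsymbol{\ell}=(\ell_{\mathbf{u}\mathbf{v}})$ be a set of 12 edge lengths such that for each face the three lengths are side lengths of a non-degenerate spherical triangle (each in $(0,\pi)$, strict triangle inequalities, sum less than $2\pi$). It determines all angles of faces. For each vertex $\mathbf{u}$ and each face $\mathbf{u}\mathbf{v}_1\mathbf{v}_2$ containing it, let $\mathbf{u}\mathbf{v}_1\mathbf{v}_2,\mathbf{u}\mathbf{v}_2\mathbf{v}_3,\mathbf{u}\mathbf{v}_3\mathbf{v}_4,\mathbf{u}\mathbf{v}_4\mathbf{v}_1$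 be the four faces at $\mathbf{u}$ in cyclic order and $\alpha=\angle\mathbf{v}_1\mathbf{u}\mathbf{v}_2$, $\beta=\angle\mathbf{v}_2\mathbf{u}\mathbf{v}_3$, $\gamma=\angle\mathbf{v}_3\mathbf{u}\mathbf{v}_4$, $\delta=\angle\mathbf{v}_4\mathbf{u}\mathbf{v}_1$. Writing $t_{\mathbf{u}\mathbf{v}_i}=(X_i:Y_i)$, one has the equation $$AX_1^2X_2^2+BX_1^2Y_2^2+2CX_1Y_1X_2Y_2+DY_1^2X_2^2+EY_1^2Y_2^2=0,$$ $A=\cos\gamma-\cos(\alpha+\beta+\delta)$, $B=\cos\gamma-\cos(\alpha-\beta+\delta)$, $D=\cos\gamma-\cos(\alpha+\beta-\delta)$, $E=\cos\gamma-\cos(\alpha-\beta-\delta)$, $C=-2\sin\beta\sin\delta$. The configuration space $\Sigma(\boldsymbol{\ell})\subset(\mathbb{RP}^1)^{12}$ is the algebraic variety in the 12 variables $t_{\mathbf{u}\mathbf{v}}$ given by these 24 equations (one for each pair of edges lying in a common face). Its points are in one-to-one correspondence with octahedra with edge lengths $\boldsymbol{\ell}$ up to rotations of $\mathbb{S}^3$. A one-dimensional irreducible component $\Gamma$ of $\Sigma(\boldsymbol{\ell})$ is essential if no $t_{\mathbf{u}\mathbf{v}}$ is identically $0$ or identically $\infty$ on $\Gamma$. $\mathbb{R}(\Gamma)$ is the field of rational functions on $\Gamma$, $\mathbb{R}(t_i)\subset\mathbb{R}(\Gamma)$ the subfield of rational functions in $t_i$, and $|E/F|$ the degree of a field extension.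 The signs $\delta_1,\delta_2,\varepsilon_1,\varepsilon_2$ in the parametrization may be chosen arbitrarily and may change along the flexion at values of $\theta$ where the corresponding square root vanishes.
   Formalization: The configuration space is taken to be the solutions of the 24 equations that actually come from octahedra with edge lengths ℓ; the 24 equations alone admit further essential curves that satisfy (i) but correspond to no flexion. *)

(* Defs.v *)
From HB Require Import structures.
From mathcomp Require Import all_boot all_order all_algebra.
From mathcomp Require Import all_classical all_reals all_analysis.
From mathcomp Require Import -(notations) mpoly.

Set Implicit Arguments.
Unset Strict Implicit.
Unset Printing Implicit Defensive.

Import Order.TTheory GRing.Theory Num.Theory.

Local Open Scope classical_set_scope.
Local Open Scope quotient_scope.
Local Open Scope ring_scope.

(** * Real algebraic subsets of (RP^1)^I

    RP^1 = R \cup {oo} is [option R], with [None] the point at infinity; the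
    normalised homogeneous coordinates (X : Y) are (t : 1) and (1 : 0).  All
    varieties are sets of real points. *)

Definition homX (R : realType) (x : option R) : R := if x is Some t then t else 1.
Definition homY (R : realType) (x : option R) : R := if x is Some _ then 1 else 0.

Section Zariski.
Variables (R : realType) (I : finType).

Local Notation n := #|I|.
Local Notation point := (I -> option R).

(* Polynomials in the 2n homogeneous coordinates X_e, Y_e, and their indices. *)
Local Notation hpoly := (mpoly (n + n) R).
Definition idxX (e : I) : 'I_(n + n) := lshift n (enum_rank e).
Definition idxY (e : I) : 'I_(n + n) := rshift n (enum_rank e).

Definition hcoord (x : point) (k : 'I_(n + n)) : R :=
  match fintype.split k with
  | inl i => homX (x (enum_val i))
  | inr i => homY (x (enum_val i))
  end.

Definition multihomogeneous (p : hpoly) : Prop :=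
  exists d : I -> nat, forall m, m \in msupp p ->
    forall e, (m (idxX e) + m (idxY e))%N = d e.

Definition zclosed (Z : set point) : Prop :=
  exists2 F : set hpoly, (forall p, F p -> multihomogeneous p) &
    Z = [set x | forall p, F p -> meval (hcoord x) p = 0].

Definition zirreducible (Z : set point) : Prop :=
  Z !=set0 /\
  forall Z1 Z2, zclosed Z1 -> zclosed Z2 ->
    Z `<=` Z1 `|` Z2 -> Z `<=` Z1 \/ Z `<=` Z2.

Definition irreducible_component (S G : set point) : Prop :=
  [/\ zclosed G, zirreducible G, G `<=` S &
    forall Z, zclosed Z -> zirreducible Z -> G `<=` Z -> Z `<=` S -> Z = G].

Definition has_chain (S : set point) (k : nat) : Prop :=
  exists Z : nat -> set point,
    (forall i, (i <= k)%N -> [/\ zclosed (Z i), zirreducible (Z i) & Z i `<=` S]) /\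
    (forall i, (i < k)%N -> Z i `<` Z i.+1).

Definition has_dimension (S : set point) (k : nat) : Prop :=
  has_chain S k /\ ~ has_chain S k.+1.

(** The irreducible components of interest meet the affine chart R^I, where no
    coordinate is infinite, and their function field is the field of fractions
    of the coordinate ring of the affine part. *)

Local Notation apoly := (mpoly n R).
Definition acoord (v : I -> R) (k : 'I_n) : R := v (enum_val k).

Definition affine_part (Z : set point) : set (I -> R) :=
  [set v | Z (fun e => Some (v e))].

Definition vanishes_on (A : set (I -> R)) (p : apoly) : Prop :=
  forall v, A v -> meval (acoord v) p = 0.

Record irr_affine := IrrAffine {
  irr_set : set (I -> R);
  irr_nonempty : irr_set !=set0;
  irr_prime : forall p q : apoly, vanishes_on irr_set (p * q) ->
    vanishes_on irr_set p \/ vanishes_on irr_set q }.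

Definition homogenize (p : apoly) : hpoly :=
  \sum_(m <- msupp p) mcoeff m p *: mpolyX R (Multinom [tuple
    match fintype.split k with
    | inl i => m i
    | inr i => (msize p - m i)%N
    end | k < n + n]).

Lemma split_idxX e : fintype.split (idxX e) = inl (enum_rank e).
Proof. by rewrite -[RHS]unsplitK. Qed.

Lemma split_idxY e : fintype.split (idxY e) = inr (enum_rank e).
Proof. by rewrite -[RHS]unsplitK. Qed.

Lemma msupp_exp_le (p : apoly) m i : m \in msupp p -> (m i <= msize p)%N.
Proof.
move=> /msize_mdeg_lt /ltnW; apply: leq_trans.
by rewrite mdegE (bigD1 i) //= leq_addr.
Qed.

Lemma homogenizeP p : multihomogeneous (homogenize p).
Proof.
exists (fun _ => msize p) => m /msupp_sum_le; rewrite filter_predT.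
case/flattenP => s /mapP [m' hm' ->] /msuppZ_le; rewrite msuppX inE => /eqP -> e.
by rewrite !mnmE split_idxX split_idxY subnKC // msupp_exp_le.
Qed.

Lemma meval_homogenize (p : apoly) (v : I -> R) :
  meval (hcoord (fun e => Some (v e))) (homogenize p) = meval (acoord v) p.
Proof.
rewrite /homogenize raddf_sum /= [RHS]mevalE; apply: eq_bigr => m _.
rewrite mevalZ mevalX big_split_ord /=; congr (_ * _).
rewrite [X in _ * X]big1 ?mulr1 => [|i _].
  apply: eq_bigr => i _; rewrite mnmE /hcoord.
  by rewrite -[lshift _ _]/(unsplit (inl i)) unsplitK.
by rewrite mnmE /hcoord -[rshift _ _]/(unsplit (inr i)) unsplitK /= expr1n.
Qed.

Lemma zclosed_hyper (p : hpoly) :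
  multihomogeneous p -> zclosed [set x | meval (hcoord x) p = 0].
Proof.
move=> hp; exists [set p] => [_ -> //|].
by apply/seteqP; split=> x /= h => [_ -> //|]; exact: h.
Qed.

Lemma multihomogeneousY e : multihomogeneous (mpolyX R (mnm1 (idxY e))).
Proof.
exists (fun e' => (e' == e) : nat) => m; rewrite msuppX inE => /eqP -> e'.
rewrite !mnm1E (_ : (idxY e == idxX e') = false); last first.
  by rewrite /idxX /idxY eq_rlshift.
rewrite add0n; congr nat_of_bool; rewrite /idxY eq_rshift.
by rewrite (inj_eq enum_rank_inj) eq_sym.
Qed.

Lemma multihomogeneousM p q :
  multihomogeneous p -> multihomogeneous q -> multihomogeneous (p * q).
Proof.
move=> [d hd] [d' hd']; exists (fun e => d e + d' e)%N => m /msuppM_le.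
move=> /allpairsP [[m1 m2] /= [/hd h1 /hd' h2 ->]] e.
by rewrite !mnmDE addnACA h1 h2.
Qed.

Lemma multihomogeneous1 : multihomogeneous 1.
Proof.
exists (fun=> 0%N) => m; rewrite msupp1 inE => /eqP -> e.
by rewrite !mnm0E.
Qed.

Lemma zirreducible_prod (Z : set point) (T : eqType) (r : seq T) (f : T -> hpoly) :
  zirreducible Z -> (forall t, multihomogeneous (f t)) ->
  (forall x, Z x -> meval (hcoord x) (\prod_(t <- r) f t) = 0) ->
  exists t, forall x, Z x -> meval (hcoord x) (f t) = 0.
Proof.
move=> [[x0 Zx0] hZ] hf; elim: r => [/(_ _ Zx0)|t r IHr h].
  by rewrite big_nil meval1 => /eqP; rewrite oner_eq0.
have hr : multihomogeneous (\prod_(t <- r) f t).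
  by apply: big_ind => //; [exact: multihomogeneous1|exact: multihomogeneousM].
have [x Zx|h1|h2] := hZ _ _ (zclosed_hyper (hf t)) (zclosed_hyper hr).
- have /eqP := h x Zx; rewrite big_cons mevalM mulf_eq0 => /orP [] /eqP hx;
    by [left|right].
- by exists t.
- exact: IHr.
Qed.

Lemma affine_part_prime (Z : set point) (p q : apoly) :
  zirreducible Z -> (forall e, ~ (forall x, Z x -> x e = None)) ->
  vanishes_on (affine_part Z) (p * q) ->
  vanishes_on (affine_part Z) p \/ vanishes_on (affine_part Z) q.
Proof.
move=> Zirr Zfin hpq.
pose f (t : bool + I) := match t with
  | inl b => homogenize (if b then p else q)
  | inr e => mpolyX R (mnm1 (idxY e)) end.
have [||[[]|e] ht] := @zirreducible_prod Z _ (index_enum (bool + I)%type) f Zirr.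
- by case=> [b|e]; [exact: homogenizeP|exact: multihomogeneousY].
- move=> x Zx; rewrite rmorph_prod /=; apply/eqP/prodf_eq0.
  have [[e he]|hfin] := pselect (exists e, x e = None).
    exists (inr e) => //=.
    by rewrite mevalXU /hcoord split_idxY enum_rankK he.
  have [v xE] : exists v : I -> R, x = fun e => Some (v e).
    exists (fun e => odflt 0 (x e)); apply/funext => e.
    by case xe: (x e) => [a|] //; case: hfin; exists e.
  rewrite xE in Zx *; have /eqP := hpq v Zx.
  rewrite mevalM mulf_eq0 => /orP [] h; [exists (inl true)|exists (inl false)] => //=;
    by rewrite meval_homogenize.
- by left=> v Zv; rewrite -meval_homogenize; exact: ht.
- by right=> v Zv; rewrite -meval_homogenize; exact: ht.
- case: (Zfin e) => x /ht /=; rewrite mevalXU /hcoord split_idxY enum_rankK.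
  by case: (x e) => [a|] //= /eqP; rewrite oner_eq0.
Qed.

Lemma affine_part_nonempty (Z : set point) :
  zirreducible Z -> (forall e, ~ (forall x, Z x -> x e = None)) ->
  affine_part Z !=set0.
Proof.
move=> Zirr Zfin; apply: contrapT => Z0.
have h1 : forall p, vanishes_on (affine_part Z) p.
  by move=> p v Zv; case: Z0; exists v.
pose f (e : I) := mpolyX R (mnm1 (idxY e)).
have [e||e ht] := @zirreducible_prod Z _ (index_enum I) f Zirr.
- exact: multihomogeneousY.
- move=> x Zx; rewrite rmorph_prod /=; apply/eqP/prodf_eq0.
  have [[e he]|hfin] := pselect (exists e, x e = None).
    by exists e => //=; rewrite mevalXU /hcoord split_idxY enum_rankK he.
  case: Z0; exists (fun e => odflt 0 (x e)); rewrite /affine_part /=.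
  congr Z: Zx; apply/funext => e.
  by case xe: (x e) => [a|] //; case: hfin; exists e.
- case: (Zfin e) => x /ht /=; rewrite mevalXU /hcoord split_idxY enum_rankK.
  by case: (x e) => [a|] //= /eqP; rewrite oner_eq0.
Qed.

Definition affine_part_irr (Z : set point) (Zirr : zirreducible Z)
    (Zfin : forall e, ~ (forall x, Z x -> x e = None)) : irr_affine :=
  IrrAffine (affine_part_nonempty Zirr Zfin)
            (fun p q => @affine_part_prime Z p q Zirr Zfin).

End Zariski.

Section FunctionField.
Variables (R : realType) (I : finType) (A : irr_affine R I).

Local Notation apoly := (mpoly #|I| R).

Definition vanishing_ideal : {pred apoly} :=
  fun p => `[< vanishes_on (irr_set A) p >].

Lemma vanishing_ideal_closed : idealr_closed vanishing_ideal.
Proof.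
split.
- by apply/asboolP => v _; rewrite meval0.
- apply/asboolP => h; have [v Av] := irr_nonempty A.
  by have /eqP := h v Av; rewrite meval1 oner_eq0.
- move=> a p q /asboolP hp /asboolP hq; apply/asboolP => v Av.
  by rewrite mevalD mevalM hp // hq // mulr0 addr0.
Qed.

Lemma vanishing_ideal_prime : prime_idealr_closed vanishing_ideal.
Proof.
move=> p q /asboolP /irr_prime [h|h]; apply/orP; [left|right]; exact/asboolP.
Qed.

HB.instance Definition _ :=
  isIdealr.Build _ vanishing_ideal vanishing_ideal_closed.
HB.instance Definition _ :=
  isPrimeIdealrClosed.Build _ vanishing_ideal vanishing_ideal_prime.

Definition coord_ring := {ideal_quot vanishing_ideal}.
HB.instance Definition _ := GRing.ComNzRing.on coord_ring.

Definition cr_unit : {pred coord_ring} :=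
  fun x => `[< exists y : coord_ring, y * x = 1 >].
Definition cr_inv (x : coord_ring) : coord_ring :=
  if pselect (exists y : coord_ring, y * x = 1) is left h then projT1 (cid h) else x.

Lemma cr_mulVr : {in cr_unit, left_inverse 1 cr_inv *%R}.
Proof.
move=> x /asboolP h; rewrite /cr_inv; case: pselect => // h'.
exact: projT2 (cid h').
Qed.

Lemma cr_unitP (x y : coord_ring) : y * x = 1 -> cr_unit x.
Proof. by move=> h; apply/asboolP; exists y. Qed.

Lemma cr_inv0id : {in [predC cr_unit], cr_inv =1 id}.
Proof.
move=> x; rewrite inE /= => /asboolPn h; rewrite /cr_inv.
by case: pselect.
Qed.

HB.instance Definition _ := GRing.ComNzRing_hasMulInverse.Build coord_ring
  cr_mulVr cr_unitP cr_inv0id.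
HB.instance Definition _ := GRing.ComUnitRing_isIntegral.Build coord_ring
  (@Quotient.rquot_IdomainAxiom _ vanishing_ideal).

Definition function_field : fieldType := {fraction coord_ring}.

Definition residue (p : apoly) : coord_ring := \pi_coord_ring p.
Definition regular (p : apoly) : function_field := tofrac (residue p).

Lemma regular_eq0 (p : apoly) : regular p = 0 <-> vanishes_on (irr_set A) p.
Proof.
rewrite /regular /residue; split=> [/eqP|h]; last apply/eqP.
  rewrite tofrac_eq0 -(rmorph0 (\pi_coord_ring)) -Quotient.idealrBE subr0.
  by move/asboolP.
rewrite tofrac_eq0 -(rmorph0 (\pi_coord_ring)) -Quotient.idealrBE subr0.
exact/asboolP.
Qed.

Definition const_fun (c : R) : function_field := regular (mpolyC _ c).
Definition coordinate (e : I) : function_field :=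
  regular (mpolyX R (mnm1 (enum_rank e))).

(* The subfield R(f) of rational functions in f. *)
Definition generated_subfield (f : function_field) : set function_field :=
  [set g | exists p q : {poly R}, (map_poly const_fun q).[f] != 0 /\
     g = (map_poly const_fun p).[f] / (map_poly const_fun q).[f]].

End FunctionField.

(* |E/F| = d: E has a basis of d elements over F. *)
Definition extension_degree (K : fieldType) (E F : set K) (d : nat) : Prop :=
  F `<=` E /\
  exists b : 'I_d -> K, (forall i, E (b i)) /\
    forall x, E x -> exists! c : {ffun 'I_d -> K},
      (forall i, F (c i)) /\ x = \sum_i c i * b i.

(** * Octahedra in S^3 *)

(* (i, false) is a_{i+1} and (i, true) is b_{i+1}. *)
Definition vertex := ('I_3 * bool)%type.

Definition a1 : vertex := (@Ordinal 3 0 isT, false).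
Definition a2 : vertex := (@Ordinal 3 1 isT, false).
Definition a3 : vertex := (@Ordinal 3 2 isT, false).
Definition b1 : vertex := (@Ordinal 3 0 isT, true).
Definition b2 : vertex := (@Ordinal 3 1 isT, true).
Definition b3 : vertex := (@Ordinal 3 2 isT, true).

Definition opp_vertex (u : vertex) : vertex := (u.1, ~~ u.2).

Definition is_face (u v w : vertex) : bool :=
  [&& u.1 != v.1, v.1 != w.1 & w.1 != u.1].

(* Whether the order (u, v, w) is the orientation of the face: a1 a2 a3 is
   positive, and replacing one a_i by b_i (crossing an edge) reverses it. *)
Definition face_positive (u v w : vertex) : bool :=
  (v.1 == ordS u.1) (+) u.2 (+) v.2 (+) w.2.

Definition is_edge (e : {set vertex}) : bool :=
  [exists u : vertex, exists v : vertex, (u.1 != v.1) && (e == [set u; v]%SET)].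

Definition edge := {e : {set vertex} | is_edge e}.

Lemma is_edge_a1a2 : is_edge [set a1; a2]%SET.
Proof. by apply/existsP; exists a1; apply/existsP; exists a2; rewrite eqxx. Qed.

Definition edge_a1a2 : edge := exist is_edge _ is_edge_a1a2.

(* Meaningful only for u.1 != v.1. *)
Definition edge_of (u v : vertex) : edge := insubd edge_a1a2 [set u; v]%SET.

Lemma val_edge_of u v : u.1 != v.1 -> val (edge_of u v) = [set u; v]%SET.
Proof.
move=> h; rewrite /edge_of val_insubd ifT //.
by apply/existsP; exists u; apply/existsP; exists v; rewrite h eqxx.
Qed.

Lemma edge_ofC u v : edge_of u v = edge_of v u.
Proof. by rewrite /edge_of finset.setUC. Qed.

Section Octahedra.
Variable R : realType.

Local Notation vec := 'rV[R]_4.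
Local Notation config := (edge -> option R).

Definition dot (x y : vec) : R := \sum_i x 0 i * y 0 i.

Definition det4 (x y z w : vec) : R :=
  \det (\matrix_(i < 4) nth 0 [:: x; y; z; w] i).

Definition octahedron (P : vertex -> vec) : Prop :=
  (forall u, dot (P u) (P u) = 1) /\
  (forall s : 'I_3 -> bool, row_free (\matrix_(i < 3) P (i, s i))).

Definition has_edge_lengths (P : vertex -> vec) (l : edge -> R) : Prop :=
  forall u v, u.1 != v.1 -> acos (dot (P u) (P v)) = l (edge_of u v).

(** Oriented dihedral angles.  The plane orthogonal to the edge in the tangent
    space of S^3 at a point of the edge u v is the orthogonal complement of
    P u, P v in R^4, whichever point is taken; we take P u.  A basis x, y, z of
    the tangent space at p is positive when det (p, x, y, z) > 0. *)

Definition exterior_normal (P : vertex -> vec) (u v w : vertex) (m : vec) : Prop :=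
  [/\ dot m m = 1, dot m (P u) = 0, dot m (P v) = 0, dot m (P w) = 0 &
    if face_positive u v w then 0 < det4 (P u) m (P v) (P w)
    else det4 (P u) m (P v) (P w) < 0].

Definition inward_normal (P : vertex -> vec) (u v w : vertex) (n : vec) : Prop :=
  [/\ dot n n = 1, dot n (P u) = 0, dot n (P v) = 0 &
    exists x y z : R, 0 < z /\ n = x *: P u + y *: P v + z *: P w].

(* Rotation by pi/2 sends m1 to n1, hence n1 to - m1. *)
Definition dihedral_angle (P : vertex -> vec) (u v w1 w2 : vertex) (phi : R) : Prop :=
  exists m1 n1 n2,
    [/\ exterior_normal P u v w1 m1, inward_normal P u v w1 n1,
        inward_normal P u v w2 n2 & n2 = cos phi *: n1 - sin phi *: m1].

Definition half_tan (phi : R) : option R :=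
  if cos (phi / 2) == 0 then None else Some (tan (phi / 2)).

Definition has_half_tangents (P : vertex -> vec) (x : config) : Prop :=
  forall u v w, is_face u v w ->
    exists phi, dihedral_angle P u v w (opp_vertex w) phi /\
      x (edge_of u v) = half_tan phi.

(** * Configuration space *)

Definition nondegenerate_lengths (l : edge -> R) : Prop :=
  (forall e, 0 < l e < pi) /\
  (forall u v w, is_face u v w ->
     l (edge_of u v) < l (edge_of v w) + l (edge_of w u) /\
     l (edge_of u v) + l (edge_of v w) + l (edge_of w u) < 2 * pi).

(* Angle at u of the face u v w, by the spherical law of cosines. *)
Definition face_angle (l : edge -> R) (u v w : vertex) : R :=
  let a := l (edge_of v w) in
  let b := l (edge_of u v) in
  let c := l (edge_of u w) in
  acos ((cos a - cos b * cos c) / (sin b * sin c)).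

Definition vertex_equation (l : edge -> R) (x : config) (u v1 v2 : vertex) : Prop :=
  let v3 := opp_vertex v1 in
  let v4 := opp_vertex v2 in
  let alpha := face_angle l u v1 v2 in
  let beta := face_angle l u v2 v3 in
  let gamma := face_angle l u v3 v4 in
  let delta := face_angle l u v4 v1 in
  let A := cos gamma - cos (alpha + beta + delta) in
  let B := cos gamma - cos (alpha - beta + delta) in
  let C := - 2 * sin beta * sin delta in
  let D := cos gamma - cos (alpha + beta - delta) in
  let E := cos gamma - cos (alpha - beta - delta) in
  let X1 := homX (x (edge_of u v1)) in
  let Y1 := homY (x (edge_of u v1)) in
  let X2 := homX (x (edge_of u v2)) in
  let Y2 := homY (x (edge_of u v2)) in
  A * X1 ^+ 2 * X2 ^+ 2 + B * X1 ^+ 2 * Y2 ^+ 2 + 2 * C * X1 * Y1 * X2 * Y2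
    + D * Y1 ^+ 2 * X2 ^+ 2 + E * Y1 ^+ 2 * Y2 ^+ 2 = 0.

(* The points of the configuration space are to be the octahedra with edge
   lengths l up to rotation.  The 24 equations alone do not ensure it: for
   instance they have further solutions, coming from no octahedron, when l is
   the set of edge lengths of the flexible octahedra [standard_octahedron]
   below.  Hence the second condition. *)
Definition configuration_space (l : edge -> R) : set config :=
  [set x | (forall u v1 v2, is_face u v1 v2 -> vertex_equation l x u v1 v2) /\
     exists P, [/\ octahedron P, has_edge_lengths P l & has_half_tangents P x]].

Record essential_component (l : edge -> R) (G : set config) : Prop :=
  EssentialComponent {
    ess_component : irreducible_component (configuration_space l) G;
    ess_dim : has_dimension G 1;
    ess_not_zero : forall e, ~ (forall x, G x -> x e = Some 0);
    ess_not_infty : forall e, ~ (forall x, G x -> x e = None) }.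

Lemma ess_irreducible l G : essential_component l G -> zirreducible G.
Proof. by move=> /ess_component []. Qed.

Definition component_chart l G (h : essential_component l G) : irr_affine R edge :=
  affine_part_irr (ess_irreducible h) (ess_not_infty h).

(* The octahedra corresponding to the points of G. *)
Definition flexion (l : edge -> R) (G : set config) : set (vertex -> vec) :=
  [set P | [/\ octahedron P, has_edge_lengths P l &
     exists2 x, G x & has_half_tangents P x]].

(** * The parametrised family *)

Definition vec4 (x y z w : R) : vec := \row_(i < 4) nth 0 [:: x; y; z; w] i.

Definition standard_octahedron (p1 p2 q1 q2 d1 d2 e1 e2 theta : R)
    (u : vertex) : vec :=
  let c := cos theta in
  let s := sin theta in
  match nat_of_ord u.1, u.2 with
  | 0%N, false => vec4 (p1 / c) (d1 * Num.sqrt (1 - p1 ^+ 2 / c ^+ 2)) 0 0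
  | 0%N, true => vec4 (p2 / c) (d2 * Num.sqrt (1 - p2 ^+ 2 / c ^+ 2)) 0 0
  | 1%N, false => vec4 0 0 (q1 / s) (e1 * Num.sqrt (1 - q1 ^+ 2 / s ^+ 2))
  | 1%N, true => vec4 0 0 (q2 / s) (e2 * Num.sqrt (1 - q2 ^+ 2 / s ^+ 2))
  | _, false => vec4 c 0 s 0
  | _, true => vec4 c 0 (- s) 0
  end.

(* [Num.sqrt] is total: the radicands are required to be nonnegative. *)
Definition admissible (p1 p2 q1 q2 theta : R) : Prop :=
  0 < theta < pi / 2 /\
  [/\ 0 <= 1 - p1 ^+ 2 / cos theta ^+ 2, 0 <= 1 - p2 ^+ 2 / cos theta ^+ 2,
      0 <= 1 - q1 ^+ 2 / sin theta ^+ 2 & 0 <= 1 - q2 ^+ 2 / sin theta ^+ 2].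

Definition is_sign (d : R) : Prop := d = 1 \/ d = -1.

Definition is_rotation (g : 'M[R]_4) : Prop := g *m g^T = 1%:M /\ \det g = 1.

(* Exchange of a1 with a2 and of b1 with b2. *)
Definition swap12 (u : vertex) : vertex :=
  match nat_of_ord u.1 with
  | 0%N => (a2.1, u.2)
  | 1%N => (a1.1, u.2)
  | _ => u
  end.

Definition admits_parametrization (l : edge -> R) (G : set config) : Prop :=
  exists (sigma : vertex -> vertex) (p1 p2 q1 q2 : R),
    [/\ sigma = id \/ sigma = swap12, `|p1| != `|p2|, `|q1| != `|q2| &
      forall P, flexion l G P <->
        exists (g : 'M[R]_4) (d1 d2 e1 e2 theta : R),
          [/\ is_rotation g,
              [/\ is_sign d1, is_sign d2, is_sign e1 & is_sign e2],
              admissible p1 p2 q1 q2 theta &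
              forall u, P (sigma u) =
                standard_octahedron p1 p2 q1 q2 d1 d2 e1 e2 theta u *m g]].

End Octahedra.

(* Main.v *)
(* Idea.  Since R(t1)/R(t3) has degree 2, the biquadratic relation between t1 and t3 at a2,
   with t3 written as a reduced fraction in t1, splits by coprimality: A = D = 0 or B = E = 0.
   In other words the face angles at a2 are equal, or supplementary, in pairs; the same holds
   at a1.  If a1 and a2 were of the same kind, eliminating t3 would give a second relation
   between t1 and t2, not proportional to the one at a3.  If they are of different kinds, the
   half-tangents at the edges towards b3 are, up to sign, those at the edges towards a3, so the
   relations at a3 and b3 are proportional and so are the cosines of the angles there.
   Spherical trigonometry then makes the edges from a1, b1 to a2, b2 right and determines the
   lengths of the edges at b3 from those at a3, and octahedra with such edge lengths are in
   standard position up to a rotation.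

   Conversely, in terms of w = cos(theta)^2 the octahedra of the family form the curve
   Y_i^2 = w - p_i^2, Z_j^2 = 1 - q_j^2 - w.  Its ring of functions is a tower of quadratic
   extensions of R[w] with distinct branch points, so by Kummer theory a polynomial vanishing
   at infinitely many points of the curve vanishes on it: the component is the whole curve.
   Up to constants, the half-tangents at the edges from (0, i) to (1, j) are Z_j / Y_i, and
   the same tower gives the degrees. *)

From HB Require Import structures.
Require Import Defs.
From mathcomp Require Import all_boot all_order all_algebra.
From mathcomp Require Import all_classical all_reals all_analysis.
From mathcomp Require Import -(notations) mpoly.
From mathcomp Require Import finmap zify ring lra.

Set Implicit Arguments.
Unset Strict Implicit.
Unset Printing Implicit Defensive.

Import Order.TTheory GRing.Theory Num.Theory.

Local Open Scope classical_set_scope.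
Local Open Scope ring_scope.

(** * Quadratic towers of functions *)

Section PolynomialFacts.
Variable R : realType.
Implicit Types (p g h a b : {poly R}) (r : R).

Lemma poly_infinite_roots (S : set R) p :
  infinite_set S -> (forall x, S x -> p.[x] = 0) -> p = 0.
Proof.
move=> Sinf Sp; apply: contrapT => /eqP p0.
have [B BS sB] := infinite_set_fset (size p) Sinf.
have Br : all (root p) (enum_fset B).
  by apply/allP => x /BS /Sp px; rewrite rootE px.
by have := max_poly_roots p0 Br (fset_uniq B); rewrite ltnNge sB.
Qed.

Definition nonsquare g := forall a b, a ^+ 2 = g * b ^+ 2 -> b = 0.

Definition simple_root r g := exists2 h, g = ('X - r%:P) * h & h.[r] != 0.

Lemma simple_root_nonsquare r g : simple_root r g -> nonsquare g.
Proof.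
case=> h -> hr a b; have [n le_bn] := ubnP (size b).
elim: n a b le_bn => // n IHn a b le_bn eab.
have ra : root a r.
  by rewrite -[root a r]orbb -rootM -expr2 eab rootE hornerM hornerM hornerXsubC subrr !mul0r.
have [a' ea] := factor_theorem _ _ ra.
have X0 : ('X - r%:P : {poly R}) != 0 by rewrite polyXsubC_eq0.
have ea' : ('X - r%:P) * a' ^+ 2 = h * b ^+ 2.
  apply: (mulfI X0); rewrite [RHS]mulrA -eab ea; move: ('X - _) => Z; ring.
have rb : root b r.
  rewrite -[root b r]orbb -rootM -expr2 rootE; apply/eqP.
  have := congr1 (horner^~ r) ea'; rewrite /= [LHS]hornerM [RHS]hornerM hornerXsubC subrr mul0r => /esym/eqP.
  by rewrite mulf_eq0 (negPf hr) /= => /eqP.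
have [b' eb] := factor_theorem _ _ rb.
have [->|b0] := eqVneq b 0; first by [].
suff b'0 : b' = 0 by rewrite eb b'0 mul0r.
apply: (IHn a').
  have b'0 : b' != 0 by apply: contraNneq b0 => b'0; rewrite eb b'0 mul0r.
  by move: le_bn; rewrite eb size_Mmonic ?monicXsubC // size_XsubC addn2 ltnS.
by apply: (mulfI X0); rewrite ea' eb; move: ('X - _) => Z; ring.
Qed.

Lemma simple_rootM r g h : simple_root r g -> h.[r] != 0 -> simple_root r (g * h).
Proof.
case=> k -> kr hr; exists (k * h); first by rewrite mulrA.
by rewrite hornerM mulf_neq0.
Qed.

End PolynomialFacts.

Section QuadraticTower.
Variables (R : realType) (T : Type) (w : T -> R) (y : nat -> T -> R).
Variable h : nat -> {poly R}.
Hypothesis y_sqr : forall k t, y k t ^+ 2 = (h k).[w t].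
Hypothesis w_infinite : infinite_set (range w).
Implicit Types (f g a b : T -> R) (k : nat) (p : {poly R}).

(* The ring R[w, y_0, ..., y_(k-1)] as a ring of functions on T. *)
Fixpoint tower k f : Prop :=
  if k is k'.+1 then exists a b, [/\ tower k' a, tower k' b &
    forall t, f t = a t + b t * y k' t]
  else exists p, forall t, f t = p.[w t].

Lemma tower_ext k f g : tower k f -> f =1 g -> tower k g.
Proof.
case: k => [[p hp] fg|k [a [b [ha hb hf]]] fg].
  by exists p => t; rewrite -fg.
by exists a, b; split=> // t; rewrite -fg.
Qed.

Lemma tower_poly k p : tower k (fun t => p.[w t]).
Proof.
elim: k p => [|k IHk] p; first by exists p.
exists (fun t => p.[w t]), (fun t => (0 : {poly R}).[w t]); split=> // t.
by rewrite horner0 mul0r addr0.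
Qed.

Lemma tower_cst k (c : R) : tower k (fun=> c).
Proof. by apply: (tower_ext (tower_poly k c%:P)) => t; rewrite hornerC. Qed.

Lemma towerD k f g : tower k f -> tower k g -> tower k (fun t => f t + g t).
Proof.
elim: k f g => [|k IHk] f g.
  by case=> p hp [q hq]; exists (p + q) => t; rewrite hornerD hp hq.
case=> a [b [ha hb hf]] [c [d [hc hd hg]]].
exists (fun t => a t + c t), (fun t => b t + d t); split; [exact: IHk|exact: IHk|].
by move=> t; rewrite hf hg; ring.
Qed.

Lemma towerM k f g : tower k f -> tower k g -> tower k (fun t => f t * g t).
Proof.
elim: k f g => [|k IHk] f g.
  by case=> p hp [q hq]; exists (p * q) => t; rewrite hornerM hp hq.
case=> a [b [ha hb hf]] [c [d [hc hd hg]]].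
exists (fun t => a t * c t + b t * d t * (h k).[w t]), (fun t => a t * d t + b t * c t).
split; [| |by move=> t; rewrite hf hg -y_sqr; ring].
  by apply: towerD; [exact: IHk|apply: (IHk); [exact: IHk|exact: tower_poly]].
by apply: towerD; exact: IHk.
Qed.

Lemma towerN k f : tower k f -> tower k (fun t => - f t).
Proof.
move=> hf; apply: (tower_ext (towerM (tower_cst k (-1)) hf)) => t.
by rewrite mulN1r.
Qed.

Lemma towerB k f g : tower k f -> tower k g -> tower k (fun t => f t - g t).
Proof. by move=> hf hg; apply: towerD => //; exact: towerN. Qed.

Lemma towerX k f n : tower k f -> tower k (fun t => f t ^+ n).
Proof.
move=> hf; elim: n => [|n IHn].
  by apply: (tower_ext (tower_cst k 1)) => t; rewrite expr0.
by apply: (tower_ext (towerM hf IHn)) => t; rewrite exprS.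
Qed.

Lemma towerS k f : tower k f -> tower k.+1 f.
Proof.
move=> hf; exists f, (fun=> 0); split=> [//||t]; first exact: tower_cst.
by rewrite mul0r addr0.
Qed.

Lemma tower_gen k : tower k.+1 (y k).
Proof.
exists (fun=> 0), (fun=> 1); split=> [||t]; [exact: tower_cst..|].
by rewrite add0r mul1r.
Qed.

Lemma tower_le k l f : (k <= l)%N -> tower k f -> tower l f.
Proof.
move=> /subnK <-; elim: (l - k)%N => [//|n IHn] hf; rewrite addSn.
exact/towerS/IHn.
Qed.

Lemma tower_sum k (I : Type) (r : seq I) (F : I -> T -> R) :
  (forall i, tower k (F i)) -> tower k (fun t => \sum_(i <- r) F i t).
Proof.
move=> hF; elim: r => [|i r IHr].
  by apply: (tower_ext (tower_cst k 0)) => t; rewrite big_nil.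
by apply: (tower_ext (towerD (hF i) IHr)) => t; rewrite big_cons.
Qed.

Lemma tower_prod k (I : Type) (r : seq I) (F : I -> T -> R) :
  (forall i, tower k (F i)) -> tower k (fun t => \prod_(i <- r) F i t).
Proof.
move=> hF; elim: r => [|i r IHr].
  by apply: (tower_ext (tower_cst k 1)) => t; rewrite big_nil.
by apply: (tower_ext (towerM (hF i) IHr)) => t; rewrite big_cons.
Qed.

Fixpoint nonsquare_upto k (g : {poly R}) : Prop :=
  if k is k'.+1 then nonsquare_upto k' g /\ nonsquare_upto k' (g * h k')
  else nonsquare g.

Definition tower_nonsquare k (g : {poly R}) := forall a b, tower k a -> tower k b ->
  (forall t, a t ^+ 2 = g.[w t] * b t ^+ 2) -> forall t, b t = 0.

Definition vanishing_extends k := forall f (S : set T), tower k f ->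
  infinite_set (w @` S) -> (forall t, S t -> f t = 0) -> forall t, f t = 0.

Lemma tower_domain k f g : vanishing_extends k -> tower k f -> tower k g ->
  (forall t, f t * g t = 0) -> (forall t, f t = 0) \/ (forall t, g t = 0).
Proof.
move=> vk hf hg fg0.
have [fin|inf] := pselect (finite_set (w @` [set t | f t = 0])); last first.
  by left; apply: vk hf inf _.
right; apply: (vk g [set t | g t = 0] hg) => // gfin; apply: w_infinite.
apply: (@sub_finite_set _ _ (w @` [set t | f t = 0] `|` w @` [set t | g t = 0])).
  move=> _ [t _ <-]; have /eqP := fg0 t; rewrite mulf_eq0.
  by case/orP=> /eqP ht; [left|right]; exists t.
by rewrite finite_setU.
Qed.

Lemma vanishing_extends0 : vanishing_extends 0.
Proof.
move=> f S [p hp] Sinf fS t; rewrite hp.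
suff -> : p = 0 by rewrite horner0.
by apply: (poly_infinite_roots Sinf) => _ [u Su <-]; rewrite -hp fS.
Qed.

Lemma vanishing_extendsS k : vanishing_extends k -> tower_nonsquare k (h k) ->
  vanishing_extends k.+1.
Proof.
move=> vk nk f S [a [b [ha hb hf]]] Sinf fS.
have sq : forall t, a t ^+ 2 = (h k).[w t] * b t ^+ 2.
  move=> t; apply/eqP; rewrite -subr_eq0; apply/eqP; move: t.
  apply: (vk _ S) => //.
    apply: towerB; first exact: towerX.
    by apply: towerM; [exact: tower_poly|exact: towerX].
  move=> t /fS; rewrite hf -y_sqr => /eqP; rewrite addr_eq0 => /eqP ->; ring.
have b0 := nk _ _ ha hb sq.
move=> t; rewrite hf b0 mul0r addr0; apply/eqP.
by rewrite -sqrf_eq0 sq b0 expr0n mulr0.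
Qed.

Lemma tower_indep k a b : tower_nonsquare k (h k) -> tower k a -> tower k b ->
  (forall t, a t + b t * y k t = 0) -> (forall t, a t = 0) /\ (forall t, b t = 0).
Proof.
move=> nk ha hb h0.
have sq t : a t ^+ 2 = (h k).[w t] * b t ^+ 2.
  by have /eqP := h0 t; rewrite -y_sqr addr_eq0 => /eqP ->; ring.
have b0 := nk _ _ ha hb sq; split=> // t.
by have := h0 t; rewrite b0 mul0r addr0.
Qed.

Lemma tower_nonsquare0 (g : {poly R}) : nonsquare g -> tower_nonsquare 0 g.
Proof.
move=> ng a b [p hp] [q hq] e t.
have pq : p ^+ 2 - g * q ^+ 2 = 0.
  apply: (poly_infinite_roots w_infinite) => _ [u _ <-].
  by rewrite hornerD hornerN horner_exp hornerM horner_exp -hp -hq e subrr.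
by rewrite hq (ng p q) ?horner0 //; apply/eqP; rewrite -subr_eq0 pq.
Qed.

(* Kummer theory: if g is a square u + v y_k in the field above, then u v = 0,
   so g or g h_k is a square one step below. *)
Lemma tower_nonsquareS k (g : {poly R}) : vanishing_extends k -> tower_nonsquare k (h k) ->
  tower_nonsquare k g -> tower_nonsquare k (g * h k) -> tower_nonsquare k.+1 g.
Proof.
move=> vk nh ng ngh a b [a0 [a1 [ha0 ha1 ha]]] [b0 [b1 [hb0 hb1 hb]]] e.
have hh : tower k (fun t => (h k).[w t]) by exact: tower_poly.
have hg : tower k (fun t => g.[w t]) by exact: tower_poly.
pose u t := a0 t * b0 t - a1 t * b1 t * (h k).[w t].
pose v t := a1 t * b0 t - a0 t * b1 t.
pose n t := b0 t ^+ 2 - b1 t ^+ 2 * (h k).[w t].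
have hu : tower k u by apply: towerB; do ?apply: towerM.
have hv : tower k v by apply: towerB; do ?apply: towerM.
have hn : tower k n by apply: towerB; do ?apply: towerM; do ?apply: towerX.
have uvn t : (u t + v t * y k t) ^+ 2 = g.[w t] * n t ^+ 2.
  have -> : u t + v t * y k t = a t * (b0 t - b1 t * y k t).
    by rewrite ha /u /v -y_sqr; ring.
  have -> : n t = b t * (b0 t - b1 t * y k t) by rewrite hb /n -y_sqr; ring.
  by rewrite exprMn e; ring.
have [uv0 uv2] : (forall t, u t ^+ 2 + v t ^+ 2 * (h k).[w t] - g.[w t] * n t ^+ 2 = 0)
    /\ (forall t, 2 * (u t * v t) = 0).
  apply: (tower_indep nh).
  - by apply: towerB; [apply: towerD; do ?apply: towerM|apply: towerM => //];
      do ?apply: towerX.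
  - by apply: towerM; [exact: tower_cst|exact: towerM].
  - by move=> t; rewrite -uvn -y_sqr; ring.
have n0 : forall t, n t = 0.
  have [] := tower_domain vk hu hv.
  - move=> t; have /eqP := uv2 t; rewrite mulf_eq0 pnatr_eq0 /= => /eqP //.
  - move=> u0; apply: (ngh (fun t => v t * (h k).[w t])) => //; first exact: towerM.
    move=> t; have := uv0 t; rewrite u0 hornerM => /eqP; rewrite subr_eq0 => /eqP E.
    by transitivity ((h k).[w t] * (0 ^+ 2 + v t ^+ 2 * (h k).[w t]));
      [ring|rewrite E; ring].
  - move=> v0; apply: (ng u) => // t.
    by have /eqP := uv0 t; rewrite v0 subr_eq0 => /eqP <-; ring.
have b10 : forall t, b1 t = 0.
  apply: (nh b0) => // t; have /eqP := n0 t; rewrite subr_eq0 => /eqP ->; ring.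
move=> t; rewrite hb b10 mul0r addr0; apply/eqP; rewrite -sqrf_eq0.
by have := n0 t; rewrite /n b10 expr0n mul0r subr0 => ->.
Qed.

Lemma tower_main k : (forall j, (j < k)%N -> nonsquare_upto j (h j)) ->
  vanishing_extends k /\ forall g : {poly R}, nonsquare_upto k g -> tower_nonsquare k g.
Proof.
elim: k => [|k IHk] hk; first by split; [exact: vanishing_extends0|exact: tower_nonsquare0].
have [vk nk] := IHk (fun j jk => hk j (ltnW jk)).
have nh := nk _ (hk k (ltnSn k)).
split; first exact: vanishing_extendsS.
by move=> g [g1 g2]; apply: tower_nonsquareS => //; exact: nk.
Qed.

Lemma simple_root_upto k r (g : {poly R}) : simple_root r g ->
  (forall j, (j < k)%N -> (h j).[r] != 0) -> nonsquare_upto k g.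
Proof.
elim: k g => [|k IHk] g hg hk; first exact: simple_root_nonsquare hg.
have hk' j : (j < k)%N -> (h j).[r] != 0 by move=> jk; exact/hk/ltnW.
split; first exact: IHk.
by apply: IHk => //; apply: simple_rootM => //; exact: hk.
Qed.

End QuadraticTower.

(** * Subfields and rational functions *)

Section Subfields.
Variable F : fieldType.
Implicit Types (K L : set F) (x y t : F).

Definition is_subfield K :=
  [/\ K 1, forall x y, K x -> K y -> K (x - y) & forall x y, K x -> K y -> K (x / y)].

Section Closure.
Variable K : set F.
Hypothesis sK : is_subfield K.

Lemma subfield1 : K 1. Proof. by case: sK. Qed.

Lemma subfieldB x y : K x -> K y -> K (x - y).
Proof. by case: sK => _ + _; apply. Qed.

Lemma subfield_div x y : K x -> K y -> K (x / y).
Proof. by case: sK => _ _; apply. Qed.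

Lemma subfield0 : K 0.
Proof. by rewrite -(subrr 1); apply: subfieldB; exact: subfield1. Qed.

Lemma subfieldN x : K x -> K (- x).
Proof. by move=> hx; rewrite -sub0r; apply: subfieldB => //; exact: subfield0. Qed.

Lemma subfieldD x y : K x -> K y -> K (x + y).
Proof. by move=> hx hy; rewrite -(opprK y); apply: subfieldB => //; exact: subfieldN. Qed.

Lemma subfieldV x : K x -> K x^-1.
Proof. by move=> hx; rewrite -div1r; apply: subfield_div => //; exact: subfield1. Qed.

Lemma subfieldM x y : K x -> K y -> K (x * y).
Proof. by move=> hx hy; rewrite -(invrK y); apply: subfield_div => //; exact: subfieldV. Qed.

Lemma subfieldX x n : K x -> K (x ^+ n).
Proof.
move=> hx; elim: n => [|n IHn]; first by rewrite expr0; exact: subfield1.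
by rewrite exprS; exact: subfieldM.
Qed.

Lemma subfieldMn x n : K x -> K (x *+ n).
Proof.
move=> hx; elim: n => [|n IHn]; first by rewrite mulr0n; exact: subfield0.
by rewrite mulrS; exact: subfieldD.
Qed.

Lemma subfield_nat n : K n%:R.
Proof. by apply: subfieldMn; exact: subfield1. Qed.

Lemma subfield_indep t a b : ~ K t -> K a -> K b -> a + b * t = 0 -> a = 0 /\ b = 0.
Proof.
move=> Kt Ka Kb e; have [b0|b0] := eqVneq b 0.
  by move: e; rewrite b0 mul0r addr0.
case: Kt; have -> : t = - a / b.
  by apply: (mulfI b0); rewrite mulrCA divff // mulr1 -[RHS]add0r -e; ring.
by apply: subfield_div => //; exact: subfieldN.
Qed.

End Closure.

Definition adjoin K t : set F := [set x | exists a b, [/\ K a, K b & x = a + b * t]].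

Lemma adjoin_sub K t x : is_subfield K -> K x -> adjoin K t x.
Proof.
by move=> sK Kx; exists x, 0; rewrite mul0r addr0; split=> //; exact: subfield0.
Qed.

Lemma adjoin_gen K t : is_subfield K -> adjoin K t t.
Proof.
move=> sK; exists 0, 1; rewrite add0r mul1r; split=> //; first exact: subfield0.
exact: subfield1.
Qed.

Lemma adjoin_subfield K t r s : is_subfield K -> K r -> K s -> ~ K t ->
  t ^+ 2 = r * t + s -> is_subfield (adjoin K t).
Proof.
move=> sK Kr Ks Kt et; split.
- exact/(adjoin_sub _ sK)/(subfield1 sK).
- move=> _ _ [a [b [Ka Kb ->]]] [c [d [Kc Kd ->]]].
  by exists (a - c), (b - d); split; [exact: subfieldB..|ring].
have mulK x y : adjoin K t x -> adjoin K t y -> adjoin K t (x * y).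
  move=> [a [b [Ka Kb ->]]] [c [d [Kc Kd ->]]].
  exists (a * c + b * d * s), (a * d + b * c + b * d * r); split.
  - by apply: (subfieldD sK); do ?apply: (subfieldM sK).
  - by do ?apply: (subfieldD sK); do ?apply: (subfieldM sK).
  - transitivity (a * c + (a * d + b * c) * t + b * d * t ^+ 2); first by ring.
    by rewrite et; ring.
move=> x y Kx [c [d [Kc Kd ey]]]; apply: mulK => //.
have [->|y0] := eqVneq y 0.
  by rewrite invr0; exact/(adjoin_sub _ sK)/(subfield0 sK).
(* the conjugate of c + d t is c + d r - d t *)
pose n := c ^+ 2 + c * d * r - d ^+ 2 * s.
have en : y * (c + d * r - d * t) = n.
  transitivity (c ^+ 2 + c * d * r + d ^+ 2 * r * t - d ^+ 2 * t ^+ 2).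
    by rewrite ey; ring.
  by rewrite et /n; ring.
have Kn : K n.
  by do ?apply: (subfieldD sK); try apply: (subfieldN sK); do ?apply: (subfieldM sK);
    do ?apply: (subfieldX sK).
have n0 : n != 0.
  apply/eqP => n0; move/eqP: en; rewrite n0 mulf_eq0 (negPf y0) /= => /eqP e0.
  have [] := @subfield_indep K sK t (c + d * r) (- d) Kt.
  - by apply: (subfieldD sK) => //; exact: subfieldM.
  - exact: subfieldN.
  - by rewrite -e0; ring.
  move=> cd0 /eqP; rewrite oppr_eq0 => /eqP d0.
  by move: cd0 y0; rewrite ey d0 !mul0r !addr0 => ->; rewrite eqxx.
have -> : y^-1 = (c + d * r) / n + (- d / n) * t.
  apply: (mulfI y0); rewrite divff //; apply: (mulIf n0); rewrite mul1r -{1}en.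
  by field.
exists ((c + d * r) / n), (- d / n); split => //.
  by apply: (subfield_div sK) => //; apply: (subfieldD sK) => //; exact: subfieldM.
by apply: (subfield_div sK) => //; exact: subfieldN.
Qed.

Lemma adjoin_degree K t : is_subfield K -> ~ K t -> extension_degree (adjoin K t) K 2.
Proof.
move=> sK Kt; split; first by move=> x; exact: adjoin_sub.
exists (fun i : 'I_2 => if i == ord0 then 1 else t); split.
  move=> i; case: eqP => _; last exact: adjoin_gen.
  exact/(adjoin_sub _ sK)/(subfield1 sK).
move=> x [a [b [Ka Kb ->]]].
exists [ffun i : 'I_2 => if i == ord0 then a else b]; split.
  split; first by move=> i; rewrite ffunE; case: eqP.
  by rewrite !big_ord_recl big_ord0 !ffunE /= mulr1 addr0.
move=> c [Kc]; rewrite !big_ord_recl big_ord0 /= mulr1 addr0 => e.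
set c0 := c ord0 in e; set c1 := c (lift ord0 ord0) in e.
have [] := @subfield_indep K sK t (a - c0) (b - c1) Kt.
- exact: (subfieldB sK Ka (Kc _)).
- exact: (subfieldB sK Kb (Kc _)).
- by transitivity ((a + b * t) - (c0 + c1 * t)); [ring|rewrite e subrr].
move=> /eqP; rewrite subr_eq0 => /eqP ea /eqP; rewrite subr_eq0 => /eqP eb.
apply/ffunP => i; rewrite ffunE; case: eqP => [->//|]; rewrite eb /c1.
case: i => [[|[|]]] //= ? ni; last by congr (c _); apply: val_inj.
by case: ni; apply: val_inj.
Qed.

Lemma adjoin_degree4 K t u : is_subfield K -> is_subfield (adjoin K t) ->
  ~ K t -> ~ adjoin K t u -> extension_degree (adjoin (adjoin K t) u) K 4.
Proof.
move=> sK sL Kt Lu; split.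
  by move=> x Kx; apply: adjoin_sub => //; exact: adjoin_sub.
pose b (i : 'I_4) := nth 0 [:: 1; t; u; t * u] i.
have Lt : adjoin K t t by exact: adjoin_gen.
have L0 := subfield0 sL; have L1 := subfield1 sL.
exists b; split.
  case=> [[|[|[|[|]]]]] //= ?; rewrite /b /=.
  - exact: adjoin_sub.
  - exact: adjoin_sub.
  - exact: adjoin_gen.
  - by exists 0, t; rewrite add0r.
move=> _ [_ [_ [[a0 [a1 [Ka0 Ka1 ->]]] [a2 [a3 [Ka2 Ka3 ->]]] ->]]].
exists [ffun i : 'I_4 => nth 0 [:: a0; a1; a2; a3] i]; split.
  split; first by case=> [[|[|[|[|]]]]] //= ?; rewrite ffunE.
  by rewrite !big_ord_recl big_ord0 !ffunE /b /=; ring.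
move=> c [Kc]; rewrite !big_ord_recl big_ord0 /b /= => e.
set c0 := c _ in e; set c1 := c _ in e; set c2 := c _ in e; set c3 := c _ in e.
have [] := @subfield_indep _ sL u ((a0 - c0) + (a1 - c1) * t) ((a2 - c2) + (a3 - c3) * t) Lu.
- by exists (a0 - c0), (a1 - c1); split=> //; exact: (subfieldB sK _ (Kc _)).
- by exists (a2 - c2), (a3 - c3); split=> //; exact: (subfieldB sK _ (Kc _)).
- transitivity ((a0 + a1 * t + (a2 + a3 * t) * u)
     - (c0 * 1 + (c1 * t + (c2 * u + (c3 * (t * u) + 0))))); first by ring.
  by rewrite e subrr.
move=> /(subfield_indep sK Kt (subfieldB sK Ka0 (Kc _)) (subfieldB sK Ka1 (Kc _))) [].
move=> /eqP + /eqP; rewrite !subr_eq0 => /eqP e0 /eqP e1.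
move=> /(subfield_indep sK Kt (subfieldB sK Ka2 (Kc _)) (subfieldB sK Ka3 (Kc _))) [].
move=> /eqP + /eqP; rewrite !subr_eq0 => /eqP e2 /eqP e3.
apply/ffunP; case=> [[|[|[|[|]]]]] //= ?; rewrite ffunE /=;
  rewrite ?e0 ?e1 ?e2 ?e3; congr (c _); exact: val_inj.
Qed.

Lemma degree2_neq K E : is_subfield K -> extension_degree E K 2 -> ~ E `<=` K.
Proof.
move=> sK [_ [b [Eb hb]]] EK; have Kb i : K (b i) by exact/EK/Eb.
pose z : {ffun 'I_2 -> F} := [ffun=> 0].
have uniq0 (x : F) (c d : {ffun 'I_2 -> F}) : E x -> (forall i, K (c i)) ->
    x = \sum_i c i * b i -> (forall i, K (d i)) -> x = \sum_i d i * b i -> c = d.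
  by move=> /hb [e [_ eu]] Kc xc Kd xd; rewrite -(eu c) // -(eu d).
have Eb0 := Eb ord0; set o1 : 'I_2 := lift ord0 ord0.
pose c : {ffun 'I_2 -> F} := [ffun i => if i == ord0 then 1 else 0].
pose d : {ffun 'I_2 -> F} := [ffun i => if i == ord0 then 1 + b o1 else - b ord0].
have cb : b ord0 = \sum_i c i * b i.
  by rewrite !big_ord_recl big_ord0 !ffunE /= mul1r mul0r !addr0.
have db : b ord0 = \sum_i d i * b i.
  by rewrite !big_ord_recl big_ord0 !ffunE /= /o1; ring.
have Kc i : K (c i) by rewrite ffunE; case: eqP => _; [exact: subfield1|exact: subfield0].
have Kd i : K (d i).
  rewrite ffunE; case: eqP => _; last exact: subfieldN.
  by apply: (subfieldD sK) => //; exact: subfield1.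
have ecd := uniq0 _ c d Eb0 Kc cb Kd db.
have b00 : b ord0 = 0.
  have := congr1 (fun f : {ffun 'I_2 -> F} => f o1) ecd.
  by rewrite !ffunE /= => /esym/eqP; rewrite oppr_eq0 => /eqP.
have ezc : z = c.
  apply: (uniq0 _ z c Eb0) => //; first by move=> i; rewrite ffunE; exact: subfield0.
  by rewrite b00 big1 // => i _; rewrite ffunE mul0r.
have /eqP := congr1 (fun f : {ffun 'I_2 -> F} => f ord0) ezc.
by rewrite !ffunE eqxx eq_sym oner_eq0.
Qed.

End Subfields.

Section RationalFunctions.
Variables (R : realType) (F : fieldType) (iota : {rmorphism R -> F}).
Implicit Types (f g p q : {poly R}) (t x y : F) (L : set F).

Local Notation ev t := (fun p : {poly R} => (map_poly iota p).[t]).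

Lemma evC t c : (map_poly iota c%:P).[t] = iota c.
Proof. by rewrite map_polyC hornerC. Qed.

Lemma evX t : (map_poly iota 'X).[t] = t.
Proof. by rewrite map_polyX hornerX. Qed.

Lemma evD t p q : (map_poly iota (p + q)).[t] = (map_poly iota p).[t] + (map_poly iota q).[t].
Proof. by rewrite rmorphD hornerD. Qed.

Lemma evN t p : (map_poly iota (- p)).[t] = - (map_poly iota p).[t].
Proof. by rewrite rmorphN hornerN. Qed.

Lemma evM t p q : (map_poly iota (p * q)).[t] = (map_poly iota p).[t] * (map_poly iota q).[t].
Proof. by rewrite rmorphM hornerM. Qed.

Lemma ev_exp t p n : (map_poly iota (p ^+ n)).[t] = (map_poly iota p).[t] ^+ n.
Proof. by rewrite rmorphXn horner_exp. Qed.

Definition evE := (evC, evX, evD, evN, ev_exp, evM).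

Definition rational_in t : set F := [set g | exists p q : {poly R},
  (map_poly iota q).[t] != 0 /\ g = (map_poly iota p).[t] / (map_poly iota q).[t]].

Lemma rational_in_poly t p : rational_in t (map_poly iota p).[t].
Proof. by exists p, 1; rewrite !evE rmorph1 divr1 oner_neq0. Qed.

Lemma rational_in_cst t c : rational_in t (iota c).
Proof. by rewrite -(evC t); exact: rational_in_poly. Qed.

Lemma rational_in_gen t : rational_in t t.
Proof. by rewrite -{2}(evX t); exact: rational_in_poly. Qed.

Lemma rational_in_subfield t : is_subfield (rational_in t).
Proof.
split.
- by rewrite -(rmorph1 iota); exact: rational_in_cst.
- move=> _ _ [p [q [q0 ->]]] [p' [q' [q'0 ->]]].
  exists (p * q' - p' * q), (q * q'); rewrite !evE; split; first by rewrite mulf_neq0.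
  by field; rewrite q0 q'0.
- move=> _ _ [p [q [q0 ->]]] [p' [q' [q'0 ->]]].
  have [p'0|p'0] := eqVneq (map_poly iota p').[t] 0.
    by rewrite p'0 mul0r invr0 mulr0 -(rmorph0 iota); exact: rational_in_cst.
  exists (p * q'), (q * p'); rewrite !evE; split; first by rewrite mulf_neq0.
  by field; rewrite q0 q'0 p'0.
Qed.

Lemma rational_in_min t L : is_subfield L -> (forall c, L (iota c)) -> L t ->
  rational_in t `<=` L.
Proof.
move=> sL Lc Lt _ [p [q [_ ->]]].
suff Lp f : L (map_poly iota f).[t] by apply: subfield_div.
elim/poly_ind: f => [|f c IHf].
  by rewrite rmorph0 horner0; exact: subfield0.
by rewrite !evE; apply: (subfieldD sL) => //; exact: subfieldM.
Qed.

Definition transcendental t := forall p, (map_poly iota p).[t] = 0 -> p = 0.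

Lemma rational_in_coprime t y : transcendental t -> rational_in t y ->
  exists f g, [/\ coprimep f g, g != 0 & y * (map_poly iota g).[t] = (map_poly iota f).[t]].
Proof.
move=> tr [p [q [q0 ->]]].
have qn0 : q != 0 by apply: contraNneq q0 => ->; rewrite rmorph0 horner0.
pose d := gcdp p q.
have dp : p = p %/ d * d by rewrite divpK // dvdp_gcdl.
have dq : q = q %/ d * d by rewrite divpK // dvdp_gcdr.
have d0 : d != 0 by rewrite gcdp_eq0 negb_and qn0 orbT.
exists (p %/ d), (q %/ d); split.
- by rewrite coprimep_div_gcd // qn0 orbT.
- by apply: contraNneq qn0 => e; rewrite dq e mul0r.
- set p' := p %/ d in dp *; set q' := q %/ d in dq *.
  have evd : (map_poly iota d).[t] != 0.
    by apply/eqP => /tr /eqP; rewrite (negPf d0).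
  have evq' : (map_poly iota q').[t] != 0.
    by move: q0; rewrite dq evM mulf_eq0 negb_or => /andP [].
  by rewrite dp dq !evM; field; rewrite evd evq'.
Qed.

Definition quad (a b : R) : {poly R} := a%:P * 'X ^+ 2 + b%:P.

Lemma coef_quad a b i : (quad a b)`_i = (if i == 2 then a else if i == 0%N then b else 0).
Proof.
rewrite /quad coefD coefCM coefXn coefC.
by case: i => [|[|[|i]]] /=; rewrite ?mulr0 ?mulr1 ?add0r ?addr0.
Qed.

Lemma size_quad a b : (size (quad a b) <= 3)%N.
Proof.
by apply/leq_sizeP => -[|[|[|j]]] //= _; rewrite coef_quad.
Qed.

Lemma quad_eq0 a b : quad a b = 0 -> a = 0 /\ b = 0.
Proof.
move=> e; have := congr1 (fun p : {poly R} => p`_2) e.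
have := congr1 (fun p : {poly R} => p`_0) e.
by rewrite !coef_quad !coef0.
Qed.

Lemma quad_transcendental t a b c : transcendental t ->
  iota a * t ^+ 2 + iota c * t + iota b = 0 -> [/\ a = 0, b = 0 & c = 0].
Proof.
move=> tr e.
have e0 : quad a b + c%:P * 'X = 0 by apply: tr; rewrite !evE -e; ring.
have := congr1 (fun p : {poly R} => p`_0) e0.
have := congr1 (fun p : {poly R} => p`_1) e0.
have := congr1 (fun p : {poly R} => p`_2) e0.
rewrite 3!coefD !coef_quad !coefCM !coefX !coef0 /= !mulr0 mulr1 !addr0 add0r.
by move=> -> -> ->.
Qed.

End RationalFunctions.

Section Biquadratic.
Variables (R : realType) (F : fieldType) (iota : {rmorphism R -> F}).
Implicit Types (f g p q h k : {poly R}) (t x y : F) (L : set F).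
Local Notation rational_in := (rational_in iota).
Local Notation transcendental := (transcendental iota).
Local Notation evE := (evE iota).

Lemma size_le2 f : (size f <= 2)%N -> f = (f`_1)%:P * 'X + (f`_0)%:P.
Proof.
move=> sf; apply/polyP => -[|[|i]]; rewrite !coefE ?mulr0 ?mulr1 ?add0r ?addr0 //=.
by rewrite nth_default // (leq_trans sf).
Qed.

Lemma mobius_inverse t y f g : coprimep f g -> g != 0 -> (size f <= 2)%N -> (size g <= 2)%N ->
  y * (map_poly iota g).[t] = (map_poly iota f).[t] -> transcendental t ->
  (forall c, y <> iota c) -> rational_in y t.
Proof.
move=> cfg g0 sf sg e tr yc.
set f1 := f`_1; set f0 := f`_0; set g1 := g`_1; set g0' := g`_0.
have sK := rational_in_subfield iota y.
have Kc := rational_in_cst iota y; have Ky := rational_in_gen iota y.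
have e' : (y * iota g1 - iota f1) * t = iota f0 - y * iota g0'.
  move: e; rewrite (size_le2 sf) (size_le2 sg) !evE -/f1 -/f0 -/g1 -/g0' => e.
  transitivity (y * (iota g1 * t + iota g0') - (iota f1 * t + iota f0) + iota f0 - y * iota g0').
    by ring.
  by rewrite e; ring.
have [z|nz] := eqVneq (y * iota g1 - iota f1) 0; last first.
  have -> : t = (iota f0 - y * iota g0') / (y * iota g1 - iota f1).
    by rewrite -e' mulrAC divff // mul1r.
  by apply: (subfield_div sK); apply: (subfieldB sK) => //; apply: (subfieldM sK).
have [g10|g10] := eqVneq g1 0.
  move: z; rewrite g10 rmorph0 mulr0 sub0r => /eqP; rewrite oppr_eq0 fmorph_eq0 => /eqP f10.
  move: e'; rewrite g10 f10 rmorph0 mulr0 subrr mul0r => /esym/eqP; rewrite subr_eq0 => /eqP e'.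
  have g00 : g0' != 0.
    by apply: contraNneq g0 => g00; rewrite (size_le2 sg) -/g1 -/g0' g10 g00 mul0r add0r.
  case: (yc (f0 / g0')); rewrite fmorph_div e' mulfK // fmorph_eq0 //.
case: (yc (f1 / g1)); move/eqP: z; rewrite subr_eq0 => /eqP z.
by rewrite fmorph_div -z mulfK // fmorph_eq0.
Qed.

Lemma size_absurd (m n : nat) : (0 < m)%N -> (2 < n)%N -> ((m + n).-1 <= 2)%N -> False.
Proof. by case: m n => [|m] [|[|[|n]]] //= _ _; rewrite !addnS. Qed.

Lemma size_eq1 (m n : nat) : (0 < m)%N -> (2 < n)%N -> (m + n <= 4)%N -> m = 1%N.
Proof. by lia. Qed.

Lemma biquadratic_split t y (a b c d e : R) : transcendental t -> rational_in t y ->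
  ~ rational_in y t -> c != 0 ->
  iota a * t ^+ 2 * y ^+ 2 + iota b * t ^+ 2 + 2 * iota c * t * y
    + iota d * y ^+ 2 + iota e = 0 ->
  (a = 0 /\ d = 0) \/ (b = 0 /\ e = 0).
Proof.
move=> tr ty yt c0 rel.
have [f [g [cfg g0 ey]]] := rational_in_coprime tr ty.
have polyrel : quad a d * f ^+ 2 + (2 * c)%:P * 'X * f * g + quad b e * g ^+ 2 = 0.
  apply: tr; rewrite /quad !evE -ey rmorphM rmorph_nat.
  transitivity ((map_poly iota g).[t] ^+ 2 * (iota a * t ^+ 2 * y ^+ 2 + iota b * t ^+ 2
     + 2 * iota c * t * y + iota d * y ^+ 2 + iota e)); last by rewrite rel mulr0.
  by ring.
have [/quad_eq0 [-> ->]|A0] := eqVneq (quad a d) 0; first by left.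
have [/quad_eq0 [-> ->]|B0] := eqVneq (quad b e) 0; first by right.
exfalso.
have f0 : f != 0.
  apply: contraNneq B0 => f0; move: polyrel.
  rewrite f0 expr0n !mulr0 mul0r !add0r => /eqP.
  by rewrite mulf_eq0 sqrf_eq0 (negPf g0) orbF.
have cgf2 : coprimep g (f ^+ 2) by rewrite coprimep_expr // coprimep_sym.
have cfg2 : coprimep f (g ^+ 2) by rewrite coprimep_expr.
have [h eh] : exists h : {poly R}, quad a d = h * g.
  apply/dvdpP; rewrite -(Gauss_dvdpr _ cgf2); apply/dvdpP.
  exists (- ((2 * c)%:P * 'X * f + quad b e * g)).
  by rewrite mulrC; apply/eqP; rewrite -subr_eq0 -polyrel; apply/eqP; ring.
have [k ek] : exists k : {poly R}, quad b e = k * f.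
  apply/dvdpP; rewrite -(Gauss_dvdpr _ cfg2); apply/dvdpP.
  exists (- ((2 * c)%:P * 'X * g + quad a d * f)).
  by rewrite mulrC; apply/eqP; rewrite -subr_eq0 -polyrel; apply/eqP; ring.
have key : h * f + k * g = - ((2 * c)%:P * 'X).
  apply: (mulIf f0); apply: (mulIf g0); apply/eqP; rewrite -subr_eq0 -polyrel eh ek.
  by apply/eqP; ring.
have h0 : h != 0 by apply: contraNneq A0 => h0; rewrite eh h0 mul0r.
have k0 : k != 0 by apply: contraNneq B0 => k0; rewrite ek k0 mul0r.
have shg : (size h + size g <= 4)%N.
  have := size_quad a d; rewrite eh size_mul //; case: (size h + size g)%N => //.
have skf : (size k + size f <= 4)%N.
  have := size_quad b e; rewrite ek size_mul //; case: (size k + size f)%N => //.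
have sX : size (- ((2 * c)%:P * 'X)) = 2%N.
  rewrite size_polyN size_Cmul ?size_polyX // mulf_neq0 //; exact: pnatr_neq0.
have sh1 : (0 < size h)%N by rewrite size_poly_gt0.
have sk1 : (0 < size k)%N by rewrite size_poly_gt0.
have [sf|sf] := leqP (size f) 2; have [sg|sg] := leqP (size g) 2.
- case: yt; apply: (mobius_inverse cfg g0 sf sg ey tr) => u yu; move: rel; rewrite yu => rel.
  have [] := @quad_transcendental _ _ iota t (a * u ^+ 2 + b) (d * u ^+ 2 + e) (2 * c * u) tr.
    by rewrite -rel; ring.
  move=> _ _ /eqP; rewrite !mulf_eq0 pnatr_eq0 (negPf c0) /= => /eqP u0.
  move: ey; rewrite yu u0 rmorph0 mul0r => /esym/tr /eqP; by rewrite (negPf f0).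
- have sh := size_eq1 sh1 sg shg.
  have : (size (k * g)%R <= 2)%N.
    have -> : k * g = - ((2 * c)%:P * 'X) - h * f by rewrite -key; ring.
    rewrite (leq_trans (size_polyD _ _)) // geq_max sX size_polyN /=.
    by rewrite size_mul // sh.
  by rewrite size_mul // => /(size_absurd sk1 sg).
- have sk := size_eq1 sk1 sf skf.
  have : (size (h * f)%R <= 2)%N.
    have -> : h * f = - ((2 * c)%:P * 'X) - k * g by rewrite -key; ring.
    rewrite (leq_trans (size_polyD _ _)) // geq_max sX size_polyN /=.
    by rewrite size_mul // sk.
  by rewrite size_mul // => /(size_absurd sh1 sf).
have [r r0 hr] : exists2 r, r != 0 & h = r%:P.
  by apply/size_poly1P; rewrite (size_eq1 sh1 sg shg).
have [s s0 ks] : exists2 s, s != 0 & k = s%:P.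
  by apply/size_poly1P; rewrite (size_eq1 sk1 sf skf).
have := congr1 (fun p : {poly R} => p`_1) key.
have g1 : g`_1 = 0.
  have := congr1 (fun p : {poly R} => p`_1) eh.
  by rewrite coef_quad hr coefCM /= => /esym/eqP; rewrite mulf_eq0 (negPf r0) => /eqP.
have f1 : f`_1 = 0.
  have := congr1 (fun p : {poly R} => p`_1) ek.
  by rewrite coef_quad ks coefCM /= => /esym/eqP; rewrite mulf_eq0 (negPf s0) => /eqP.
rewrite hr ks coefD !coefCM g1 f1 !mulr0 addr0 coefN coefCM coefX mulr1.
by move/esym/eqP; rewrite oppr_eq0 mulf_eq0 pnatr_eq0 (negPf c0).
Qed.

Lemma half_biquadratic_neq0 t y (c a b : R) : t != 0 -> y != 0 -> ~ rational_in y t -> c != 0 ->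
  2 * iota c * t + y * (iota a * t ^+ 2 + iota b) = 0 -> a != 0 /\ b != 0.
Proof.
move=> t0 y0 yt c0 e.
have sK := rational_in_subfield iota y.
have Kc := rational_in_cst iota y; have Ky := rational_in_gen iota y.
have c20 : 2 * iota c != 0.
  by rewrite -(rmorph_nat iota 2) -rmorphM fmorph_eq0 mulf_neq0 // pnatr_eq0.
have K2 : rational_in y (2 * iota c) by apply: (subfieldM sK) => //; exact: subfield_nat.
split; apply/negP => /eqP z; case: yt; move: e; rewrite z rmorph0.
  rewrite mul0r add0r => /eqP; rewrite addr_eq0 => /eqP e.
  have -> : t = - (y * iota b) / (2 * iota c) by rewrite -e mulrAC divff // mul1r.
  by apply: (subfield_div sK) => //; apply: (subfieldN sK); exact: subfieldM.
rewrite addr0 => e.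
have [a0|a0] := eqVneq a 0.
  by move/eqP: e; rewrite a0 rmorph0 mul0r mulr0 addr0 mulf_eq0 (negPf c20) (negPf t0).
have e' : t * (y * iota a) = - (2 * iota c).
  by apply: (mulIf t0); apply/eqP; rewrite -subr_eq0 -e; apply/eqP; ring.
have ya0 : y * iota a != 0 by rewrite mulf_neq0 // fmorph_eq0.
have -> : t = - (2 * iota c) / (y * iota a) by rewrite -e' mulfK.
by apply: (subfield_div sK); [exact: subfieldN|exact: subfieldM].
Qed.

Lemma quadratics_proportional L t (a2 a1 a0 b2 b1 b0 : F) : is_subfield L -> ~ L t ->
  L a2 -> L a1 -> L a0 -> L b2 -> L b1 -> L b0 ->
  a2 * t ^+ 2 + a1 * t + a0 = 0 -> b2 * t ^+ 2 + b1 * t + b0 = 0 ->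
  [/\ a1 * b2 = a2 * b1, a0 * b2 = a2 * b0 & a0 * b1 = a1 * b0].
Proof.
move=> sL Lt A2 A1 A0 B2 B1 B0 ea eb.
have [] := @subfield_indep _ L sL t (a0 * b2 - a2 * b0) (a1 * b2 - a2 * b1) Lt.
- by apply: (subfieldB sL); exact: subfieldM.
- by apply: (subfieldB sL); exact: subfieldM.
- transitivity (b2 * (a2 * t ^+ 2 + a1 * t + a0) - a2 * (b2 * t ^+ 2 + b1 * t + b0)); first by ring.
  by rewrite ea eb; ring.
move=> /eqP; rewrite subr_eq0 => /eqP e1 /eqP; rewrite subr_eq0 => /eqP e2; split=> //.
apply/eqP; rewrite -subr_eq0; apply/eqP.
transitivity (b1 * (a2 * t ^+ 2 + a1 * t + a0) - a1 * (b2 * t ^+ 2 + b1 * t + b0)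
   + (a1 * b2 - a2 * b1) * t ^+ 2); first by ring.
by rewrite ea eb e2; ring.
Qed.

Lemma biquadratic_unique t u (a b c d e a' b' c' d' e' : R) : transcendental t ->
  ~ rational_in t u -> c != 0 -> c' != 0 ->
  iota a * t ^+ 2 * u ^+ 2 + iota b * t ^+ 2 + 2 * iota c * t * u
    + iota d * u ^+ 2 + iota e = 0 ->
  iota a' * t ^+ 2 * u ^+ 2 + iota b' * t ^+ 2 + 2 * iota c' * t * u
    + iota d' * u ^+ 2 + iota e' = 0 ->
  [/\ a * c' = a' * c, b * c' = b' * c, d * c' = d' * c & e * c' = e' * c].
Proof.
move=> tr tu c0 c0' e1 e2.
have sL := rational_in_subfield iota t.
have Lp := rational_in_poly iota t.
have := @quadratics_proportional _ u (map_poly iota (quad a d)).[t]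
  (map_poly iota ((2 * c)%:P * 'X)).[t] (map_poly iota (quad b e)).[t]
  (map_poly iota (quad a' d')).[t]
  (map_poly iota ((2 * c')%:P * 'X)).[t] (map_poly iota (quad b' e')).[t] sL tu
  (Lp _) (Lp _) (Lp _) (Lp _) (Lp _) (Lp _).
rewrite /quad !evE !rmorphM !rmorph_nat => -[||].
- by rewrite -e1; ring.
- by rewrite -e2; ring.
have t0 : t != 0.
  by apply/eqP => t0; have := tr 'X; rewrite evE => /(_ t0)/eqP; rewrite polyX_eq0.
move=> eq1 _ eq3.
have t20 : 2 * t != 0 :> F.
  by rewrite mulf_neq0 // -(rmorph_nat iota) fmorph_eq0 pnatr_eq0.
have [] := @quad_transcendental _ _ iota t (a * c' - a' * c) (d * c' - d' * c) 0 tr.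
  by apply: (mulfI t20); move/eqP: eq1; rewrite mulr0 -subr_eq0 => /eqP eq1;
    rewrite -[RHS]oppr0 -eq1; ring.
move=> /eqP + /eqP; rewrite !subr_eq0 => /eqP -> /eqP -> _.
have [] := @quad_transcendental _ _ iota t (b * c' - b' * c) (e * c' - e' * c) 0 tr.
  by apply: (mulfI t20); move/eqP: eq3; rewrite mulr0 -subr_eq0 => /eqP eq3;
    rewrite -eq3; ring.
by move=> /eqP + /eqP; rewrite !subr_eq0 => /eqP -> /eqP -> _.
Qed.

Lemma no_mixed_term t u (a b c d e a' b' d' e' : R) : transcendental t ->
  ~ rational_in t u -> c != 0 -> a' != 0 -> b' != 0 -> d' != 0 ->
  iota a * t ^+ 2 * u ^+ 2 + iota b * t ^+ 2 + 2 * iota c * t * u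
    + iota d * u ^+ 2 + iota e = 0 ->
  iota a' * t * u ^+ 2 + (iota b' * t ^+ 2 + iota d') * u + iota e' * t = 0 -> False.
Proof.
move=> tr tu c0 a0' b0' d0' e1 e2.
have sL := rational_in_subfield iota t.
have Lp := rational_in_poly iota t.
have := @quadratics_proportional _ u (map_poly iota (quad a d)).[t]
  (map_poly iota ((2 * c)%:P * 'X)).[t] (map_poly iota (quad b e)).[t]
  (map_poly iota (a'%:P * 'X)).[t]
  (map_poly iota (quad b' d')).[t] (map_poly iota (e'%:P * 'X)).[t] sL tu
  (Lp _) (Lp _) (Lp _) (Lp _) (Lp _) (Lp _).
case.
- by rewrite /quad !evE -e1; ring.
- by rewrite /quad !evE -e2; ring.
rewrite -!evM => e3 _ _.
have {e3} e3 : (2 * c)%:P * 'X * (a'%:P * 'X) - quad a d * quad b' d' = 0.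
  by apply: tr; rewrite evD evN e3 subrr.
pose P : {poly R} := (a * b')%:P * 'X ^+ 4 + (a * d' + d * b' - 2 * c * a')%:P * 'X ^+ 2
  + (d * d')%:P.
have e4 : P = 0 by rewrite -[RHS]oppr0 -e3 /P /quad; ring.
have := congr1 (fun p : {poly R} => p`_4) e4.
have := congr1 (fun p : {poly R} => p`_2) e4.
have := congr1 (fun p : {poly R} => p`_0) e4.
rewrite /P !(coefD, coefCM, coefXn, coefC, coef0) /= !(mulr0, mulr1, add0r, addr0).
move=> /eqP; rewrite mulf_eq0 (negPf d0') orbF => /eqP ->.
move=> e5 /eqP; rewrite mulf_eq0 (negPf b0') orbF => /eqP az; move: e5; rewrite az.
rewrite !mul0r !add0r => /eqP.
by rewrite oppr_eq0 !mulf_eq0 pnatr_eq0 (negPf c0) (negPf a0').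
Qed.

Lemma poly_unit_const f (c : R) : f != 0 -> c != 0 -> f %| c%:P -> exists2 r, r != 0 & f = r%:P.
Proof.
move=> f0 c0 fc; apply/size_poly1P; rewrite eqn_leq size_poly_gt0 f0 andbT.
have cn0 : c%:P != 0 by rewrite polyC_eq0.
by have := dvdp_leq cn0 fc; rewrite size_polyC c0.
Qed.

Lemma quadratic_irrational_aux f g (a b c : R) : a != 0 -> b != 0 -> c != 0 ->
  coprimep f g -> g != 0 -> f.[0] = 0 ->
  'X * (a%:P * f ^+ 2 + b%:P * g ^+ 2) + c%:P * f * g = 0 -> False.
Proof.
move=> a0 b0 c0 cfg g0 f0 e.
have /factor_theorem [f1 ef] : root f 0 by rewrite rootE f0.
rewrite subr0 in ef.
have X0 : 'X != 0 :> {poly R} by rewrite polyX_eq0.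
have e1 : a%:P * f ^+ 2 + b%:P * g ^+ 2 + c%:P * f1 * g = 0.
  by apply: (mulfI X0); rewrite mulr0 -e ef; ring.
have cgf2 : coprimep g (f ^+ 2) by rewrite coprimep_expr // coprimep_sym.
have [r r0 eg] : exists2 r, r != 0 & g = r%:P.
  apply: (poly_unit_const g0 a0); rewrite -(Gauss_dvdpr _ cgf2); apply/dvdpP.
  exists (- (b%:P * g + c%:P * f1)).
  by rewrite mulrC; apply/eqP; rewrite -subr_eq0 -e1; apply/eqP; ring.
have f10 : f1 != 0.
  apply/eqP => f10; move: e1; rewrite ef f10 mul0r expr0n !mulr0 mul0r add0r addr0 => /eqP.
  by rewrite mulf_eq0 sqrf_eq0 polyC_eq0 (negPf b0) (negPf g0).
have [s s0 ef1] : exists2 s, s != 0 & f1 = s%:P.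
  apply: (@poly_unit_const f1 (b * r ^+ 2)) => //; first by rewrite mulf_neq0 ?expf_neq0.
  apply/dvdpP; exists (- (a%:P * f1 * 'X ^+ 2 + c%:P * g)).
  by apply/eqP; rewrite -subr_eq0 -e1 ef eg; apply/eqP; ring.
have e2 : (a * s ^+ 2)%:P * 'X ^+ 2 + (b * r ^+ 2 + c * s * r)%:P = 0.
  by rewrite -e1 ef ef1 eg; ring.
have := congr1 (fun p : {poly R} => p`_2) e2.
rewrite !(coefD, coefCM, coefXn, coefC, coef0) /= mulr1 addr0 => /eqP.
by rewrite mulf_eq0 sqrf_eq0 (negPf a0) (negPf s0).
Qed.

Lemma quadratic_irrational t y (a b c : R) : transcendental y ->
  a != 0 -> b != 0 -> c != 0 ->
  2 * iota c * t + y * (iota a * t ^+ 2 + iota b) = 0 -> ~ rational_in y t.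
Proof.
move=> tr a0 b0 c0 e ht.
have [f [g [cfg g0 eg]]] := rational_in_coprime tr ht.
have e1 : 'X * (a%:P * f ^+ 2 + b%:P * g ^+ 2) + (2 * c)%:P * f * g = 0.
  apply: tr; rewrite !evE -eg.
  transitivity ((map_poly iota g).[y] ^+ 2 * (2 * iota c * t + y * (iota a * t ^+ 2 + iota b))).
    by ring.
  by rewrite e mulr0.
have c20 : 2 * c != 0 by rewrite mulf_neq0 // pnatr_eq0.
have : f.[0] * g.[0] = 0.
  have := congr1 (horner^~ 0) e1; rewrite /= hornerD ![in X in X -> _]hornerM hornerX mul0r add0r.
  rewrite !hornerC => /eqP; rewrite !mulf_eq0.
  by rewrite -!mulf_eq0 (mulf_eq0 (2 * c * _)) (mulf_eq0 (2 * c)) (negPf c20) /= -mulf_eq0 => /eqP.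
move/eqP; rewrite mulf_eq0 => /orP [] /eqP z.
  exact: (quadratic_irrational_aux a0 b0 c20 cfg g0 z e1).
have f0 : f != 0.
  apply/eqP => f0; move: e1; rewrite f0 expr0n !mulr0 mul0r addr0 add0r => /eqP.
  by rewrite !mulf_eq0 polyX_eq0 polyC_eq0 (negPf b0) (negPf g0).
apply: (quadratic_irrational_aux b0 a0 c20 _ f0 z); first by rewrite coprimep_sym.
by rewrite -e1; ring.
Qed.

Lemma rational_in_adjoin t y r s : rational_in t y -> ~ rational_in y t ->
  rational_in y r -> rational_in y s -> t ^+ 2 = r * t + s ->
  rational_in t = adjoin (rational_in y) t.
Proof.
move=> ty yt Kr Ks et.
have sK := rational_in_subfield iota y; have sL := rational_in_subfield iota t.
have Kc := rational_in_cst iota y.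
have KL : rational_in y `<=` rational_in t.
  exact: (rational_in_min sL (rational_in_cst iota t)).
apply/seteqP; split.
  apply: rational_in_min; [exact: adjoin_subfield sK Kr Ks yt et| |exact: adjoin_gen].
  by move=> c; apply: adjoin_sub.
move=> _ [a [b [/KL Ka /KL Kb ->]]].
by apply: (subfieldD sL) => //; apply: (subfieldM sL) => //; exact: rational_in_gen.
Qed.

Lemma quartic_degrees t u y r s r' s' : rational_in t y -> rational_in u y ->
  ~ rational_in y t -> ~ rational_in t u ->
  rational_in y r -> rational_in y s -> t ^+ 2 = r * t + s ->
  rational_in y r' -> rational_in y s' -> u ^+ 2 = r' * u + s' ->
  (forall L, is_subfield L -> (forall c, L (iota c)) -> L t -> L u -> forall x, L x) ->
  [/\ rational_in y = rational_in t `&` rational_in u,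
      extension_degree setT (rational_in y) 4,
      extension_degree setT (rational_in t) 2 /\ extension_degree setT (rational_in u) 2 &
      extension_degree (rational_in t) (rational_in y) 2 /\
        extension_degree (rational_in u) (rational_in y) 2].
Proof.
move=> ty uy yt tu Kr Ks et Kr' Ks' eu top.
have sK := rational_in_subfield iota y; have sL := rational_in_subfield iota t.
have sM := rational_in_subfield iota u.
have KL : rational_in y `<=` rational_in t.
  exact: (rational_in_min sL (rational_in_cst iota t)).
have KM : rational_in y `<=` rational_in u.
  exact: (rational_in_min sM (rational_in_cst iota u)).
have yu : ~ rational_in y u by move=> /KL.
have Lt := rational_in_adjoin ty yt Kr Ks et.
have Mu := rational_in_adjoin uy yu Kr' Ks' eu.
have Lt1 := rational_in_gen iota t; have Mu1 := rational_in_gen iota u.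
have ut : ~ rational_in u t.
  rewrite Mu => -[a [b [Ka Kb e]]]; case: tu.
  have b0 : b != 0 by apply/eqP => b0; case: yt; rewrite e b0 mul0r addr0.
  have -> : u = (t - a) / b by rewrite {1}e addrC addKr mulrC mulKf.
  by apply: (subfield_div sL); [apply: (subfieldB sL) => //|]; exact: KL.
have topLu : adjoin (rational_in t) u = setT.
  apply/seteqP; split=> // x _; apply: (top (adjoin (rational_in t) u)).
  - by apply: (@adjoin_subfield _ _ _ r' s') => //; exact: KL.
  - by move=> c; apply: adjoin_sub => //; exact: rational_in_cst.
  - exact: adjoin_sub.
  - exact: adjoin_gen.
have topMt : adjoin (rational_in u) t = setT.
  apply/seteqP; split=> // x _; apply: (top (adjoin (rational_in u) t)).
  - by apply: (@adjoin_subfield _ _ _ r s) => //; exact: KM.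
  - by move=> c; apply: adjoin_sub => //; exact: rational_in_cst.
  - exact: adjoin_gen.
  - exact: adjoin_sub.
split.
- apply/seteqP; split=> [x Kx|x []]; first by split; [exact: KL|exact: KM].
  rewrite {1}Lt {1}Mu => -[a [b [Ka Kb ea]]] [c [d [Kc Kd ec]]].
  have [d0|d0] := eqVneq d 0; first by rewrite ec d0 mul0r addr0.
  case: tu; have -> : u = (a + b * t - c) / d by rewrite -ea ec addrC addKr mulrC mulKf.
  apply: (subfield_div sL); last exact: KL.
  apply: (subfieldB sL); last exact: KL.
  by apply: (subfieldD sL); [exact: KL|apply: (subfieldM sL) => //; exact: KL].
- by rewrite -topLu Lt; apply: adjoin_degree4 => //; rewrite -Lt.
- by split; [rewrite -topLu|rewrite -topMt]; exact: adjoin_degree.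
- by split; [rewrite Lt|rewrite Mu]; exact: adjoin_degree.
Qed.

End Biquadratic.

(** * Dihedral angles in R^4 *)

Section Geometry4.
Variable R : realType.
Local Notation vec := 'rV[R]_4.
Implicit Types (u v w x y z m n : vec) (a b c : R).

Definition i0 : 'I_4 := @Ordinal 4 0 isT.
Definition i1 : 'I_4 := @Ordinal 4 1 isT.
Definition i2 : 'I_4 := @Ordinal 4 2 isT.
Definition i3 : 'I_4 := @Ordinal 4 3 isT.

Lemma sum4 (V : nmodType) (f : 'I_4 -> V) : \sum_i f i = f i0 + f i1 + f i2 + f i3.
Proof.
rewrite !big_ord_recl big_ord0 addr0 !addrA.
by congr (f _ + f _ + f _ + f _); apply: val_inj.
Qed.

Lemma dotE x y : dot x y = x 0 i0 * y 0 i0 + x 0 i1 * y 0 i1 + x 0 i2 * y 0 i2 + x 0 i3 * y 0 i3.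
Proof. by rewrite /dot sum4. Qed.

Definition d4 (f : nat -> nat -> R) : R :=
  let d2 j k := f 2 j * f 3 k - f 2 k * f 3 j in
  let d3 i j k := f 1 i * d2 j k - f 1 j * d2 i k + f 1 k * d2 i j in
  f 0 0 * d3 1 2 3 - f 0 1 * d3 0 2 3 + f 0 2 * d3 0 1 3 - f 0 3 * d3 0 1 2.

Lemma det_d3 (f : nat -> nat -> R) : \det (\matrix_(i < 3, j < 3) f i j) =
  f 0 0 * (f 1 1 * f 2 2 - f 1 2 * f 2 1) - f 0 1 * (f 1 0 * f 2 2 - f 1 2 * f 2 0)
  + f 0 2 * (f 1 0 * f 2 1 - f 1 1 * f 2 0).
Proof.
rewrite (expand_det_row _ ord0) !big_ord_recl big_ord0 addr0 /cofactor.
rewrite !(expand_det_row _ ord0) !big_ord_recl !big_ord0 !addr0 /cofactor.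
by rewrite !det_mx11 !mxE /= /bump /= ?addn0 ?add0n /=; ring.
Qed.

Lemma det_d4 (f : nat -> nat -> R) : \det (\matrix_(i < 4, j < 4) f i j) = d4 f.
Proof.
have minor (j : 'I_4) : row' ord0 (col' j (\matrix_(i < 4, j < 4) f i j)) =
    \matrix_(i < 3, k < 3) f i.+1 (bump j k).
  by apply/matrixP => i k; rewrite !mxE.
rewrite /d4 (expand_det_row _ ord0) !big_ord_recl big_ord0 addr0 /cofactor !minor.
rewrite !(det_d3 (fun i k => f i.+1 (bump _ k))) !mxE /= /bump /=.
by rewrite ?addn0 ?add0n /=; ring.
Qed.

Lemma inord40 : inord 0 = i0. Proof. by apply: val_inj; rewrite /= inordK. Qed.
Lemma inord41 : inord 1 = i1. Proof. by apply: val_inj; rewrite /= inordK. Qed.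
Lemma inord42 : inord 2 = i2. Proof. by apply: val_inj; rewrite /= inordK. Qed.
Lemma inord43 : inord 3 = i3. Proof. by apply: val_inj; rewrite /= inordK. Qed.

Lemma det4_d4 x y z w : det4 x y z w =
  d4 (fun i j => nth (0 : vec) [:: x; y; z; w] i 0 (inord j)).
Proof.
rewrite -det_d4 /det4; congr (\det _); apply/matrixP => i j.
by rewrite !mxE inord_val.
Qed.

Lemma det4E x y z w : det4 x y z w =
  let d2 j k := z 0 j * w 0 k - z 0 k * w 0 j in
  let d3 i j k := y 0 i * d2 j k - y 0 j * d2 i k + y 0 k * d2 i j in
  x 0 i0 * d3 i1 i2 i3 - x 0 i1 * d3 i0 i2 i3 + x 0 i2 * d3 i0 i1 i3
  - x 0 i3 * d3 i0 i1 i2.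
Proof. by rewrite det4_d4 /d4 inord40 inord41 inord42 inord43. Qed.

Lemma det4_gram x y z w : det4 x y z w ^+ 2 =
  d4 (fun i j => dot (nth (0 : vec) [:: x; y; z; w] i) (nth 0 [:: x; y; z; w] j)).
Proof.
rewrite -det_d4 /det4 expr2 -{2}det_tr -det_mulmx; congr (\det _).
apply/matrixP => i j; rewrite !mxE; apply: eq_bigr => k _.
by rewrite !mxE.
Qed.

Lemma dotC x y : dot x y = dot y x.
Proof. by rewrite !dotE; ring. Qed.

Lemma dotDl x y z : dot (x + y) z = dot x z + dot y z.
Proof. by rewrite !dotE !mxE; ring. Qed.

Lemma dotZl a x z : dot (a *: x) z = a * dot x z.
Proof. by rewrite !dotE !mxE; ring. Qed.

Lemma dotNl x z : dot (- x) z = - dot x z.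
Proof. by rewrite !dotE !mxE; ring. Qed.

Lemma dotDr x y z : dot z (x + y) = dot z x + dot z y.
Proof. by rewrite dotC dotDl !(dotC z). Qed.

Lemma dotZr a x z : dot z (a *: x) = a * dot z x.
Proof. by rewrite dotC dotZl (dotC z). Qed.

Lemma dotNr x z : dot z (- x) = - dot z x.
Proof. by rewrite dotC dotNl (dotC z). Qed.

Definition dot_linE := (dotDl, dotDr, dotNl, dotNr, dotZl, dotZr).

Lemma dot_ge0 x : 0 <= dot x x.
Proof. by apply: sumr_ge0 => i _; rewrite -expr2 sqr_ge0. Qed.

Lemma dot_eq0 x : dot x x = 0 -> x = 0.
Proof.
move=> /eqP; rewrite /dot psumr_eq0 => [|i _]; last by rewrite -expr2 sqr_ge0.
move=> /allP h; apply/rowP => i; rewrite mxE; apply/eqP.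
by have := h i (mem_index_enum i); rewrite /= -expr2 sqrf_eq0.
Qed.

Definition gram u v x y : R := dot x y * (1 - dot u v ^+ 2) - dot u x * dot u y
  - dot v x * dot v y + dot u v * (dot u x * dot v y + dot v x * dot u y).

Definition cross u v w : vec := \row_j det4 u (delta_mx 0 j) v w.

Lemma dot_cross u v w z : dot (cross u v w) z = det4 u z v w.
Proof. by rewrite dotE /cross !mxE !det4E /= !mxE /=; ring. Qed.

Lemma dot_cross_cross u v w : dot u u = 1 -> dot v v = 1 ->
  dot (cross u v w) (cross u v w) = gram u v w w.
Proof.
move=> uu vv; rewrite dot_cross.
transitivity (dot w w * (dot u u * dot v v - dot u v ^+ 2) - dot v v * dot u w ^+ 2
  - dot u u * dot v w ^+ 2 + 2 * dot u v * dot u w * dot v w); last first.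
  by rewrite /gram uu vv; ring.
by rewrite det4E /= /cross !mxE !det4E /= !mxE /= !dotE; ring.
Qed.

Lemma gram_det u v x y : dot u u = 1 -> dot v v = 1 ->
  (1 - dot u v ^+ 2) * det4 u v x y ^+ 2 = gram u v x x * gram u v y y - gram u v x y ^+ 2.
Proof.
move=> uu vv; rewrite det4_gram /d4 /= /gram uu vv.
by rewrite (dotC v u) (dotC x u) (dotC y u) (dotC x v) (dotC y v) (dotC y x); ring.
Qed.

End Geometry4.

Section Dihedral.
Variable R : realType.
Local Notation vec := 'rV[R]_4.
Implicit Types (u v w x y z m n : vec) (a b c s phi : R).

Definition tan_half c s : option R := if 1 + c == 0 then None else Some (s / (1 + c)).

Lemma half_tanE phi : half_tan phi = tan_half (cos phi) (sin phi).
Proof.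
have [ec es] : cos phi = cos (phi / 2) ^+ 2 - sin (phi / 2) ^+ 2 /\
    sin phi = 2 * sin (phi / 2) * cos (phi / 2).
  have := cosD (phi / 2) (phi / 2); have := sinD (phi / 2) (phi / 2).
  by rewrite -splitr => -> ->; split; ring.
have := cos2Dsin2 (phi / 2); rewrite /half_tan /tan_half ec es /tan.
set c := cos _; set s := sin _ => cs.
have -> : 1 + (c ^+ 2 - s ^+ 2) = 2 * c ^+ 2 by lra.
rewrite mulf_eq0 pnatr_eq0 /= sqrf_eq0; case: eqVneq => // c0.
by congr Some; field.
Qed.

Lemma exists_angle c s : c ^+ 2 + s ^+ 2 = 1 -> exists phi, cos phi = c /\ sin phi = s.
Proof.
move=> cs.
have c1 : -1 <= c <= 1 by nra.
have e : sin (acos c) = `|s| by rewrite sin_acos // -cs addrC addKr sqrtr_sqr.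
have ec : cos (acos c) = c by rewrite acosK // in_itv.
have [s0|s0] := leP 0 s.
  by exists (acos c); rewrite e ger0_norm.
by exists (- acos c); rewrite cosN sinN e ltr0_norm // opprK.
Qed.

Lemma det4_linear u v x y (a b c a' b' c' : R) :
  det4 u v (a *: u + b *: v + c *: x) (a' *: u + b' *: v + c' *: y) =
  c * c' * det4 u v x y.
Proof. by rewrite !det4E /= !mxE; ring. Qed.

Lemma det4_rot u m v n : det4 u m v n = det4 u v n m.
Proof. by rewrite !det4E /=; ring. Qed.

Lemma det4_last u v w x y a b c :
  det4 u x v (a *: u + b *: v + c *: w) = c * det4 u x v w.
Proof. by rewrite !det4E /= !mxE; ring. Qed.

Definition orient (t u v : vertex) : R := if face_positive t u v then 1 else -1.

Definition gram_norm u v x y := Num.sqrt (gram u v x x * gram u v y y).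

Definition dihedral_cos (P : vertex -> vec) t1 t2 t3 t4 :=
  gram (P t1) (P t2) (P t3) (P t4) / gram_norm (P t1) (P t2) (P t3) (P t4).

Definition dihedral_sin (P : vertex -> vec) t1 t2 t3 t4 :=
  - orient t1 t2 t3 * Num.sqrt (1 - dot (P t1) (P t2) ^+ 2)
  * det4 (P t1) (P t2) (P t3) (P t4) / gram_norm (P t1) (P t2) (P t3) (P t4).

Lemma inward_normal_inv (P : vertex -> vec) t1 t2 t3 n :
  inward_normal P t1 t2 t3 n -> exists a b c, 0 < c /\
    P t3 = a *: P t1 + b *: P t2 + c *: n.
Proof.
case=> _ _ _ [x [y [z [z0 e]]]].
exists (- x / z), (- y / z), z^-1; split; first by rewrite invr_gt0.
have zn : z != 0 by rewrite gt_eqF.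
apply/rowP => i; rewrite e !mxE; field => //.
Qed.

Lemma dihedral_cos_sin (P : vertex -> vec) t1 t2 t3 t4 phi :
  dot (P t1) (P t1) = 1 -> dot (P t2) (P t2) = 1 -> dot (P t1) (P t2) ^+ 2 < 1 ->
  dihedral_angle P t1 t2 t3 t4 phi ->
  cos phi = dihedral_cos P t1 t2 t3 t4 /\ sin phi = dihedral_sin P t1 t2 t3 t4.
Proof.
move=> uu vv c1 [m1 [n1 [n2 [hm hn1 hn2 en2]]]].
have [a [b [c [c0 ew1]]]] := inward_normal_inv hn1.
have [a' [b' [c' [c0' ew2]]]] := inward_normal_inv hn2.
case: hn1 hn2 => nn1 nu1 nv1 [x [y [z [z0 en1]]]] [nn2 nu2 nv2 _].
case: hm => mm mu mv mw sg.
move: uu vv c1 ew1 ew2 nu1 nv1 en1 nu2 nv2 mu mv mw sg.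
rewrite /dihedral_cos /dihedral_sin /gram_norm /orient.
set u := P t1; set v := P t2; set w1 := P t3; set w2 := P t4.
move=> uu vv c1 ew1 ew2 nu1 nv1 en1 nu2 nv2 mu mv mw sg.
have mn : dot m1 n1 = 0 by rewrite en1 !dot_linE mu mv mw; ring.
have n12 : dot n1 n2 = cos phi by rewrite en2 !dot_linE nn1 (dotC n1) mn; ring.
have un1 : dot u n1 = 0 by rewrite dotC.
have vn1 : dot v n1 = 0 by rewrite dotC.
have un2 : dot u n2 = 0 by rewrite dotC.
have vn2 : dot v n2 = 0 by rewrite dotC.
have g11 : gram u v w1 w1 = c ^+ 2 * (1 - dot u v ^+ 2).
  by rewrite /gram ew1 !dot_linE uu vv un1 vn1 nu1 nv1 nn1 (dotC v u); ring.
have g22 : gram u v w2 w2 = c' ^+ 2 * (1 - dot u v ^+ 2).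
  by rewrite /gram ew2 !dot_linE uu vv un2 vn2 nu2 nv2 nn2 (dotC v u); ring.
have g12 : gram u v w1 w2 = c * c' * (1 - dot u v ^+ 2) * cos phi.
  by rewrite /gram ew1 ew2 !dot_linE ?(uu, vv, un1, un2, vn1, vn2, nu1, nv1, nu2, nv2, n12) (dotC v u); ring.
set k2 := 1 - dot u v ^+ 2 in g11 g22 g12 *.
have k20 : 0 < k2 by rewrite subr_gt0.
have K : Num.sqrt (gram u v w1 w1 * gram u v w2 w2) = c * c' * k2.
  have -> : gram u v w1 w1 * gram u v w2 w2 = (c * c' * k2) ^+ 2 by rewrite g11 g22; ring.
  by rewrite sqrtr_sqr ger0_norm // !mulr_ge0 // ltW.
have K0 : c * c' * k2 != 0 by rewrite !mulf_neq0 // gt_eqF.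
have dn : det4 u v w1 w2 = - c * c' * sin phi * det4 u v n1 m1.
  rewrite ew1 ew2 det4_linear en2.
  have -> : cos phi *: n1 - sin phi *: m1 = 0 *: u + 0 *: v + 1 *: (cos phi *: n1 - sin phi *: m1).
    by rewrite !scale0r !add0r scale1r.
  by rewrite !det4E /= !mxE; ring.
have sgd : det4 u m1 v w1 = c * det4 u v n1 m1 by rewrite ew1 det4_last // det4_rot.
have d2 : det4 u v n1 m1 ^+ 2 = k2.
  rewrite det4_gram /d4 /= uu vv nn1 mm un1 vn1 nu1 nv1 mu mv mn (dotC v u) (dotC n1 m1) mn.
  by rewrite (dotC u m1) (dotC v m1) mu mv /k2; ring.
set s : R := if _ then _ else _.
have sd : s * det4 u v n1 m1 = Num.sqrt k2.
  rewrite -d2 sqrtr_sqr /s; case: ifP sg => _; rewrite sgd.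
    by rewrite pmulr_rgt0 // => h; rewrite mul1r gtr0_norm.
  by rewrite pmulr_rlt0 // => h; rewrite mulN1r ltr0_norm.
have [cn cn' k2n] : [/\ c != 0, c' != 0 & k2 != 0] by rewrite !gt_eqF.
rewrite K g12 dn; split; first by field; rewrite cn cn' k2n.
rewrite -sd.
transitivity (sin phi * (c * c' * (s * det4 u v n1 m1) ^+ 2) / (c * c' * k2));
  last by field; rewrite cn cn' k2n.
by rewrite sd sqr_sqrtr ?ltW //; field; rewrite cn cn' k2n.
Qed.

Lemma unit_rotation (a b m : vec) (c s : R) :
  dot a a = 1 -> dot b b = 1 -> dot m m = 1 -> dot m a = 0 ->
  dot a b = c -> dot m b = - s -> c ^+ 2 + s ^+ 2 = 1 -> b = c *: a - s *: m.
Proof.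
move=> aa bb mm ma ab mb cs; apply/eqP; rewrite -subr_eq0; apply/eqP/dot_eq0.
rewrite !dot_linE aa bb mm ma ab mb (dotC b a) (dotC b m) (dotC a m) ma ab mb.
by transitivity (1 - (c ^+ 2 + s ^+ 2)); [ring|rewrite cs subrr].
Qed.

Lemma dihedral_exists (P : vertex -> vec) t1 t2 t3 t4 :
  dot (P t1) (P t1) = 1 -> dot (P t2) (P t2) = 1 -> dot (P t1) (P t2) ^+ 2 < 1 ->
  0 < gram (P t1) (P t2) (P t3) (P t3) -> 0 < gram (P t1) (P t2) (P t4) (P t4) ->
  exists phi, dihedral_angle P t1 t2 t3 t4 phi.
Proof.
move=> uu vv c1 g11 g22.
set u := P t1 in uu c1 g11 g22 *; set v := P t2 in vv c1 g11 g22 *.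
set w1 := P t3 in g11; set w2 := P t4 in g22.
pose k2 := 1 - dot u v ^+ 2; have k20 : 0 < k2 by rewrite subr_gt0.
pose r (w : vec) := Num.sqrt (gram u v w w / k2).
pose perp (w : vec) := w - ((dot u w - dot u v * dot v w) / k2) *: u
  - ((dot v w - dot u v * dot u w) / k2) *: v.
have r2 w : 0 < gram u v w w -> r w ^+ 2 = gram u v w w / k2.
  by move=> gw; rewrite sqr_sqrtr // ltW // divr_gt0.
have r0 w : 0 < gram u v w w -> 0 < r w by move=> gw; rewrite sqrtr_gt0 divr_gt0.
have k2n : k2 != 0 by rewrite gt_eqF.
have pu w : dot (perp w) u = 0.
  by rewrite /perp !dot_linE uu (dotC v u) (dotC w u); move: k2n; rewrite /k2 => k2n; field.
have pv w : dot (perp w) v = 0.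
  by rewrite /perp !dot_linE vv (dotC w v); move: k2n; rewrite /k2 => k2n; field.
have pw w x : dot (perp w) x = dot w x - ((dot u w - dot u v * dot v w) / k2) * dot u x
  - ((dot v w - dot u v * dot u w) / k2) * dot v x by rewrite /perp !dot_linE.
have pp w x : dot (perp w) (perp x) = gram u v w x / k2.
  rewrite {2}/perp !(dotDr, dotNr, dotZr) pu pv pw /gram -/k2 !mulr0 !subr0.
  by field.
pose n w := (r w)^-1 *: perp w.
have hn t : 0 < gram u v (P t) (P t) -> inward_normal P t1 t2 t (n (P t)).
  move=> gw; have rw := r0 _ gw; have rn : r (P t) != 0 by rewrite gt_eqF.
  rewrite /n; split; rewrite ?dotZl ?dotZr ?pp ?pu ?pv ?mulr0 //.
    by rewrite -r2 //; field.
  exists (- ((dot u (P t) - dot u v * dot v (P t)) / k2) / r (P t)),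
    (- ((dot v (P t) - dot u v * dot u (P t)) / k2) / r (P t)), (r (P t))^-1.
  split; first by rewrite invr_gt0.
  rewrite /perp !scalerDr !scalerN !scalerA; apply/rowP => i; rewrite !mxE -/u -/v.
  by field; rewrite k2n rn.
pose s : R := orient t1 t2 t3.
have s2 : s ^+ 2 = 1 by rewrite /s /orient; case: ifP => _; ring.
pose m := (s / Num.sqrt (gram u v w1 w1)) *: cross u v w1.
set q := Num.sqrt (gram u v w1 w1) in m.
have q2 : q ^+ 2 = gram u v w1 w1 by rewrite sqr_sqrtr // ltW.
have q0 : 0 < q by rewrite sqrtr_gt0.
have qn : q != 0 by rewrite gt_eqF.
have mz z : dot m z = s / q * det4 u z v w1 by rewrite /m dotZl dot_cross.
have hm : exterior_normal P t1 t2 t3 m.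
  split; rewrite -?/u -?/v -?/w1.
  - rewrite /m dotZl dotZr dot_cross_cross // -q2.
    transitivity (s ^+ 2); last exact: s2.
    by field.
  - by rewrite mz det4E /=; ring.
  - by rewrite mz det4E /=; ring.
  - by rewrite mz det4E /=; ring.
  have -> : det4 u m v w1 = s * q.
    by rewrite -dot_cross /m dotZr dot_cross_cross // -q2; field.
  rewrite /s /orient; case: (face_positive _ _ _); first by rewrite mul1r.
  by rewrite mulN1r oppr_lt0.
have gd := gram_det w1 w2 uu vv; rewrite -/k2 in gd.
have r1 := r0 _ g11; have r2' := r0 _ g22.
have nn1 : dot (n w1) (n w1) = 1 by case: (hn t3 g11).
have nn2 : dot (n w2) (n w2) = 1 by case: (hn t4 g22).
have mn1 : dot m (n w1) = 0.
  by rewrite mz /n /perp !det4E /= !mxE; ring.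
have [phi [ec es]] : exists phi, cos phi = dot (n w1) (n w2) /\ sin phi = - dot m (n w2).
  apply: exists_angle.
  rewrite /n dotZl !dotZr pp mz.
  have -> : det4 u (perp w2) v w1 = det4 u v w1 w2 by rewrite /perp !det4E /= !mxE; ring.
  transitivity ((gram u v w1 w2 ^+ 2 / k2 / (r w1 ^+ 2) + s ^+ 2 / q ^+ 2 * (k2 * det4 u v w1 w2 ^+ 2)) / (k2 * r w2 ^+ 2)).
    by field; rewrite k2n qn !gt_eqF.
  rewrite gd r2 // r2 // s2 q2; field.
  by rewrite k2n !gt_eqF.
exists phi, m, (n w1), (n w2); split=> //; [exact: hn|exact: hn|].
by apply: unit_rotation => //; [case: hm|rewrite es opprK|exact: cos2Dsin2].
Qed.

End Dihedral.

(** * Spherical trigonometry *)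

Section SphericalTriangles.
Variable R : realType.
Implicit Types (a b c x y z : R).

Lemma cos_lt_pi a b : 0 <= a -> b <= pi -> a < b -> cos b < cos a.
Proof.
move=> a0 bpi ab.
by rewrite ltr_cos // in_itv /= ?a0 ?bpi ?(ltW (le_lt_trans a0 ab)) ?(ltW (lt_le_trans ab bpi)).
Qed.

Lemma sin_sqr a : sin a ^+ 2 = 1 - cos a ^+ 2.
Proof. by rewrite -(cos2Dsin2 a) addrC addKr. Qed.

Lemma triangle_gram_gt0 a b c : 0 < a < pi -> 0 < b < pi -> 0 < c < pi ->
  a < b + c -> b < c + a -> c < a + b -> a + b + c < 2 * pi ->
  0 < 1 + 2 * cos a * cos b * cos c - cos a ^+ 2 - cos b ^+ 2 - cos c ^+ 2.
Proof.
move=> /andP [a0 api] /andP [b0 bpi] /andP [c0 cpi] ha hb hc hs.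
have e : 1 + 2 * cos a * cos b * cos c - cos a ^+ 2 - cos b ^+ 2 - cos c ^+ 2 =
   (cos a - cos (b + c)) * (cos (b - c) - cos a).
  rewrite cosD cosB.
  transitivity ((1 - cos b ^+ 2) * (1 - cos c ^+ 2) - (cos a - cos b * cos c) ^+ 2); first by ring.
  by rewrite -!sin_sqr; ring.
rewrite e mulr_gt0 // subr_gt0.
  have [bc|bc] := leP (b + c) pi; first by apply: cos_lt_pi => //; exact: ltW.
  have -> : cos (b + c) = cos (2 * pi - (b + c)).
    by rewrite -[RHS]cosN opprB -[RHS]cosD2pi; congr cos; ring.
  by apply: cos_lt_pi; lra.
wlog bc : b c b0 bpi c0 cpi ha hb hc hs {e} / c <= b.
  move=> H; have [cb|bc] := leP c b; first exact: H.
  by rewrite -[cos (b - c)]cosN opprB; apply: H; lra.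
by apply: cos_lt_pi; lra.
Qed.

(* x, a, d are cosines of the sides, with sines sx, sa, sd; c3, cj, ci are the cosines of the
   angles opposite to them, with sines s3, sj, si. *)
Record triangle (x a d sx sa sd ci si cj sj c3 s3 : R) : Prop := Triangle {
  tri_sin : [/\ 0 < sx, 0 < sa & 0 < sd];
  tri_sin_angle : [/\ 0 < si, 0 < sj & 0 < s3];
  tri_pyth : [/\ sx ^+ 2 = 1 - x ^+ 2, sa ^+ 2 = 1 - a ^+ 2 & sd ^+ 2 = 1 - d ^+ 2];
  tri_pyth_angle : [/\ si ^+ 2 = 1 - ci ^+ 2, sj ^+ 2 = 1 - cj ^+ 2 & s3 ^+ 2 = 1 - c3 ^+ 2];
  tri_law3 : x = a * d + sa * sd * c3;
  tri_lawj : a = x * d + sx * sd * cj;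
  tri_lawi : d = x * a + sx * sa * ci;
  tri_dual3 : c3 = - ci * cj + si * sj * x;
  tri_dualj : cj = - ci * c3 + si * s3 * a;
  tri_duali : ci = - cj * c3 + sj * s3 * d;
  tri_cotj : x * sd * s3 = sx * (d * cj * s3 + sj * c3);
  tri_coti : x * sa * s3 = sx * (a * ci * s3 + si * c3) }.

Lemma triangleP (x a d sx sa sd v : R) : 0 < sx -> 0 < sa -> 0 < sd -> 0 < v ->
  sx ^+ 2 = 1 - x ^+ 2 -> sa ^+ 2 = 1 - a ^+ 2 -> sd ^+ 2 = 1 - d ^+ 2 ->
  v ^+ 2 = 1 + 2 * x * a * d - x ^+ 2 - a ^+ 2 - d ^+ 2 ->
  triangle x a d sx sa sd ((d - x * a) / (sx * sa)) (v / (sx * sa))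
    ((a - x * d) / (sx * sd)) (v / (sx * sd)) ((x - a * d) / (sa * sd)) (v / (sa * sd)).
Proof.
move=> sx0 sa0 sd0 v0 ex ea ed ev.
have [nx na nd] : [/\ sx != 0, sa != 0 & sd != 0] by rewrite !gt_eqF.
have x2 : x ^+ 2 = 1 - sx ^+ 2 by rewrite ex; ring.
have nz := (nx, na, nd).
split.
- by [].
- by rewrite !divr_gt0 // mulr_gt0.
- by [].
- split.
  + transitivity (v ^+ 2 / (sx ^+ 2 * sa ^+ 2)); first by field; rewrite ?nz.
    rewrite ev; transitivity (1 - (d - x * a) ^+ 2 / (sx ^+ 2 * sa ^+ 2)); last by field; rewrite ?nz.
    apply: (mulIf (mulf_neq0 (expf_neq0 2 nx) (expf_neq0 2 na))).
    rewrite mulfVK ?mulf_neq0 ?expf_neq0 // mulrBl mulfVK ?mulf_neq0 ?expf_neq0 // ex ea; ring.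
  + transitivity (v ^+ 2 / (sx ^+ 2 * sd ^+ 2)); first by field; rewrite ?nz.
    rewrite ev; transitivity (1 - (a - x * d) ^+ 2 / (sx ^+ 2 * sd ^+ 2)); last by field; rewrite ?nz.
    apply: (mulIf (mulf_neq0 (expf_neq0 2 nx) (expf_neq0 2 nd))).
    rewrite mulfVK ?mulf_neq0 ?expf_neq0 // mulrBl mulfVK ?mulf_neq0 ?expf_neq0 // ex ed; ring.
  + transitivity (v ^+ 2 / (sa ^+ 2 * sd ^+ 2)); first by field; rewrite ?nz.
    rewrite ev; transitivity (1 - (x - a * d) ^+ 2 / (sa ^+ 2 * sd ^+ 2)); last by field; rewrite ?nz.
    apply: (mulIf (mulf_neq0 (expf_neq0 2 na) (expf_neq0 2 nd))).
    rewrite mulfVK ?mulf_neq0 ?expf_neq0 // mulrBl mulfVK ?mulf_neq0 ?expf_neq0 // ea ed; ring.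
- by field; rewrite ?nz.
- by field; rewrite ?nz.
- by field; rewrite ?nz.
- transitivity ((- (d - x * a) * (a - x * d) + v ^+ 2 * x) / (sx ^+ 2 * sa * sd)); last first.
    by field; rewrite ?nz.
  rewrite ev; transitivity ((x - a * d) * (1 - x ^+ 2) / (sx ^+ 2 * sa * sd)).
    by rewrite -ex; field; rewrite ?nz.
  by congr (_ / _); ring.
- transitivity ((- (d - x * a) * (x - a * d) + v ^+ 2 * a) / (sa ^+ 2 * sx * sd)); last first.
    by field; rewrite ?nz.
  rewrite ev; transitivity ((a - x * d) * (1 - a ^+ 2) / (sa ^+ 2 * sx * sd)).
    by rewrite -ea; field; rewrite ?nz.
  by congr (_ / _); ring.
- transitivity ((- (a - x * d) * (x - a * d) + v ^+ 2 * d) / (sd ^+ 2 * sx * sa)); last first.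
    by field; rewrite ?nz.
  rewrite ev; transitivity ((d - x * a) * (1 - d ^+ 2) / (sd ^+ 2 * sx * sa)).
    by rewrite -ed; field; rewrite ?nz.
  by congr (_ / _); ring.
- transitivity (v / (sa * sd) * ((d * (a - x * d) + (x - a * d)) / sd)); last by field; rewrite ?nz.
  have -> : d * (a - x * d) + (x - a * d) = x * sd ^+ 2 by rewrite ed; ring.
  by field; rewrite ?nz.
- transitivity (v / (sa * sd) * ((a * (d - x * a) + (x - a * d)) / sa)); last by field; rewrite ?nz.
  have -> : a * (d - x * a) + (x - a * d) = x * sa ^+ 2 by rewrite ea; ring.
  by field; rewrite ?nz.
Qed.

End SphericalTriangles.

Section TwoTriangles.
Variable R : realType.

Lemma pos_sqr_eq (s t : R) : 0 < s -> 0 < t -> s ^+ 2 = t ^+ 2 -> s = t.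
Proof. by move=> s0 t0 /eqP; rewrite eqrXn2 ?ltW // => /eqP. Qed.

Lemma sine_eq (s t c d : R) : 0 < s -> 0 < t -> s ^+ 2 = 1 - c ^+ 2 -> t ^+ 2 = 1 - d ^+ 2 ->
  c ^+ 2 = d ^+ 2 -> s = t.
Proof. by move=> s0 t0 es et e; apply: pos_sqr_eq => //; rewrite es et e. Qed.

Variables (x sx a d sa sd ci si cj sj c3 s3 : R).
Variables (a' d' sa' sd' ci' si' cj' sj' c3' s3' : R).
Hypothesis T : triangle x a d sx sa sd ci si cj sj c3 s3.
Hypothesis T' : triangle x a' d' sx sa' sd' ci' si' cj' sj' c3' s3'.

Lemma tri_sin_eq (P : Prop) :
  ((a' ^+ 2 = a ^+ 2 -> sa' = sa) -> (d' ^+ 2 = d ^+ 2 -> sd' = sd) ->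
   (ci' ^+ 2 = ci ^+ 2 -> si' = si) -> (cj' ^+ 2 = cj ^+ 2 -> sj' = sj) ->
   (c3' ^+ 2 = c3 ^+ 2 -> s3' = s3) -> P) -> P.
Proof.
case: T T' => -[p1 p2 p3] [p4 p5 p6] [q1 q2 q3] [q4 q5 q6] _ _ _ _ _ _ _ _.
case=> -[r1 r2 r3] [r4 r5 r6] [t1 t2 t3] [t4 t5 t6] _ _ _ _ _ _ _ _.
by apply; apply: sine_eq.
Qed.

Lemma supplementary_triangles : cj' = cj -> ci' = - ci -> c3' = - c3 ->
  [/\ x = 0, a' = a & d' = - d].
Proof.
move=> ej ei e3; apply: tri_sin_eq => _ _ /(_ _)Ei /(_ _)Ej /(_ _)E3.
have {}Ei : si' = si by apply: Ei; rewrite ei sqrrN.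
have {}Ej : sj' = sj by apply: Ej; rewrite ej.
have {}E3 : s3' = s3 by apply: E3; rewrite e3 sqrrN.
have [_ [pi pj p3] _ _ _ _ _ g3 gj gi _ _] := T.
have [_ _ _ _ _ _ _ g3' gj' gi' _ _] := T'.
rewrite Ei Ej E3 ej ei e3 in g3' gj' gi'.
split.
- apply: (mulfI (mulf_neq0 (lt0r_neq0 pi) (lt0r_neq0 pj))); rewrite mulr0; lra.
- apply: (mulfI (mulf_neq0 (lt0r_neq0 pi) (lt0r_neq0 p3))); lra.
- apply: (mulfI (mulf_neq0 (lt0r_neq0 pj) (lt0r_neq0 p3))); rewrite mulrN; lra.
Qed.

Lemma right_side_from_j : cj' = cj -> c3' = - c3 -> d' = - d -> x = 0 /\ a' = a.
Proof.
move=> ej e3 ed; apply: tri_sin_eq => _ Ed _ Ej E3.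
have {}Ed : sd' = sd by apply: Ed; rewrite ed sqrrN.
have {}Ej : sj' = sj by apply: Ej; rewrite ej.
have {}E3 : s3' = s3 by apply: E3; rewrite e3 sqrrN.
have [[px pa pd] [pi pj p3] _ _ _ lj _ _ _ _ gj _] := T.
have [_ _ _ _ _ lj' _ _ _ _ gj' _] := T'.
rewrite Ed Ej E3 ej e3 ed in gj' lj'.
have x0 : x = 0.
  apply: (mulIf (mulf_neq0 (lt0r_neq0 pd) (lt0r_neq0 p3))); rewrite mul0r; lra.
by split=> //; rewrite lj lj' x0; ring.
Qed.

Lemma right_side_from_i : ci' = - ci -> c3' = - c3 -> a' = a -> x = 0 /\ d' = - d.
Proof.
move=> ei e3 ea; apply: tri_sin_eq => Ea _ Ei _ E3.
have {}Ea : sa' = sa by apply: Ea; rewrite ea.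
have {}Ei : si' = si by apply: Ei; rewrite ei sqrrN.
have {}E3 : s3' = s3 by apply: E3; rewrite e3 sqrrN.
have [[px pa pd] [pi pj p3] _ _ _ _ li _ _ _ _ gi] := T.
have [_ _ _ _ _ _ li' _ _ _ _ gi'] := T'.
rewrite Ea Ei E3 ei e3 ea in gi' li'.
have x0 : x = 0.
  apply: (mulIf (mulf_neq0 (lt0r_neq0 pa) (lt0r_neq0 p3))); rewrite mul0r; lra.
by split=> //; rewrite li li' x0; ring.
Qed.

Lemma right_side_from_3 : c3' = - c3 -> a' = a -> d' = - d -> x = 0.
Proof.
move=> e3 ea ed; apply: tri_sin_eq => Ea Ed _ _ E3.
have {}Ea : sa' = sa by apply: Ea; rewrite ea.
have {}Ed : sd' = sd by apply: Ed; rewrite ed sqrrN.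
have [_ _ _ _ l3 _ _ _ _ _ _ _] := T.
have [_ _ _ _ l3' _ _ _ _ _ _ _] := T'.
by move: l3'; rewrite Ea Ed ea ed e3 l3; lra.
Qed.

Lemma same_apex_right_angle : cj' = cj -> ci' = - ci -> c3' = c3 ->
  (ci = 0 /\ [/\ a' = a, d' = d & (a = 0 -> d = 0)]) \/
  (cj = 0 /\ [/\ a' = - a, d' = - d & (d = 0 -> ci = 0)]).
Proof.
move=> ej ei e3; apply: tri_sin_eq => _ _ Ei Ej E3.
have {}Ei : si' = si by apply: Ei; rewrite ei sqrrN.
have {}Ej : sj' = sj by apply: Ej; rewrite ej.
have {}E3 : s3' = s3 by apply: E3; rewrite e3.
have [_ [pi pj p3] _ _ _ _ li g3 gj gi _ _] := T.
have [_ _ _ _ _ _ _ g3' gj' gi' _ _] := T'.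
rewrite Ei Ej E3 ej ei e3 in g3' gj' gi'.
have : ci * cj = 0 by lra.
have ni3 := mulf_neq0 (lt0r_neq0 pi) (lt0r_neq0 p3).
have nj3 := mulf_neq0 (lt0r_neq0 pj) (lt0r_neq0 p3).
move/eqP; rewrite mulf_eq0 => /orP [] /eqP z; [left|right]; split=> //.
- split.
  + by apply: (mulfI ni3); move: gj gj'; rewrite z; lra.
  + by apply: (mulfI nj3); move: gi gi'; rewrite z; lra.
  + by move=> a0; rewrite li a0 z; ring.
- split.
  + by apply: (mulfI ni3); rewrite mulrN; move: gj gj'; rewrite z; lra.
  + by apply: (mulfI nj3); rewrite mulrN; move: gi gi'; rewrite z; lra.
  + by move=> d0; rewrite gi z d0; ring.
Qed.

Lemma same_apex_j : cj' = cj -> c3' = c3 -> d' = - d -> d * cj = 0.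
Proof.
move=> ej e3 ed; apply: tri_sin_eq => _ Ed _ Ej E3.
have {}Ed : sd' = sd by apply: Ed; rewrite ed sqrrN.
have {}Ej : sj' = sj by apply: Ej; rewrite ej.
have {}E3 : s3' = s3 by apply: E3; rewrite e3.
have [[px pa pd] [pi pj p3] _ _ _ _ _ _ _ _ gj _] := T.
have [_ _ _ _ _ _ _ _ _ _ gj' _] := T'.
rewrite Ed Ej E3 ej e3 ed in gj'.
by apply: (mulfI (mulf_neq0 (lt0r_neq0 px) (lt0r_neq0 p3))); rewrite mulr0; lra.
Qed.

Lemma same_apex_i : ci' = - ci -> c3' = c3 -> a' = a -> a * ci = 0.
Proof.
move=> ei e3 ea; apply: tri_sin_eq => Ea _ Ei _ E3.
have {}Ea : sa' = sa by apply: Ea; rewrite ea.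
have {}Ei : si' = si by apply: Ei; rewrite ei sqrrN.
have {}E3 : s3' = s3 by apply: E3; rewrite e3.
have [[px pa pd] [pi pj p3] _ _ _ _ _ _ _ _ _ gi] := T.
have [_ _ _ _ _ _ _ _ _ _ _ gi'] := T'.
rewrite Ea Ei E3 ei e3 ea in gi'.
by apply: (mulfI (mulf_neq0 (lt0r_neq0 px) (lt0r_neq0 p3))); rewrite mulr0; lra.
Qed.

Lemma same_apex_3 : c3' = c3 -> a' = a -> d' = - d -> a * d = 0.
Proof.
move=> e3 ea ed; apply: tri_sin_eq => Ea Ed _ _ _.
have {}Ea : sa' = sa by apply: Ea; rewrite ea.
have {}Ed : sd' = sd by apply: Ed; rewrite ed sqrrN.
have [_ _ _ _ l3 _ _ _ _ _ _ _] := T.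
have [_ _ _ _ l3' _ _ _ _ _ _ _] := T'.
by move: l3'; rewrite Ea Ed ea ed e3; lra.
Qed.

End TwoTriangles.

(* Sides and angles of the faces on the vertices (0, i), (1, j) and on (2, false), or (2, true)
   for the primed letters: x, a, d are the cosines of the sides joining 0 and 1, 0 and 2,
   1 and 2, and I, J, G those of the angles at (0, i), at (1, j) and at the third vertex. *)
Section FourPairs.
Variable R : realType.
Variables (x sx : bool -> bool -> R) (a sa a' sa' d sd d' sd' : bool -> R).
Variables (I sI J sJ G sG I' sI' J' sJ' G' sG' : bool -> bool -> R) (eps : R).
Hypothesis T : forall i j, triangle (x i j) (a i) (d j) (sx i j) (sa i) (sd j)
  (I i j) (sI i j) (J i j) (sJ i j) (G i j) (sG i j).
Hypothesis T' : forall i j, triangle (x i j) (a' i) (d' j) (sx i j) (sa' i) (sd' j)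
  (I' i j) (sI' i j) (J' i j) (sJ' i j) (G' i j) (sG' i j).
Hypothesis eps1 : eps = 1 \/ eps = -1.
Hypothesis J_eq : forall i, J' i false = J i false.
Hypothesis I_supp : forall j, I' false j = - I false j.
Hypothesis G_eps : forall i j, G' i j = eps * G i j.
Hypothesis J_neq : J false false ^+ 2 != J true false ^+ 2.
Hypothesis I_neq : I false false ^+ 2 != I false true ^+ 2.

Lemma orthogonal_lengths :
  [/\ forall i j, x i j = 0, forall i, a' i = a i & forall j, d' j = - d j].
Proof.
case: eps1 => e1; last first.
  have Gm i j : G' i j = - G i j by rewrite G_eps e1 mulN1r.
  have [x00 a0 d0] := supplementary_triangles (T false false) (T' false false)
    (J_eq _) (I_supp _) (Gm _ _).
  have [x10 a1] := right_side_from_j (T true false) (T' true false) (J_eq _) (Gm _ _) d0.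
  have [x01 d1] := right_side_from_i (T false true) (T' false true) (I_supp _) (Gm _ _) a0.
  have x11 := right_side_from_3 (T true true) (T' true true) (Gm _ _) a1 d1.
  by split; [case; case|case|case].
exfalso.
have Gp i j : G' i j = G i j by rewrite G_eps e1 mul1r.
have I00 : [/\ I false false = 0, a' false = a false, d' false = d false
    & a false = 0 -> d false = 0].
  have [[-> [-> ->]] //|[J00 [ea ed h]]] :=
    same_apex_right_angle (T false false) (T' false false) (J_eq _) (I_supp _) (Gp _ _).
  have /eqP := same_apex_j (T true false) (T' true false) (J_eq _) (Gp _ _) ed.
  rewrite mulf_eq0 => /orP [] /eqP z; last by move: J_neq; rewrite J00 z eqxx.
  have Iz := h z; have [_ _ _ _ _ _ li _ _ _ _ _] := T false false.
  have [_ [_ sj0 s30] _ _ _ lj _ _ dj _ _ _] := T false false.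
  have [_ _ _ _ _ lj' _ _ _ _ _ _] := T' false false.
  have az : a false = 0 by rewrite lj z J00; ring.
  by split=> //; rewrite ?ea ?ed ?az ?z ?oppr0.
case: I00 => I00 ea0 ed0 ad.
have I01 : I false true != 0.
  by apply: contraNneq I_neq => z; rewrite I00 z.
have a0 : a false = 0.
  have /eqP := same_apex_i (T false true) (T' false true) (I_supp _) (Gp _ _) ea0.
  by rewrite mulf_eq0 (negPf I01) orbF => /eqP.
have d0 := ad a0.
have J00 : J false false = 0.
  have [[sx0 _ sd0] _ _ _ _ lj _ _ _ _ _ _] := T false false.
  apply: (mulfI (mulf_neq0 (lt0r_neq0 sx0) (lt0r_neq0 sd0))).
  by move: lj; rewrite a0 d0 !mulr0 add0r.
have J10 : J true false != 0 by apply: contraNneq J_neq => z; rewrite J00 z.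
have ea1 : a' true = a true.
  have [_ _ [_ _ qd] _ _ lj _ _ _ _ _ _] := T true false.
  have [_ _ [_ _ qd'] _ _ lj' _ _ _ _ _ _] := T' true false.
  have [[_ _ sd0] _ _ _ _ _ _ _ _ _ _ _] := T true false.
  have [[_ _ sd0'] _ _ _ _ _ _ _ _ _ _ _] := T' true false.
  have es : sd' false = sd false by apply: pos_sqr_eq => //; rewrite qd' qd ed0.
  by rewrite lj lj' ed0 es J_eq.
have [ed1 d1] : d' true = - d true /\ d true != 0.
  have [[sx0 sa0 _] _ [_ qa _] _ _ _ li _ _ _ _ _] := T false true.
  have [[_ sa0' _] _ [_ qa' _] _ _ _ li' _ _ _ _ _] := T' false true.
  have es : sa' false = sa false by apply: pos_sqr_eq => //; rewrite qa' qa ea0.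
  split; first by rewrite li li' ea0 es I_supp a0; ring.
  by rewrite li a0 mulr0 add0r !mulf_neq0 // lt0r_neq0.
have /eqP := same_apex_3 (T true true) (T' true true) (Gp _ _) ea1 ed1.
rewrite mulf_eq0 (negPf d1) orbF => /eqP a1.
have [[sx0 _ sd0] _ _ _ _ lj _ _ _ _ _ _] := T true false.
move/eqP: lj; rewrite a1 d0 mulr0 add0r eq_sym !mulf_eq0 (negPf J10).
by rewrite !(gt_eqF sx0, gt_eqF sd0).
Qed.

End FourPairs.

(* The coefficients of the vertex equation, expanded in the cosines and sines of the angles
   alpha, beta, gamma, delta. *)
Section VertexCoefficients.
Variable R : realType.
Variables (ca sa cb sb cc sc cd sd : R).
Hypotheses (sa0 : 0 < sa) (sb0 : 0 < sb) (sc0 : 0 < sc) (sd0 : 0 < sd).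
Hypotheses (ea : sa ^+ 2 = 1 - ca ^+ 2) (eb : sb ^+ 2 = 1 - cb ^+ 2).
Hypotheses (ec : sc ^+ 2 = 1 - cc ^+ 2) (ed : sd ^+ 2 = 1 - cd ^+ 2).

Definition vertexA := cc - ((ca * cb - sa * sb) * cd - (sa * cb + ca * sb) * sd).
Definition vertexB := cc - ((ca * cb + sa * sb) * cd - (sa * cb - ca * sb) * sd).
Definition vertexC := - 2 * sb * sd.
Definition vertexD := cc - ((ca * cb - sa * sb) * cd + (sa * cb + ca * sb) * sd).
Definition vertexE := cc - ((ca * cb + sa * sb) * cd + (sa * cb - ca * sb) * sd).

Lemma vertexC_neq0 : vertexC != 0.
Proof. by rewrite /vertexC !mulf_neq0 ?oppr_eq0 ?pnatr_eq0 // lt0r_neq0. Qed.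

Lemma vertexAD0 : vertexA = 0 -> vertexD = 0 -> [/\ cb = - ca, sb = sa, cc = - cd & sc = sd].
Proof.
rewrite /vertexA /vertexD => hA hD.
have h : sa * cb + ca * sb = 0.
  by apply: (mulIf (lt0r_neq0 sd0)); rewrite mul0r; lra.
have es : sb = sa.
  apply: (@sine_eq R sb sa cb ca) => //.
  have : (sa * cb) ^+ 2 = (ca * sb) ^+ 2 by rewrite (_ : sa * cb = - (ca * sb)) ?sqrrN //; lra.
  by rewrite !exprMn ea eb; lra.
have ecb : cb = - ca by apply: (mulfI (lt0r_neq0 sa0)); rewrite mulrN; move: h; rewrite es; lra.
have ecc : cc = - cd.
  have e1 : cc = (ca * cb - sa * sb) * cd by lra.
  rewrite e1 ecb es; transitivity (- (ca ^+ 2 + sa ^+ 2) * cd); first by ring.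
  by rewrite ea; ring.
by split=> //; apply: (@sine_eq R sc sd cc cd) => //; rewrite ecc sqrrN.
Qed.

Lemma vertexBE0 : vertexB = 0 -> vertexE = 0 -> [/\ cb = ca, sb = sa, cc = cd & sc = sd].
Proof.
rewrite /vertexB /vertexE => hA hD.
have h : sa * cb - ca * sb = 0.
  by apply: (mulIf (lt0r_neq0 sd0)); rewrite mul0r; lra.
have es : sb = sa.
  apply: (@sine_eq R sb sa cb ca) => //.
  have : (sa * cb) ^+ 2 = (ca * sb) ^+ 2 by rewrite (_ : sa * cb = ca * sb) //; lra.
  by rewrite !exprMn ea eb; lra.
have ecb : cb = ca by apply: (mulfI (lt0r_neq0 sa0)); move: h; rewrite es; lra.
have ecc : cc = cd.
  have e1 : cc = (ca * cb + sa * sb) * cd by lra.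
  rewrite e1 ecb es; transitivity ((ca ^+ 2 + sa ^+ 2) * cd); first by ring.
  by rewrite ea; ring.
by split=> //; apply: (@sine_eq R sc sd cc cd) => //; rewrite ecc.
Qed.

Lemma eq_coefs : cb = ca -> sb = sa -> cc = cd -> sc = sd ->
  [/\ vertexB = 0, vertexE = 0, vertexA = 2 * sa * (sa * cd + ca * sd),
      vertexD = 2 * sa * (sa * cd - ca * sd) & vertexA * vertexD = 4 * sa ^+ 2 * (cd ^+ 2 - ca ^+ 2)].
Proof.
rewrite /vertexA /vertexB /vertexD /vertexE => -> -> -> _.
have h : (ca ^+ 2 + sa ^+ 2) * cd = cd by rewrite ea; ring.
have hA : cd - ((ca * ca - sa * sa) * cd - (sa * ca + ca * sa) * sd) = 2 * sa * (sa * cd + ca * sd).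
  by rewrite -{1}h; ring.
have hD : cd - ((ca * ca - sa * sa) * cd + (sa * ca + ca * sa) * sd) = 2 * sa * (sa * cd - ca * sd).
  by rewrite -{1}h; ring.
split=> //; [by rewrite -{1}h; ring|by rewrite -{1}h; ring|].
rewrite hA hD; transitivity (4 * sa ^+ 2 * (sa ^+ 2 * cd ^+ 2 - ca ^+ 2 * sd ^+ 2)); first by ring.
by rewrite ea ed; ring.
Qed.

Lemma supp_coefs : cb = - ca -> sb = sa -> cc = - cd -> sc = sd ->
  [/\ vertexA = 0, vertexD = 0, vertexB = - (2 * sa * (sa * cd + ca * sd)),
      vertexE = - (2 * sa * (sa * cd - ca * sd)) & vertexB * vertexE = 4 * sa ^+ 2 * (cd ^+ 2 - ca ^+ 2)].
Proof.
rewrite /vertexA /vertexB /vertexD /vertexE => -> -> -> _.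
have h : (ca ^+ 2 + sa ^+ 2) * cd = cd by rewrite ea; ring.
have hA : - cd - ((ca * - ca + sa * sa) * cd - (sa * - ca - ca * sa) * sd) =
    - (2 * sa * (sa * cd + ca * sd)) by rewrite -{1}h; ring.
have hD : - cd - ((ca * - ca + sa * sa) * cd + (sa * - ca - ca * sa) * sd) =
    - (2 * sa * (sa * cd - ca * sd)) by rewrite -{1}h; ring.
split=> //; [by rewrite -{1}h; ring|by rewrite -{1}h; ring|].
rewrite hA hD; transitivity (4 * sa ^+ 2 * (sa ^+ 2 * cd ^+ 2 - ca ^+ 2 * sd ^+ 2)); first by ring.
by rewrite ea ed; ring.
Qed.

End VertexCoefficients.

Section ProportionalVertices.
Variable R : realType.
Variables (ca sa cb sb cc sc cd sd ca' sa' cb' sb' cc' sc' cd' sd' eps : R).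
Hypotheses (sa0 : 0 < sa) (sb0 : 0 < sb) (sd0 : 0 < sd).
Hypotheses (ea : sa ^+ 2 = 1 - ca ^+ 2) (eb : sb ^+ 2 = 1 - cb ^+ 2) (ed : sd ^+ 2 = 1 - cd ^+ 2).
Hypotheses (sa0' : 0 < sa') (sb0' : 0 < sb') (sd0' : 0 < sd').
Hypotheses (ea' : sa' ^+ 2 = 1 - ca' ^+ 2) (eb' : sb' ^+ 2 = 1 - cb' ^+ 2)
  (ed' : sd' ^+ 2 = 1 - cd' ^+ 2).
Hypothesis eps1 : eps ^+ 2 = 1.
Let C := vertexC sb sd.
Let C' := vertexC sb' sd'.
Hypothesis hA : vertexA ca sa cb sb cc cd sd * (eps * C') = vertexA ca' sa' cb' sb' cc' cd' sd' * C.
Hypothesis hB : vertexB ca sa cb sb cc cd sd * (eps * C') = vertexB ca' sa' cb' sb' cc' cd' sd' * C.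
Hypothesis hD : vertexD ca sa cb sb cc cd sd * (eps * C') = vertexD ca' sa' cb' sb' cc' cd' sd' * C.
Hypothesis hE : vertexE ca sa cb sb cc cd sd * (eps * C') = vertexE ca' sa' cb' sb' cc' cd' sd' * C.

Lemma comb4 (A B D E A' B' D' E' k m : R) : A * k = A' * m -> B * k = B' * m ->
  D * k = D' * m -> E * k = E' * m -> forall b d e,
  (A + b * B + d * D + e * E) * k = (A' + b * B' + d * D' + e * E') * m.
Proof. by move=> h1 h2 h3 h4 b d e; rewrite !mulrDl -!mulrA h1 h2 h3 h4. Qed.

(* A - B - D + E = - 2 C cos(alpha), and similarly the other sign combinations
   recover cot(beta), cot(delta) and cos(gamma) from the ratios to C. *)
Lemma proportional_angles : [/\ ca' = eps * ca, cb' = eps * cb, cc' = eps * cc & cd' = eps * cd].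
Proof.
have C0 : C != 0 by exact: vertexC_neq0.
have C0' : C' != 0 by exact: vertexC_neq0.
have eca : ca' = eps * ca.
  have := comb4 hA hB hD hE (-1) (-1) 1.
  have -> : vertexA ca sa cb sb cc cd sd + -1 * vertexB ca sa cb sb cc cd sd + -1 * vertexD ca sa cb sb cc cd sd + 1 * vertexE ca sa cb sb cc cd sd = - 2 * ca * C.
    by rewrite /vertexA /vertexB /vertexD /vertexE /C /vertexC; ring.
  have -> : vertexA ca' sa' cb' sb' cc' cd' sd' + -1 * vertexB ca' sa' cb' sb' cc' cd' sd' + -1 * vertexD ca' sa' cb' sb' cc' cd' sd' + 1 * vertexE ca' sa' cb' sb' cc' cd' sd' = - 2 * ca' * C'.
    by rewrite /vertexA /vertexB /vertexD /vertexE /C' /vertexC; ring.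
by move=> h; apply: (mulfI (mulf_neq0 C0 C0')); lra.
have esa : sa' = sa.
  by apply: (@sine_eq R sa' sa ca' ca) => //; rewrite eca exprMn eps1 mul1r.
have [cotd cotb] : cd' * sd = eps * cd * sd' /\ cb' * sb = eps * cb * sb'.
  split.
    have k0 : sa * sb * sb' != 0 by rewrite !mulf_neq0 // lt0r_neq0.
    have := comb4 hA hB hD hE (-1) 1 (-1).
    have -> : vertexA ca sa cb sb cc cd sd + -1 * vertexB ca sa cb sb cc cd sd + 1 * vertexD ca sa cb sb cc cd sd + -1 * vertexE ca sa cb sb cc cd sd = 4 * sa * cd * sb.
      by rewrite /vertexA /vertexB /vertexD /vertexE /C /vertexC; ring.
    have -> : vertexA ca' sa' cb' sb' cc' cd' sd' + -1 * vertexB ca' sa' cb' sb' cc' cd' sd' + 1 * vertexD ca' sa' cb' sb' cc' cd' sd' + -1 * vertexE ca' sa' cb' sb' cc' cd' sd' = 4 * sa * cd' * sb'.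
      by rewrite /vertexA /vertexB /vertexD /vertexE /C' /vertexC ?esa; ring.
by rewrite /C /C' /vertexC => h; apply: (mulfI k0); lra.
  have k0 : sa * sd * sd' != 0 by rewrite !mulf_neq0 // lt0r_neq0.
  have := comb4 hA hB hD hE 1 (-1) (-1).
  have -> : vertexA ca sa cb sb cc cd sd + 1 * vertexB ca sa cb sb cc cd sd + -1 * vertexD ca sa cb sb cc cd sd + -1 * vertexE ca sa cb sb cc cd sd = 4 * sa * cb * sd.
    by rewrite /vertexA /vertexB /vertexD /vertexE /C /vertexC; ring.
  have -> : vertexA ca' sa' cb' sb' cc' cd' sd' + 1 * vertexB ca' sa' cb' sb' cc' cd' sd' + -1 * vertexD ca' sa' cb' sb' cc' cd' sd' + -1 * vertexE ca' sa' cb' sb' cc' cd' sd' = 4 * sa * cb' * sd'.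
    by rewrite /vertexA /vertexB /vertexD /vertexE /C' /vertexC ?esa; ring.
by rewrite /C /C' /vertexC => h; apply: (mulfI k0); lra.
have sin_of (s s' c c' : R) : 0 < s -> 0 < s' -> s ^+ 2 = 1 - c ^+ 2 -> s' ^+ 2 = 1 - c' ^+ 2 ->
    c' * s = eps * c * s' -> c' = eps * c /\ s' = s.
  move=> s0 s0' e e' h.
  have h2 : c' ^+ 2 * s ^+ 2 = c ^+ 2 * s' ^+ 2 by rewrite -exprMn h !exprMn eps1; ring.
  have es : s' = s.
    by apply: (@sine_eq R s' s c' c) => //; rewrite e e' in h2; lra.
  by split=> //; apply: (mulIf (lt0r_neq0 s0)); rewrite h es.
have [ecd esd] := sin_of _ _ _ _ sd0 sd0' ed ed' cotd.
have [ecb esb] := sin_of _ _ _ _ sb0 sb0' eb eb' cotb.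
split=> //.
have := comb4 hA hB hD hE 1 1 1.
have -> : vertexA ca sa cb sb cc cd sd + 1 * vertexB ca sa cb sb cc cd sd + 1 * vertexD ca sa cb sb cc cd sd + 1 * vertexE ca sa cb sb cc cd sd = 4 * cc - 4 * ca * cb * cd.
  by rewrite /vertexA /vertexB /vertexD /vertexE /C /vertexC; ring.
have -> : vertexA ca' sa' cb' sb' cc' cd' sd' + 1 * vertexB ca' sa' cb' sb' cc' cd' sd' + 1 * vertexD ca' sa' cb' sb' cc' cd' sd' + 1 * vertexE ca' sa' cb' sb' cc' cd' sd' = 4 * cc' - 4 * ca' * cb' * cd'.
  by rewrite /vertexA /vertexB /vertexD /vertexE /C' /vertexC; ring.
have -> : C' = C by rewrite /C /C' esb esd.
rewrite eca ecb ecd => h.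
have {}h : (4 * cc - 4 * ca * cb * cd) * eps =
    4 * cc' - 4 * (eps ^+ 2) * eps * ca * cb * cd.
  by apply: (mulIf C0); rewrite -[LHS]mulrA h; ring.
by move: h; rewrite eps1; lra.
Qed.

End ProportionalVertices.

(** * Standard position *)

Section Frames.
Variable R : realType.
Local Notation vec := 'rV[R]_4.
Implicit Types (x y f : vec) (g : 'M[R]_4).

Lemma vec4E (a b c d : R) : [/\ vec4 a b c d 0 i0 = a, vec4 a b c d 0 i1 = b,
  vec4 a b c d 0 i2 = c & vec4 a b c d 0 i3 = d].
Proof. by rewrite /vec4 !mxE. Qed.

Definition frame_mx (f1 f2 f3 f4 : vec) : 'M[R]_4 :=
  \matrix_(i < 4) nth (0 : vec) [:: f1; f2; f3; f4] i.

Lemma vec4_frame (a b c d : R) f1 f2 f3 f4 :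
  vec4 a b c d *m frame_mx f1 f2 f3 f4 = a *: f1 + b *: f2 + c *: f3 + d *: f4.
Proof.
apply/rowP => j; rewrite !mxE sum4.
by have [-> -> -> ->] := vec4E a b c d; rewrite !mxE.
Qed.

Lemma det_frame f1 f2 f3 f4 : \det (frame_mx f1 f2 f3 f4) = det4 f1 f2 f3 f4.
Proof. by []. Qed.

Lemma dot_rotation g x y : is_rotation g -> dot (x *m g) (y *m g) = dot x y.
Proof.
have dotmx u v : dot u v = (u *m v^T) 0 0.
  by rewrite mxE; apply: eq_bigr => i _; rewrite mxE.
by move=> [gg _]; rewrite !dotmx trmx_mul mulmxA -(mulmxA x) gg mulmx1.
Qed.

Lemma det4_rotation g x y z t : is_rotation g ->
  det4 (x *m g) (y *m g) (z *m g) (t *m g) = det4 x y z t.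
Proof.
move=> [_ dg]; rewrite /det4 -[RHS]mulr1 -[X in _ * X]dg -det_mulmx; congr (\det _).
apply/matrixP => i j; rewrite !mxE.
by case: i => [[|[|[|[|]]]]] //= h; rewrite mxE; apply: eq_bigr => k _; rewrite mxE.
Qed.

Definition orthonormal f1 f2 f3 f4 :=
  [/\ [/\ dot f1 f1 = 1, dot f2 f2 = 1, dot f3 f3 = 1 & dot f4 f4 = 1],
      [/\ dot f1 f2 = 0, dot f1 f3 = 0 & dot f1 f4 = 0] &
      [/\ dot f2 f3 = 0, dot f2 f4 = 0 & dot f3 f4 = 0]].

Lemma orthonormal_mx f1 f2 f3 f4 : orthonormal f1 f2 f3 f4 ->
  frame_mx f1 f2 f3 f4 *m (frame_mx f1 f2 f3 f4)^T = 1%:M.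
Proof.
move=> [[e11 e22 e33 e44] [e12 e13 e14] [e23 e24 e34]].
have e : forall i j : 'I_4, (frame_mx f1 f2 f3 f4 *m (frame_mx f1 f2 f3 f4)^T) i j =
    dot (nth (0 : vec) [:: f1; f2; f3; f4] i) (nth 0 [:: f1; f2; f3; f4] j).
  by move=> i j; rewrite mxE; apply: eq_bigr => k _; rewrite !mxE.
apply/matrixP => i j; rewrite e mxE -val_eqE /=.
by case: i => [[|[|[|[|]]]]] //= hi; case: j => [[|[|[|[|]]]]] //= hj; rewrite dotC.
Qed.

Lemma orthonormal_expand f1 f2 f3 f4 x : orthonormal f1 f2 f3 f4 ->
  x = dot x f1 *: f1 + dot x f2 *: f2 + dot x f3 *: f3 + dot x f4 *: f4.
Proof.
move=> /orthonormal_mx /mulmx1C gg; rewrite -vec4_frame -{1}(mulmx1 x) -gg mulmxA.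
congr (_ *m _); apply/rowP => j; rewrite mxE.
case: j => [[|[|[|[|]]]]] //= h; rewrite !mxE /=; apply: eq_bigr => k _;
  by rewrite !mxE.
Qed.

(* Reversing f2 makes the frame positive. *)
Lemma frame_rotation f1 f2 f3 f4 : orthonormal f1 f2 f3 f4 ->
  exists2 e : R, e = 1 \/ e = -1 & is_rotation (frame_mx f1 (e *: f2) f3 f4).
Proof.
move=> of4.
have /eqP : det4 f1 f2 f3 f4 ^+ 2 = 1.
  rewrite -det_frame expr2 -{2}det_tr -det_mulmx orthonormal_mx //; exact: det1.
rewrite sqrf_eq1 => /orP [] /eqP d.
  exists 1; first by left.
  by rewrite scale1r; split; [exact: orthonormal_mx|].
exists (-1); first by right.
split; last first.
  rewrite det_frame; have -> : det4 f1 (-1 *: f2) f3 f4 = - det4 f1 f2 f3 f4.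
    by rewrite !det4E /= !mxE; ring.
  by rewrite d opprK.
apply: orthonormal_mx.
move: of4 => [[e11 e22 e33 e44] [e12 e13 e14] [e23 e24 e34]].
split; split; rewrite ?dot_linE ?e12 ?e23 ?e24 ?e22 ?e11 ?e33 ?e44 ?e34 ?e13 ?e14 //; ring.
Qed.

End Frames.

Section StandardForm.
Variable R : realType.
Local Notation vec := 'rV[R]_4.

(* The standard octahedron with w = cos(theta)^2, where Y i is cos(theta) times the second
   coordinate of the vertex (0, i) and Z j is sin(theta) times the fourth one of (1, j): in
   these coordinates the flexion is the algebraic curve [on_curve]. *)
Definition std_vertex (p q : bool -> R) (w : R) (Y Z : bool -> R) (u : vertex) : vec :=
  let c := Num.sqrt w in
  let s := Num.sqrt (1 - w) in
  match nat_of_ord u.1 with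
  | 0%N => vec4 (p u.2 / c) (Y u.2 / c) 0 0
  | 1%N => vec4 0 0 (q u.2 / s) (Z u.2 / s)
  | _ => vec4 c 0 (if u.2 then - s else s) 0
  end.

Definition on_curve (p q : bool -> R) (w : R) (Y Z : bool -> R) :=
  [/\ 0 < w < 1, forall i, Y i ^+ 2 = w - p i ^+ 2 & forall j, Z j ^+ 2 = 1 - q j ^+ 2 - w].

Definition vtx (k : nat) (b : bool) : vertex := (inord k, b).

Definition standard_dots (p q : bool -> R) (Q : vertex -> vec) :=
  [/\ forall u, dot (Q u) (Q u) = 1,
      forall i j, dot (Q (vtx 0 i)) (Q (vtx 1 j)) = 0,
      forall i k, dot (Q (vtx 0 i)) (Q (vtx 2 k)) = p i &
      forall j k, dot (Q (vtx 1 j)) (Q (vtx 2 k)) = if k then - q j else q j].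

Lemma vtxE (u : vertex) : u = vtx u.1 u.2.
Proof. by case: u => i b; rewrite /vtx inord_val. Qed.

Lemma vertex_ind (P : vertex -> Prop) :
  (forall b, P (vtx 0 b)) -> (forall b, P (vtx 1 b)) -> (forall b, P (vtx 2 b)) -> forall u, P u.
Proof.
by move=> P0 P1 P2 u; rewrite (vtxE u); case: u => [[[|[|[|]]]]] //= h b.
Qed.

Lemma unit_direction (x y f : vec) (a b : R) : dot x x = 1 -> dot y y = 1 -> dot f f = 1 ->
  dot x f = a -> dot y f = b -> a ^+ 2 != b ^+ 2 ->
  exists2 e : vec, dot e e = 1 & dot e f = 0 /\
    exists z s t, [/\ e = s *: z + t *: f & z = x \/ z = y].
Proof.
move=> xx yy ff xf yf ab.
wlog a1 : x y a b xx yy xf yf ab / a ^+ 2 != 1.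
  move=> H; have [a1|a1] := eqVneq (a ^+ 2) 1; last exact: (H x y a b).
  have b1 : b ^+ 2 != 1 by rewrite -a1 eq_sym.
  have [||e ee [ef [z [s [t [E zxy]]]]]] := H y x b a yy xx yf xf => //; first by rewrite eq_sym.
  by exists e => //; split=> //; exists z, s, t; split=> //; case: zxy; [right|left].
pose n := x - a *: f.
have nn : dot n n = 1 - a ^+ 2.
  by rewrite /n !dot_linE xx (dotC f x) xf ff; ring.
have n0 : 0 < dot n n.
  by rewrite lt_neqAle dot_ge0 andbT eq_sym nn subr_eq0 eq_sym.
have [r r0 r2] : exists2 r : R, r != 0 & r ^+ 2 = dot n n.
  by exists (Num.sqrt (dot n n)); [rewrite gt_eqF // sqrtr_gt0|rewrite sqr_sqrtr // dot_ge0].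
exists (r^-1 *: n); first by rewrite dotZl dotZr -r2; field.
split; first by rewrite dotZl /n !dot_linE xf ff; ring.
exists x, r^-1, (- r^-1 * a); split; last by left.
by rewrite /n scalerBr scalerA mulNr scaleNr.
Qed.

Lemma standard_form (p q : bool -> R) (Q : vertex -> vec) :
  p false ^+ 2 != p true ^+ 2 -> q false ^+ 2 != q true ^+ 2 -> standard_dots p q Q ->
  exists g w Y Z, [/\ is_rotation g, on_curve p q w Y Z &
    forall u, Q u = std_vertex p q w Y Z u *m g].
Proof.
move=> pn qn [un d01 d02 d12].
pose t := dot (Q (vtx 2 false)) (Q (vtx 2 true)).
pose w := (1 + t) / 2.
pose m := Q (vtx 2 false) + Q (vtx 2 true).
pose n := Q (vtx 2 false) - Q (vtx 2 true).
have mm : dot m m = 4 * w.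
  by rewrite /m !dot_linE !un (dotC _ (Q (vtx 2 false))) -/t /w; field.
have nn : dot n n = 4 * (1 - w).
  by rewrite /n !dot_linE !un (dotC _ (Q (vtx 2 false))) -/t /w; field.
have mn : dot m n = 0.
  by rewrite /m /n !dot_linE !un (dotC _ (Q (vtx 2 false))); ring.
have a_m i : dot (Q (vtx 0 i)) m = 2 * p i by rewrite /m dotDr !d02; ring.
have a_n i : dot (Q (vtx 0 i)) n = 0 by rewrite /n dotDr dotNr !d02; ring.
have b_m j : dot (Q (vtx 1 j)) m = 0 by rewrite /m dotDr !d12; ring.
have b_n j : dot (Q (vtx 1 j)) n = 2 * q j by rewrite /n dotDr dotNr !d12; ring.
have dot0r x : dot x (0 : vec) = 0 by rewrite -(scale0r (0 : vec)) dotZr mul0r.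
have w0 : 0 < w.
  have : 0 <= dot m m by exact: dot_ge0.
  rewrite mm pmulr_rge0 // le_eqVlt => /orP [/eqP z|//].
  have m0 : m = 0 by apply: dot_eq0; rewrite mm -z mulr0.
  have p0 i : p i = 0.
    by apply/eqP; have := a_m i; rewrite m0 dot0r => /esym/eqP; rewrite mulf_eq0 pnatr_eq0.
  by move: pn; rewrite !p0 eqxx.
have w1 : 0 < 1 - w.
  have : 0 <= dot n n by exact: dot_ge0.
  rewrite nn pmulr_rge0 // le_eqVlt => /orP [/eqP z|//].
  have n0 : n = 0 by apply: dot_eq0; rewrite nn -z mulr0.
  have q0 j : q j = 0.
    by apply/eqP; have := b_n j; rewrite n0 dot0r => /esym/eqP; rewrite mulf_eq0 pnatr_eq0.
  by move: qn; rewrite !q0 eqxx.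
pose c := Num.sqrt w; pose s := Num.sqrt (1 - w).
have c0 : 0 < c by rewrite sqrtr_gt0.
have s0 : 0 < s by rewrite sqrtr_gt0.
have c2 : c ^+ 2 = w by rewrite sqr_sqrtr // ltW.
have s2 : s ^+ 2 = 1 - w by rewrite sqr_sqrtr // ltW.
have [cn sn] : c != 0 /\ s != 0 by rewrite !lt0r_neq0.
pose f1 := (2 * c)^-1 *: m; pose f3 := (2 * s)^-1 *: n.
have f11 : dot f1 f1 = 1 by rewrite dotZl dotZr mm -c2; field.
have f33 : dot f3 f3 = 1 by rewrite dotZl dotZr nn -s2; field.
have f13 : dot f1 f3 = 0 by rewrite dotZl dotZr mn !mulr0.
have a_1 i : dot (Q (vtx 0 i)) f1 = p i / c by rewrite dotZr a_m; field.
have a_3 i : dot (Q (vtx 0 i)) f3 = 0 by rewrite dotZr a_n mulr0.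
have b_1 j : dot (Q (vtx 1 j)) f1 = 0 by rewrite dotZr b_m mulr0.
have b_3 j : dot (Q (vtx 1 j)) f3 = q j / s by rewrite dotZr b_n; field.
have k_1 k : dot (Q (vtx 2 k)) f1 = c.
  transitivity ((2 * w) / (2 * c)); last by rewrite -c2; field.
  rewrite dotZr mulrC; congr (_ / _); rewrite /m dotDr /w.
  by case: k; rewrite un ?(dotC _ (Q (vtx 2 false))) -/t; field.
have k_3 k : dot (Q (vtx 2 k)) f3 = if k then - s else s.
  transitivity ((if k then -1 else 1) * (2 * (1 - w)) / (2 * s)); last first.
    by rewrite -s2; case: k; field.
  rewrite dotZr mulrC; congr (_ / _); rewrite /n dotDr dotNr /w.
  by case: k; rewrite un ?(dotC _ (Q (vtx 2 false))) -/t; field.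
clearbody f1 f3.
have [|f2 f22 [f21 [z2 [s2' [t2 [ef2 hz2]]]]]] :=
  unit_direction (un (vtx 0 false)) (un (vtx 0 true)) f11 (a_1 false) (a_1 true).
  by rewrite !expr_div_n (inj_eq (mulIf _)) // invr_neq0 // expf_neq0.
have [|f4 f44 [f43 [z4 [s4 [t4 [ef4 hz4]]]]]] :=
  unit_direction (un (vtx 1 false)) (un (vtx 1 true)) f33 (b_3 false) (b_3 true).
  by rewrite !expr_div_n (inj_eq (mulIf _)) // invr_neq0 // expf_neq0.
have f41 : dot f4 f1 = 0.
  by rewrite ef4 !dot_linE (dotC f3) f13; case: hz4 => ->; rewrite b_1; ring.
have f23 : dot f2 f3 = 0.
  by rewrite ef2 !dot_linE f13; case: hz2 => ->; rewrite a_3; ring.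
have a_4 i : dot (Q (vtx 0 i)) f4 = 0.
  by rewrite ef4 !dot_linE a_3; case: hz4 => ->; rewrite d01; ring.
have b_2 j : dot (Q (vtx 1 j)) f2 = 0.
  by rewrite ef2 !dot_linE b_1; case: hz2 => ->; rewrite dotC d01; ring.
have f24 : dot f2 f4 = 0.
  by rewrite ef2 !dot_linE (dotC f1) f41; case: hz2 => ->; rewrite a_4; ring.
have of4 : orthonormal f1 f2 f3 f4.
  by split; split=> //; rewrite dotC.
have ka u : dot (Q u) (Q u) = dot (Q u) f1 ^+ 2 + dot (Q u) f2 ^+ 2 + dot (Q u) f3 ^+ 2
    + dot (Q u) f4 ^+ 2.
  by rewrite {2}(orthonormal_expand (Q u) of4) !(dotDr, dotZr) !expr2.
have k_24 k : dot (Q (vtx 2 k)) f2 = 0 /\ dot (Q (vtx 2 k)) f4 = 0.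
  have := ka (vtx 2 k); rewrite un k_1 k_3 => e.
  have e0 : dot (Q (vtx 2 k)) f2 ^+ 2 + dot (Q (vtx 2 k)) f4 ^+ 2 = 0.
    by have h : (if k then - s else s) ^+ 2 = s ^+ 2; [case: k {e}; ring|];
      move: e; rewrite h c2 s2; lra.
  have h2 : dot (Q (vtx 2 k)) f2 ^+ 2 = 0.
    by apply/eqP; rewrite eq_le sqr_ge0 andbT; have := sqr_ge0 (dot (Q (vtx 2 k)) f4); lra.
  have h4 : dot (Q (vtx 2 k)) f4 ^+ 2 = 0 by lra.
  by split; apply/eqP; rewrite -sqrf_eq0 ?h2 ?h4.
have [e e1 rot] := frame_rotation of4.
have ee : e * e = 1 by case: e1 => ->; ring.
exists (frame_mx f1 (e *: f2) f3 f4), w, (fun i => c * (e * dot (Q (vtx 0 i)) f2)),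
  (fun j => s * dot (Q (vtx 1 j)) f4).
split=> //.
  split=> [|i|j]; first by rewrite w0 -subr_gt0.
    have := ka (vtx 0 i); rewrite un a_1 a_3 a_4 => h.
    transitivity (c ^+ 2 * (e * e) * dot (Q (vtx 0 i)) f2 ^+ 2); first by ring.
    have -> : dot (Q (vtx 0 i)) f2 ^+ 2 = 1 - (p i / c) ^+ 2 by lra.
    by rewrite ee -c2; field.
  have := ka (vtx 1 j); rewrite un b_1 b_2 b_3 => h.
  rewrite exprMn; have -> : dot (Q (vtx 1 j)) f4 ^+ 2 = 1 - (q j / s) ^+ 2 by lra.
  transitivity (s ^+ 2 - q j ^+ 2); first by field.
  by rewrite s2; ring.
move=> u; rewrite (orthonormal_expand (Q u) of4).
elim/vertex_ind: u => b; rewrite /std_vertex /vtx /= inordK // vec4_frame scalerA -/c -/s -!/(vtx _ _).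
- rewrite a_1 a_3 a_4; congr (_ + _ *: _ + _ + _).
  by rewrite -[LHS]mul1r -ee; field.
- rewrite b_1 b_2 b_3 mul0r; congr (_ + _ + _ + _ *: _).
  by field.
- by have [-> ->] := k_24 b; rewrite k_1 k_3 mul0r.
Qed.

End StandardForm.

Lemma vtx_named : [/\ vtx 0 false = a1, vtx 1 false = a2 & vtx 2 false = a3].
Proof. by split; congr pair; apply: val_inj; rewrite /= inordK. Qed.

Lemma vtx_swapped b :
  [/\ swap12 (vtx 0 b) = vtx 1 b, swap12 (vtx 1 b) = vtx 0 b & swap12 (vtx 2 b) = vtx 2 b].
Proof.
by split; rewrite /swap12 /= inordK //; congr pair; apply: val_inj; rewrite /= inordK.
Qed.

(** * Octahedra with given edge lengths *)

Section Combinatorics.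

Lemma is_faceC u v w : is_face u v w -> is_face v u w.
Proof. by case/and3P => h1 h2 h3; rewrite /is_face eq_sym h1 eq_sym h3 eq_sym h2. Qed.

Lemma is_face_rot u v w : is_face u v w -> is_face v w u.
Proof. by case/and3P => h1 h2 h3; rewrite /is_face h1 h2 h3. Qed.

Lemma is_face_opp u v w : is_face u v w -> is_face u v (opp_vertex w).
Proof. by []. Qed.

Lemma is_face_opp2 u v w : is_face u v w -> is_face u (opp_vertex v) w.
Proof. by []. Qed.

Lemma face_positiveC u v w : is_face u v w -> face_positive v u w = ~~ face_positive u v w.
Proof.
case: u v w => [[[|[|[|]]]] //= h1 b1] [[[|[|[|]]]] //= h2 b2] [[[|[|[|]]]] //= h3 b3];
  rewrite /is_face /= -?val_eqE //= => _; rewrite /face_positive -?val_eqE /=;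
  by case: b1 b2 b3 => [] [] [].
Qed.

Lemma face_positive_opp u v w : face_positive u v (opp_vertex w) = ~~ face_positive u v w.
Proof. by rewrite /face_positive /=; case: (v.1 == _) u.2 v.2 w.2 => [] [] [] []. Qed.

Lemma third_index u v w w' : is_face u v w -> is_face u v w' -> w' = w \/ w' = opp_vertex w.
Proof.
case: u v w w' => [[[|[|[|]]]] //= h1 b1] [[[|[|[|]]]] //= h2 b2] [[[|[|[|]]]] //= h3 b3]
  [[[|[|[|]]]] //= h4 b4]; rewrite /is_face /= -?val_eqE //= => _ _;
  rewrite /opp_vertex /= (bool_irrelevance h4 h3);
  by case: b3 b4 => [] []; auto.
Qed.

Lemma edge_of_inj u v u' v' : u.1 != v.1 -> u'.1 != v'.1 -> edge_of u v = edge_of u' v' ->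
  (u' = u /\ v' = v) \/ (u' = v /\ v' = u).
Proof.
move=> uv uv' /(congr1 val); rewrite !val_edge_of // => e.
have uv1 : u' != v' by apply: contraNneq uv' => ->.
have : u' \in [set u; v]%SET by rewrite e !inE eqxx.
have : v' \in [set u; v]%SET by rewrite e !inE eqxx orbT.
rewrite !inE => /orP [] /eqP ev /orP [] /eqP eu; [|by right|by left|];
  by move: uv1; rewrite eu ev eqxx.
Qed.

Lemma edge_ofP (e : edge) : exists u v w, is_face u v w /\ e = edge_of u v.
Proof.
case: e => e he; case/existsP: (he) => u /existsP [v /andP [uv /eqP ee]].
have [k [hk1 hk2]] : exists k : 'I_3, v.1 != k /\ k != u.1.
  move: u v uv {he ee} => [[[|[|[|]]]] //= h1 b1] [[[|[|[|]]]] //= h2 b2]; rewrite -?val_eqE //= => _;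
  by [exists (@Ordinal 3 0 isT)|exists (@Ordinal 3 1 isT)|exists (@Ordinal 3 2 isT)].
exists u, v, (k, false); split; first by rewrite /is_face uv hk1 hk2.
by apply: val_inj; rewrite val_edge_of.
Qed.

Definition renaming (sigma : vertex -> vertex) := sigma = id \/ sigma = swap12.

Variable sigma : vertex -> vertex.
Hypothesis hsigma : renaming sigma.

Lemma renaming_opp u : opp_vertex (sigma u) = sigma (opp_vertex u).
Proof. by case: hsigma => -> //; case: u => [[[|[|[|]]]] //= h b]. Qed.

Lemma renamingK u : sigma (sigma u) = u.
Proof.
case: hsigma => -> //; case: u => [[[|[|[|]]]] //= h b];
  by congr (_, _); apply: val_inj.
Qed.

Lemma renaming_idx u v : ((sigma u).1 == (sigma v).1) = (u.1 == v.1).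
Proof.
by case: hsigma => -> //; case: u v => [[[|[|[|]]]] //= h b] [[[|[|[|]]]] //= h' b'].
Qed.

Lemma renaming_face u v w : is_face (sigma u) (sigma v) (sigma w) = is_face u v w.
Proof. by rewrite /is_face !renaming_idx. Qed.

Lemma renaming_positive : exists s : bool, forall u v w, is_face u v w ->
  face_positive (sigma u) (sigma v) (sigma w) = s (+) face_positive u v w.
Proof.
case: hsigma => ->; [by exists false|exists true].
case=> [[[|[|[|]]]] //= h1 b1] [[[|[|[|]]]] //= h2 b2] [[[|[|[|]]]] //= h3 b3];
  rewrite /is_face /= -?val_eqE //= => _; rewrite /face_positive -?val_eqE /=;
  by case: b1 b2 b3 => [] [] [].
Qed.

End Combinatorics.

Section Octahedron.
Variables (R : realType) (l : edge -> R).
Hypothesis hl : nondegenerate_lengths l.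
Local Notation vec := 'rV[R]_4.
Implicit Types (P : vertex -> vec) (x : edge -> option R) (u v w : vertex).

Definition cosl u v := cos (l (edge_of u v)).
Definition sinl u v := sin (l (edge_of u v)).
Local Notation fa := (face_angle l).

Lemma coslC u v : cosl u v = cosl v u. Proof. by rewrite /cosl edge_ofC. Qed.

Lemma face_angleC u v w : fa u v w = fa u w v.
Proof.
by rewrite /face_angle (edge_ofC v w) [cos _ * _]mulrC [sin _ * _]mulrC.
Qed.

Lemma sinl_gt0 u v : 0 < sinl u v.
Proof. by apply: sin_gt0_pi; case: hl => h _; exact: h. Qed.

Lemma sinl_sqr u v : sinl u v ^+ 2 = 1 - cosl u v ^+ 2.
Proof. exact: sin_sqr. Qed.

Lemma cosl_sqr_lt1 u v : cosl u v ^+ 2 < 1.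
Proof. by rewrite -subr_gt0 -sinl_sqr exprn_gt0 // sinl_gt0. Qed.

Lemma face_gram_gt0 u v w : is_face u v w ->
  0 < 1 + 2 * cosl u v * cosl u w * cosl v w - cosl u v ^+ 2 - cosl u w ^+ 2 - cosl v w ^+ 2.
Proof.
move=> f; have [hpi hf] := hl.
have [h1 h2] := hf _ _ _ f; have [h3 _] := hf _ _ _ (is_face_rot f).
have [h4 _] := hf _ _ _ (is_face_rot (is_face_rot f)).
have := triangle_gram_gt0 (hpi (edge_of u v)) (hpi (edge_of w u)) (hpi (edge_of v w)).
rewrite /cosl (edge_ofC u w); apply; lra.
Qed.

Lemma acos_angle (c s : R) : 0 < s -> s ^+ 2 = 1 - c ^+ 2 -> cos (acos c) = c /\ sin (acos c) = s.
Proof.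
move=> s0 e; have c1 : -1 <= c <= 1 by nra.
by rewrite acosK ?in_itv // sin_acos // -e sqrtr_sqr gtr0_norm.
Qed.

Lemma face_triangle u v w : is_face u v w ->
  triangle (cosl u v) (cosl u w) (cosl v w) (sinl u v) (sinl u w) (sinl v w)
    (cos (fa u v w)) (sin (fa u v w)) (cos (fa v u w)) (sin (fa v u w))
    (cos (fa w u v)) (sin (fa w u v)).
Proof.
move=> f; set V := 1 + 2 * cosl u v * cosl u w * cosl v w - cosl u v ^+ 2
  - cosl u w ^+ 2 - cosl v w ^+ 2.
have V0 : 0 < V by exact: face_gram_gt0.
have T : triangle _ _ _ _ _ _ _ _ _ _ _ _ :=
  triangleP (sinl_gt0 u v) (sinl_gt0 u w) (sinl_gt0 v w)
  (v := Num.sqrt V) _ (sinl_sqr _ _) (sinl_sqr _ _) (sinl_sqr _ _) (sqr_sqrtr (ltW V0)).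
have {}T := T (ltac:(by rewrite sqrtr_gt0)).
have [_ [p1 p2 p3] _ [q1 q2 q3] _ _ _ _ _ _ _ _] := T.
have [c1 s1] := acos_angle p1 q1; have [c2 s2] := acos_angle p2 q2.
have [c3 s3] := acos_angle p3 q3.
rewrite -{1}c1 -{1}s1 -{1}c2 -{1}s2 -{1}c3 -{1}s3 in T.
have e1 : fa u v w = acos ((cosl v w - cosl u v * cosl u w) / (sinl u v * sinl u w)) by [].
have e2 : fa v u w = acos ((cosl u w - cosl u v * cosl v w) / (sinl u v * sinl v w)).
  by rewrite /face_angle /cosl /sinl (edge_ofC v u).
have e3 : fa w u v = acos ((cosl u v - cosl u w * cosl v w) / (sinl u w * sinl v w)).
  by rewrite /face_angle /cosl /sinl (edge_ofC w u) (edge_ofC w v).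
by rewrite e1 e2 e3.
Qed.

Lemma face_angle_sin u v w : is_face u v w ->
  0 < sin (fa u v w) /\ sin (fa u v w) ^+ 2 = 1 - cos (fa u v w) ^+ 2.
Proof. by move=> /face_triangle [_ [+ _ _] _ [+ _ _] _ _ _ _ _ _ _ _]. Qed.

Lemma vertex_equationE x u v1 v2 :
  let v3 := opp_vertex v1 in
  let v4 := opp_vertex v2 in
  let ca := cos (fa u v1 v2) in let sa := sin (fa u v1 v2) in
  let cb := cos (fa u v2 v3) in let sb := sin (fa u v2 v3) in
  let cc := cos (fa u v3 v4) in
  let cd := cos (fa u v4 v1) in let sd := sin (fa u v4 v1) in
  let X1 := homX (x (edge_of u v1)) in
  let Y1 := homY (x (edge_of u v1)) in
  let X2 := homX (x (edge_of u v2)) in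
  let Y2 := homY (x (edge_of u v2)) in
  vertex_equation l x u v1 v2 <->
  vertexA ca sa cb sb cc cd sd * X1 ^+ 2 * X2 ^+ 2 + vertexB ca sa cb sb cc cd sd * X1 ^+ 2 * Y2 ^+ 2
  + 2 * vertexC sb sd * X1 * Y1 * X2 * Y2 + vertexD ca sa cb sb cc cd sd * Y1 ^+ 2 * X2 ^+ 2
  + vertexE ca sa cb sb cc cd sd * Y1 ^+ 2 * Y2 ^+ 2 = 0.
Proof.
cbv zeta; rewrite /vertex_equation /vertexA /vertexB /vertexC /vertexD /vertexE; cbv zeta.
by rewrite !(cosB, sinB, cosD, sinD).
Qed.

Section Realization.
Variable P : vertex -> vec.
Hypotheses (oP : octahedron P) (lP : has_edge_lengths P l).

Lemma dot_le1 (a b : vec) : dot a a = 1 -> dot b b = 1 -> -1 <= dot a b <= 1.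
Proof.
move=> aa bb; have := dot_ge0 (a - b); have := dot_ge0 (a + b).
by rewrite !dot_linE aa bb (dotC b a) => h1 h2; apply/andP; split; lra.
Qed.

Lemma dot_unit u : dot (P u) (P u) = 1. Proof. by case: oP. Qed.

Lemma dot_cosl u v : u.1 != v.1 -> dot (P u) (P v) = cosl u v.
Proof.
move=> uv; rewrite /cosl -lP // acosK // in_itv /=.
by apply: dot_le1; exact: dot_unit.
Qed.

Lemma face_idx u v w : is_face u v w -> [/\ u.1 != v.1, v.1 != w.1 & u.1 != w.1].
Proof. by case/and3P => h1 h2 h3; rewrite [u.1 == w.1]eq_sym. Qed.

Lemma gram_face u v w : is_face u v w ->
  gram (P u) (P v) (P w) (P w) = (sinl u v * sinl u w * sin (fa u v w)) ^+ 2.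
Proof.
move=> f; have [uv vw uw] := face_idx f.
rewrite /gram dot_unit !dot_cosl //.
have [_ _ [p1 p2 _] [p3 _ _] _ _ li _ _ _ _ _] := face_triangle f.
rewrite !exprMn p3 li; transitivity (sinl u v ^+ 2 * sinl u w ^+ 2 -
  (sinl u v * sinl u w * cos (fa u v w)) ^+ 2); last by ring.
by rewrite p1 p2; ring.
Qed.

Lemma gram_face_gt0 u v w : is_face u v w -> 0 < gram (P u) (P v) (P w) (P w).
Proof.
move=> f; rewrite gram_face // exprn_gt0 // !mulr_gt0 ?sinl_gt0 //.
by case: (face_angle_sin f).
Qed.

Lemma gram_norm_face u v w : is_face u v w ->
  gram_norm (P u) (P v) (P w) (P (opp_vertex w)) =
    (sinl u v * sinl u w * sin (fa u v w)) *
    (sinl u v * sinl u (opp_vertex w) * sin (fa u v (opp_vertex w))).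
Proof.
move=> f; have f' := is_face_opp f; rewrite /gram_norm !gram_face // -exprMn sqrtr_sqr ger0_norm //.
by rewrite !mulr_ge0 ?ltW ?sinl_gt0 //; [case: (face_angle_sin f)|case: (face_angle_sin f')].
Qed.

Lemma dihedral_cosE u v w : is_face u v w ->
  let w' := opp_vertex w in
  dihedral_cos P u v w w' =
  (dot (P w) (P w') - cosl u w * cosl u w' - sinl u w * sinl u w' * (cos (fa u v w) * cos (fa u v w')))
  / (sinl u w * sinl u w' * (sin (fa u v w) * sin (fa u v w'))).
Proof.
move=> f w'; have f' : is_face u v w' by exact: is_face_opp.
have [uv vw uw] := face_idx f; have [_ vw' uw'] := face_idx f'.
rewrite /dihedral_cos gram_norm_face // -/w'.
have [[x0 _ _] _ [px _ _] _ _ _ li _ _ _ _ _] := face_triangle f.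
have [_ _ _ _ _ _ li' _ _ _ _ _] := face_triangle f'.
have [s0 _] := face_angle_sin f; have [s0' _] := face_angle_sin f'.
rewrite /gram (dot_cosl uv) (dot_cosl uw) (dot_cosl vw) (dot_cosl uw') (dot_cosl vw').
have -> : dot (P w) (P w') * (1 - cosl u v ^+ 2) - cosl u w * cosl u w' - cosl v w * cosl v w' +
   cosl u v * (cosl u w * cosl v w' + cosl v w * cosl u w') =
   sinl u v ^+ 2 * (dot (P w) (P w') - cosl u w * cosl u w'
     - sinl u w * sinl u w' * (cos (fa u v w) * cos (fa u v w'))).
  rewrite li li'; transitivity ((1 - cosl u v ^+ 2) * (dot (P w) (P w') - cosl u w * cosl u w')
    - sinl u v ^+ 2 * (sinl u w * sinl u w' * (cos (fa u v w) * cos (fa u v w')))); first by ring.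
  by rewrite -px; ring.
field; rewrite !gt_eqF ?sinl_gt0 //.
Qed.

Lemma half_tangent_face x u v w : has_half_tangents P x -> is_face u v w ->
  x (edge_of u v) = tan_half (dihedral_cos P u v w (opp_vertex w))
    (dihedral_sin P u v w (opp_vertex w)) /\
  dihedral_cos P u v w (opp_vertex w) ^+ 2 + dihedral_sin P u v w (opp_vertex w) ^+ 2 = 1.
Proof.
move=> hx f; have [phi [dphi ->]] := hx _ _ _ f; have [uv _ _] := face_idx f.
have [] := dihedral_cos_sin (dot_unit u) (dot_unit v) _ dphi.
  by rewrite dot_cosl // cosl_sqr_lt1.
by move=> <- <-; split; [exact: half_tanE|exact: cos2Dsin2].
Qed.

Lemma half_tangents_exist : exists x, has_half_tangents P x.
Proof.
have hphi u v w : is_face u v w -> exists phi, dihedral_angle P u v w (opp_vertex w) phi.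
  move=> f; have [uv _ _] := face_idx f; apply: dihedral_exists; rewrite ?dot_unit //.
  - by rewrite dot_cosl // cosl_sqr_lt1.
  - exact: gram_face_gt0.
  - exact/gram_face_gt0/is_face_opp.
pose t u v w := tan_half (dihedral_cos P u v w (opp_vertex w))
    (dihedral_sin P u v w (opp_vertex w)).
have t1 u v w : is_face u v w -> t v u w = t u v w.
  move=> f; rewrite /t; congr tan_half.
    rewrite /dihedral_cos /gram_norm.
    have g y z : gram (P v) (P u) y z = gram (P u) (P v) y z.
      by rewrite /gram (dotC (P v) (P u)); ring.
    by rewrite !g.
  rewrite /dihedral_sin /gram_norm /orient (face_positiveC f) (dotC (P v) (P u)).
  have g y z : gram (P v) (P u) y z = gram (P u) (P v) y z.
    by rewrite /gram (dotC (P v) (P u)); ring.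
  rewrite !g; congr (_ / _).
  have -> : det4 (P v) (P u) (P w) (P (opp_vertex w)) = - det4 (P u) (P v) (P w) (P (opp_vertex w)).
    by rewrite !det4E /=; ring.
  by case: face_positive => /=; ring.
have t2 u v w : is_face u v w -> t u v (opp_vertex w) = t u v w.
  have ww : opp_vertex (opp_vertex w) = w by case: w => i b; rewrite /opp_vertex /= negbK.
  move=> f; rewrite /t ww; congr tan_half.
    rewrite /dihedral_cos /gram_norm [gram _ _ (P w) (P w) * _]mulrC.
    by congr (_ / _); rewrite /gram (dotC (P w)); ring.
  rewrite /dihedral_sin /gram_norm /orient face_positive_opp.
  rewrite [gram _ _ (P w) (P w) * _]mulrC; congr (_ / _).
  have -> : det4 (P u) (P v) (P (opp_vertex w)) (P w) = - det4 (P u) (P v) (P w) (P (opp_vertex w)).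
    by rewrite !det4E /=; ring.
  by case: face_positive => /=; ring.
have tw u v w w' : is_face u v w -> is_face u v w' -> t u v w' = t u v w.
  by move=> f f'; have [->|->] := third_index f f'; rewrite ?t2.
have /choice [x hx] : forall e : edge, exists s, forall u v w, is_face u v w ->
    e = edge_of u v -> s = t u v w.
  move=> e; have [u0 [v0 [w0 [f0 e0]]]] := edge_ofP e.
  exists (t u0 v0 w0) => u v w f; rewrite e0 => E.
  have [uv _ _] := face_idx f; have [uv0 _ _] := face_idx f0.
  have [[eu ev]|[eu ev]] := edge_of_inj uv0 uv E; rewrite eu ev in f *.
    exact: tw.
  by rewrite -(t1 _ _ _ f); apply: tw => //; exact: is_faceC.
exists x => u v w f; have [phi dphi] := hphi u v w f; exists phi; split=> //.
have [uv _ _] := face_idx f.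
rewrite (hx _ u v w) // half_tanE.
have [] := dihedral_cos_sin (dot_unit u) (dot_unit v) _ dphi.
  by rewrite dot_cosl // cosl_sqr_lt1.
by move=> -> ->.
Qed.

End Realization.
End Octahedron.

Section StandardOctahedra.
Variables (R : realType) (p q : bool -> R).
Local Notation vec := 'rV[R]_4.
Implicit Types (w : R) (Y Z : bool -> R).

Section Point.
Variables (w : R) (Y Z : bool -> R).
Hypothesis hc : on_curve p q w Y Z.
Local Notation S := (std_vertex p q w Y Z).
Let c := Num.sqrt w.
Let s := Num.sqrt (1 - w).

Lemma curve_sqrt : [/\ c != 0, s != 0, c ^+ 2 = w & s ^+ 2 = 1 - w].
Proof.
case: hc => /andP [w0 w1] _ _; have w1' : 0 < 1 - w by rewrite subr_gt0.
by rewrite /c /s !gt_eqF ?sqrtr_gt0 // !sqr_sqrtr // ltW.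
Qed.

Lemma curve_neq0 : w != 0 /\ 1 - w != 0.
Proof. by case: curve_sqrt => c0 s0 <- <-; rewrite !expf_neq0. Qed.

Lemma std_vertexE b : [/\ S (vtx 0 b) = vec4 (p b / c) (Y b / c) 0 0,
  S (vtx 1 b) = vec4 0 0 (q b / s) (Z b / s) &
  S (vtx 2 b) = vec4 c 0 (if b then - s else s) 0].
Proof. by rewrite /std_vertex /vtx /= !inordK. Qed.

Lemma dot_vec4 (a1 a2 a3 a4 b1 b2 b3 b4 : R) :
  dot (vec4 a1 a2 a3 a4) (vec4 b1 b2 b3 b4) = a1 * b1 + a2 * b2 + a3 * b3 + a4 * b4.
Proof.
rewrite dotE; have [-> -> -> ->] := vec4E a1 a2 a3 a4.
by have [-> -> -> ->] := vec4E b1 b2 b3 b4.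
Qed.

Lemma det4_vec4 (a1 a2 a3 a4 b1 b2 b3 b4 c1 c2 c3 c4 d1 d2 d3 d4 : R) :
  det4 (vec4 a1 a2 a3 a4) (vec4 b1 b2 b3 b4) (vec4 c1 c2 c3 c4) (vec4 d1 d2 d3 d4) =
    a1 * (b2 * (c3 * d4 - c4 * d3) - b3 * (c2 * d4 - c4 * d2) + b4 * (c2 * d3 - c3 * d2))
  - a2 * (b1 * (c3 * d4 - c4 * d3) - b3 * (c1 * d4 - c4 * d1) + b4 * (c1 * d3 - c3 * d1))
  + a3 * (b1 * (c2 * d4 - c4 * d2) - b2 * (c1 * d4 - c4 * d1) + b4 * (c1 * d2 - c2 * d1))
  - a4 * (b1 * (c2 * d3 - c3 * d2) - b2 * (c1 * d3 - c3 * d1) + b3 * (c1 * d2 - c2 * d1)).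
Proof.
rewrite det4E; cbv zeta beta; have [-> -> -> ->] := vec4E a1 a2 a3 a4.
have [-> -> -> ->] := vec4E b1 b2 b3 b4; have [-> -> -> ->] := vec4E c1 c2 c3 c4.
by have [-> -> -> ->] := vec4E d1 d2 d3 d4.
Qed.

Lemma std_dot00 : dot (S (vtx 0 false)) (S (vtx 0 true)) = (p false * p true + Y false * Y true) / w.
Proof.
have [-> _ _] := std_vertexE false; have [-> _ _] := std_vertexE true.
have [c0 _ <- _] := curve_sqrt; rewrite dot_vec4; field => //.
Qed.

Lemma std_dot11 : dot (S (vtx 1 false)) (S (vtx 1 true)) =
  (q false * q true + Z false * Z true) / (1 - w).
Proof.
have [_ -> _] := std_vertexE false; have [_ -> _] := std_vertexE true.
have [_ s0 _ <-] := curve_sqrt; rewrite dot_vec4; field => //.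
Qed.

Lemma std_dot22 : dot (S (vtx 2 false)) (S (vtx 2 true)) = 2 * w - 1.
Proof.
have [_ _ ->] := std_vertexE false; have [_ _ ->] := std_vertexE true.
have [_ _ ec es] := curve_sqrt; rewrite dot_vec4.
by transitivity (c ^+ 2 - s ^+ 2); [ring|rewrite ec es; ring].
Qed.

Lemma std_standard_dots : standard_dots p q S.
Proof.
have [c0 s0 ec es] := curve_sqrt; have [w0 w1] := curve_neq0.
case: hc => _ hY hZ; split.
- elim/vertex_ind => b; have [e0 e1 e2] := std_vertexE b; rewrite ?e0 ?e1 ?e2 dot_vec4.
  + transitivity ((p b ^+ 2 + Y b ^+ 2) / c ^+ 2); first by field.
    by rewrite hY ec addrC subrK divff.
  + transitivity ((q b ^+ 2 + Z b ^+ 2) / s ^+ 2); first by field.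
    rewrite hZ es (_ : q b ^+ 2 + _ = 1 - w) ?divff //; ring.
  + transitivity (c ^+ 2 + s ^+ 2); first by case: b {e0 e1 e2}; ring.
    by rewrite ec es; ring.
- move=> i j; have [-> _ _] := std_vertexE i; have [_ -> _] := std_vertexE j.
  by rewrite dot_vec4; ring.
- move=> i k; have [-> _ _] := std_vertexE i; have [_ _ ->] := std_vertexE k.
  by rewrite dot_vec4; field.
- move=> j k; have [_ -> _] := std_vertexE j; have [_ _ ->] := std_vertexE k.
  by rewrite dot_vec4; case: k; field.
Qed.

Lemma std_det01 i j : det4 (S (vtx 0 i)) (S (vtx 1 j)) (S (vtx 2 false)) (S (vtx 2 true)) =
  2 * (Y i * Z j).
Proof.
have [-> _ _] := std_vertexE i; have [_ -> _] := std_vertexE j.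
have [_ _ ->] := std_vertexE false; have [_ _ ->] := std_vertexE true.
have [c0 s0 _ _] := curve_sqrt; rewrite det4_vec4; field; exact/andP.
Qed.

Lemma std_det12 j k : det4 (S (vtx 1 j)) (S (vtx 2 k)) (S (vtx 0 false)) (S (vtx 0 true)) =
  (if k then 1 else -1) * Z j * (p false * Y true - p true * Y false) / w.
Proof.
have [-> _ _] := std_vertexE false; have [-> _ _] := std_vertexE true.
have [_ -> _] := std_vertexE j; have [_ _ ->] := std_vertexE k.
have [c0 s0 <- _] := curve_sqrt; rewrite det4_vec4; case: k; field; exact/andP.
Qed.

Lemma std_det02 i k : det4 (S (vtx 0 i)) (S (vtx 2 k)) (S (vtx 1 false)) (S (vtx 1 true)) =
  - Y i * (q false * Z true - q true * Z false) / (1 - w).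
Proof.
have [_ -> _] := std_vertexE false; have [_ -> _] := std_vertexE true.
have [-> _ _] := std_vertexE i; have [_ _ ->] := std_vertexE k.
have [c0 s0 _ <-] := curve_sqrt; rewrite det4_vec4; case: k; field; exact/andP.
Qed.

End Point.

Lemma std_vertex_of_parameters (d1 d2 e1 e2 theta : R) :
  is_sign d1 -> is_sign d2 -> is_sign e1 -> is_sign e2 ->
  admissible (p false) (p true) (q false) (q true) theta ->
  exists w Y Z, on_curve p q w Y Z /\
    standard_octahedron (p false) (p true) (q false) (q true) d1 d2 e1 e2 theta
      =1 std_vertex p q w Y Z.
Proof.
move=> hd1 hd2 he1 he2 [/andP [t0 t1] [ra1 ra2 rb1 rb2]].
have c0 : 0 < cos theta.
  by apply: cos_gt0_pihalf; rewrite t1 andbT (lt_trans _ t0) // oppr_lt0 divr_gt0 // pi_gt0.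
have s0 : 0 < sin theta.
  by apply: sin_gt0_pi; rewrite t0 /= (lt_le_trans t1) // ler_pdivrMr // ler_peMr ?pi_ge0 // ler1n.
have sg (d : R) : is_sign d -> d ^+ 2 = 1 by case=> ->; ring.
set c := cos theta in c0 ra1 ra2 *; set s := sin theta in s0 rb1 rb2 *.
have cs : c ^+ 2 + s ^+ 2 = 1 by exact: cos2Dsin2.
have sw : Num.sqrt (c ^+ 2) = c by rewrite sqrtr_sqr gtr0_norm.
have sw1 : Num.sqrt (1 - c ^+ 2) = s by rewrite -cs addrC addKr sqrtr_sqr gtr0_norm.
have cn : c != 0 by rewrite gt_eqF.
have sn : s != 0 by rewrite gt_eqF.
exists (c ^+ 2), (fun i => c * ((if i then d2 else d1) * Num.sqrt (1 - p i ^+ 2 / c ^+ 2))),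
  (fun j => s * ((if j then e2 else e1) * Num.sqrt (1 - q j ^+ 2 / s ^+ 2))); split.
  split.
  - by rewrite exprn_gt0 //= -subr_gt0 -cs addrC addKr exprn_gt0.
  - move=> i; have ri : 0 <= 1 - p i ^+ 2 / c ^+ 2 by case: i.
    by rewrite !exprMn sqr_sqrtr // (sg (if i then d2 else d1)); [field|case: i {ri}].
  - move=> j; have rj : 0 <= 1 - q j ^+ 2 / s ^+ 2 by case: j.
    rewrite !exprMn sqr_sqrtr // (sg (if j then e2 else e1)); last by case: j {rj}.
    rewrite mul1r; transitivity (s ^+ 2 - q j ^+ 2); first by field.
    by lra.
elim/vertex_ind => b; rewrite /standard_octahedron /std_vertex /vtx /= inordK // ?sw ?sw1 -/c -/s.
- by case: b; congr vec4; field.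
- by case: b; congr vec4; field.
- by case: b.
Qed.

Lemma sign_sqrt (z r : R) : z ^+ 2 = r -> exists2 d : R, is_sign d & z = d * Num.sqrt r.
Proof.
move=> <-; rewrite sqrtr_sqr; have [z0|z0] := leP 0 z.
  by exists 1; [left|rewrite mul1r ger0_norm].
by exists (-1); [right|rewrite ltr0_norm // mulrNN mul1r].
Qed.

Lemma parameters_of_std_vertex w Y Z : on_curve p q w Y Z ->
  exists d1 d2 e1 e2 theta : R, [/\ is_sign d1, is_sign d2, is_sign e1 & is_sign e2] /\
    admissible (p false) (p true) (q false) (q true) theta /\
    standard_octahedron (p false) (p true) (q false) (q true) d1 d2 e1 e2 theta
      =1 std_vertex p q w Y Z.
Proof.
move=> hc; have [c0 s0 ec es] := curve_sqrt hc.
case: (hc) => /andP [w0 w1] hY hZ.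
set c := Num.sqrt w in c0 ec; set s := Num.sqrt (1 - w) in s0 es.
have cp : 0 < c by rewrite sqrtr_gt0.
have sp : 0 < s by rewrite sqrtr_gt0 subr_gt0.
have cs : c ^+ 2 + s ^+ 2 = 1 by rewrite ec es; ring.
have s2 : s ^+ 2 = 1 - c ^+ 2 by lra.
have [ct st] := acos_angle sp s2.
have hp i : 1 - p i ^+ 2 / c ^+ 2 = (Y i / c) ^+ 2 by rewrite expr_div_n hY -ec; field.
have hq j : 1 - q j ^+ 2 / s ^+ 2 = (Z j / s) ^+ 2.
  rewrite expr_div_n hZ (_ : 1 - q j ^+ 2 - w = s ^+ 2 - q j ^+ 2); first by field.
  by rewrite es; ring.
have [d1 hd1 ed1] := sign_sqrt (esym (hp false)).
have [d2 hd2 ed2] := sign_sqrt (esym (hp true)).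
have [e1 he1 ee1] := sign_sqrt (esym (hq false)).
have [e2 he2 ee2] := sign_sqrt (esym (hq true)).
have c1 : -1 < c < 1 by nra.
have tpi : 0 < acos c < pi / 2.
  have a0 : 0 < acos c by apply: acos_gt0; rewrite !ltW //; case/andP: c1.
  rewrite a0 ltNge; apply/negP => h.
  have api : acos c <= pi by apply: acos_lepi; case/andP: c1 => *; rewrite !ltW.
  have : cos (acos c) <= 0.
    rewrite -(@cos_pihalf R); move: h; rewrite le_eqVlt => /orP [/eqP -> //|h].
    by apply/ltW/cos_lt_pi => //; rewrite divr_ge0 ?pi_ge0.
  by rewrite ct leNgt cp.
exists d1, d2, e1, e2, (acos c); split; first by [].
split; first by split=> //; rewrite ct st !hp !hq !sqr_ge0.
elim/vertex_ind => b; rewrite /standard_octahedron /std_vertex /vtx /= inordK // ?ct ?st -/c -/s.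
- by case: b; rewrite -?ed1 -?ed2.
- by case: b; rewrite -?ee1 -?ee2.
- by case: b.
Qed.

End StandardOctahedra.

Section TanHalf.
Variable R : realType.

Lemma tan_half_prop (C S K : R) : 0 < K -> C ^+ 2 + S ^+ 2 = K ^+ 2 ->
  let x := tan_half (C / K) (S / K) in
  exists m n, [/\ S = m * homX x, K + C = m * homY x, K - C = n * homX x, S = n * homY x &
    m != 0 \/ n != 0].
Proof.
move=> K0 e; have Kn : K != 0 by rewrite gt_eqF.
have K2 : K - C + (K + C) = 2 * K by ring.
rewrite /tan_half; have -> : 1 + C / K = (K + C) / K by field.
rewrite mulf_eq0 invr_eq0 (negPf Kn) orbF; case: eqVneq => [KC|KC] /=.
  have S0 : S = 0.
    apply/eqP; rewrite -sqrf_eq0; apply/eqP.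
    by transitivity ((K + C) * (K - C)); [lra|rewrite KC mul0r].
  exists 0, (2 * K); rewrite !mulr0 !mul0r mulr1 S0 KC; split=> //; first by lra.
  by right; rewrite mulf_neq0 // pnatr_eq0.
exists (K + C), S; rewrite !mulr1; split=> //.
- by field; rewrite Kn KC.
- have -> : K - C = (K ^+ 2 - C ^+ 2) / (K + C) by field.
  by rewrite -e; field; rewrite KC Kn.
- by left.
Qed.

Lemma tan_half_some (c s t : R) : c ^+ 2 + s ^+ 2 = 1 -> tan_half c s = Some t ->
  1 + c != 0 /\ t ^+ 2 = (1 - c) / (1 + c).
Proof.
rewrite /tan_half => e; case: eqVneq => // c1 [<-]; split=> //.
have s2 : s ^+ 2 = (1 - c) * (1 + c) by lra.
by rewrite expr_div_n s2; field.
Qed.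

End TanHalf.

Section ScaleMultihomogeneous.
Variables (R : realType) (I : finType).

Lemma multihomogeneous_scale (f : mpoly (#|I| + #|I|) R) (h h' : 'I_(#|I| + #|I|) -> R) (c : I -> R) :
  multihomogeneous f ->
  (forall e, h' (idxX e) = c e * h (idxX e) /\ h' (idxY e) = c e * h (idxY e)) ->
  exists2 k, ((forall e, c e != 0) -> k != 0) & meval h' f = k * meval h f.
Proof.
move=> [d hd] hh; exists (\prod_e c e ^+ d e).
  by move=> c0; apply/prodf_neq0 => e _; rewrite expf_neq0.
rewrite !mevalE big_distrr /= [RHS]big_seq_cond [LHS]big_seq_cond; apply: eq_bigr => m.
rewrite andbT => /hd dm; rewrite mulrCA; congr (_ * _).
have reidx (F : 'I_(#|I| + #|I|) -> R) :
    \prod_i F i = \prod_e (F (idxX e) * F (idxY e)).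
  rewrite big_split_ord /= big_split /=.
  by rewrite !(reindex _ (onW_bij _ (@enum_rank_bij I))).
rewrite !reidx -big_split /=; apply: eq_bigr => e _.
have [-> ->] := hh e; rewrite !exprMn -(dm e) exprD; ring.
Qed.

End ScaleMultihomogeneous.

Section CurveOfOctahedra.
Variables (R : realType) (l : edge -> R) (sigma : vertex -> vertex) (p q : bool -> R).
Hypothesis hl : nondegenerate_lengths l.
Hypothesis hsigma : renaming sigma.
Local Notation vec := 'rV[R]_4.
Implicit Types (P : vertex -> vec) (x : edge -> option R) (u v t : vertex) (w : R).

Definition std_lengths :=
  [/\ forall i j, cosl l (sigma (vtx 0 i)) (sigma (vtx 1 j)) = 0,
      forall i k, cosl l (sigma (vtx 0 i)) (sigma (vtx 2 k)) = p i &
      forall j k, cosl l (sigma (vtx 1 j)) (sigma (vtx 2 k)) = if k then - q j else q j].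

Hypothesis hp : p false ^+ 2 != p true ^+ 2.
Hypothesis hq : q false ^+ 2 != q true ^+ 2.
Hypothesis hstd : std_lengths.

Lemma vtx_idx (k k' : nat) b b' : (k < 3)%N -> (k' < 3)%N ->
  ((vtx k b).1 == (vtx k' b').1) = (k == k').
Proof. by move=> h h'; rewrite /vtx -val_eqE /= !inordK. Qed.

Lemma vtx_face (i j k : bool) :
  [/\ is_face (vtx 0 i) (vtx 1 j) (vtx 2 k), is_face (vtx 1 j) (vtx 2 k) (vtx 0 i),
      is_face (vtx 0 i) (vtx 2 k) (vtx 1 j) & opp_vertex (vtx 0 i) = vtx 0 (~~ i) /\
      opp_vertex (vtx 1 j) = vtx 1 (~~ j) /\ opp_vertex (vtx 2 k) = vtx 2 (~~ k)].
Proof. by rewrite /is_face !vtx_idx. Qed.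

Lemma pq_lt1 i j : 0 < 1 - p i ^+ 2 - q j ^+ 2.
Proof.
have [h01 h02 h12] := hstd; have [f _ _ _] := vtx_face i j false.
have := @face_gram_gt0 _ _ hl (sigma (vtx 0 i)) (sigma (vtx 1 j)) (sigma (vtx 2 false)).
by rewrite renaming_face // => /(_ f); rewrite h01 h02 h12; lra.
Qed.

Lemma realization_std P : octahedron P -> has_edge_lengths P l ->
  exists g w Y Z, [/\ is_rotation g, on_curve p q w Y Z &
    forall u, P (sigma u) = std_vertex p q w Y Z u *m g].
Proof.
move=> oP lP; apply: (standard_form hp hq).
have [h01 h02 h12] := hstd.
split; first by move=> u; exact: dot_unit.
- by move=> i j; rewrite (dot_cosl oP lP) ?renaming_idx ?vtx_idx.
- by move=> i j; rewrite (dot_cosl oP lP) ?renaming_idx ?vtx_idx.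
- by move=> i j; rewrite (dot_cosl oP lP) ?renaming_idx ?vtx_idx.
Qed.

Lemma octahedron_of_dots P : (forall u, dot (P u) (P u) = 1) ->
  (forall u v, u.1 != v.1 -> dot (P u) (P v) = cosl l u v) ->
  octahedron P /\ has_edge_lengths P l.
Proof.
move=> P1 Pl; split; last first.
  move=> u v uv; rewrite Pl // cosK // in_itv /=.
  by case: hl => /(_ (edge_of u v)) /andP [h1 h2] _; rewrite !ltW.
split=> // s.
pose U (k : nat) : vertex := (inord k, s (inord k)).
set M := \matrix_(i < 3) P (i, s i).
have eM : M *m M^T = \matrix_(i < 3, j < 3) dot (P (U i)) (P (U j)).
  apply/matrixP => i j; rewrite !mxE; apply: eq_bigr => k _.
  by rewrite !mxE /U !inord_val.
have f : is_face (U 0) (U 1) (U 2) by rewrite /is_face /U /= -!val_eqE /= !inordK.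
have uM : M *m M^T \in unitmx.
  rewrite unitmxE eM (det_d3 (fun i j => dot (P (U i)) (P (U j)))) unitfE gt_eqF //.
  have [f1 f2 f3] := face_idx f.
  have := face_gram_gt0 hl f; rewrite -!Pl // (dotC (P (U 1)) (P (U 0))).
  rewrite (dotC (P (U 2)) (P (U 0))) (dotC (P (U 2)) (P (U 1))) !P1.
  by congr (0 < _); ring.
rewrite /row_free eqn_leq rank_leq_row /=.
by rewrite -{1}(eqP (_ : row_free (M *m M^T))) ?row_free_unit // mxrankM_maxl.
Qed.

Definition curve_octahedron P w (Y Z : bool -> R) := exists2 g : 'M[R]_4, is_rotation g &
  forall u, P (sigma u) = std_vertex p q w Y Z u *m g.

Lemma curve_octahedronP P w (Y Z : bool -> R) : on_curve p q w Y Z -> curve_octahedron P w Y Z ->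
  octahedron P /\ has_edge_lengths P l.
Proof.
move=> hc [g rg Pg]; have [u1 u01 u02 u12] := std_standard_dots hc.
have [h01 h02 h12] := hstd.
have dg u v : dot (P (sigma u)) (P (sigma v)) =
    dot (std_vertex p q w Y Z u) (std_vertex p q w Y Z v).
  by rewrite !Pg dot_rotation.
apply: octahedron_of_dots => [u|u v].
  by rewrite -(renamingK hsigma u) dg u1.
rewrite -(renamingK hsigma u) -(renamingK hsigma v) renaming_idx // dg.
elim/vertex_ind: (sigma u) => i; elim/vertex_ind: (sigma v) => j; rewrite vtx_idx //= => _;
  by rewrite ?(u01, u02, u12, h01, h02, h12) // dotC coslC ?(u01, u02, u12, h01, h02, h12).
Qed.

Lemma curve_half_tangents : exists2 sg : R, sg ^+ 2 = 1 &
  forall P x w (Y Z : bool -> R), on_curve p q w Y Z -> curve_octahedron P w Y Z ->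
  has_half_tangents P x ->
  forall u v t, is_face u v t -> let S := std_vertex p q w Y Z in
  x (edge_of (sigma u) (sigma v)) = tan_half (dihedral_cos S u v t (opp_vertex t))
     (sg * dihedral_sin S u v t (opp_vertex t)) /\
  dihedral_cos S u v t (opp_vertex t) ^+ 2 + (sg * dihedral_sin S u v t (opp_vertex t)) ^+ 2 = 1.
Proof.
have [s hs] := renaming_positive hsigma.
exists (if s then -1 else 1); first by case: s {hs}; ring.
move=> P x w Y Z hc cP hx u v t f S.
have [oP lP] := curve_octahedronP hc cP.
have f' : is_face (sigma u) (sigma v) (sigma t) by rewrite renaming_face.
have := half_tangent_face hl oP lP hx f'.
case: cP => g rg Pg; rewrite renaming_opp //.
have eg a b c d : gram (P (sigma a)) (P (sigma b)) (P (sigma c)) (P (sigma d)) =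
    gram (S a) (S b) (S c) (S d).
  by rewrite /gram !Pg !dot_rotation.
have -> : dihedral_cos P (sigma u) (sigma v) (sigma t) (sigma (opp_vertex t)) =
    dihedral_cos S u v t (opp_vertex t).
  by rewrite /dihedral_cos /gram_norm !eg.
have -> : dihedral_sin P (sigma u) (sigma v) (sigma t) (sigma (opp_vertex t)) =
    (if s then -1 else 1) * dihedral_sin S u v t (opp_vertex t).
  rewrite /dihedral_sin /gram_norm !eg !Pg det4_rotation // dot_rotation //.
  rewrite /orient hs //; case: s {hs}; case: (face_positive u v t) => /=; ring.
by [].
Qed.

End CurveOfOctahedra.

(** * The curve of standard octahedra *)

Section CurveFunctions.
Variables (R : realType) (l : edge -> R) (sigma : vertex -> vertex) (p q : bool -> R).
Hypothesis hl : nondegenerate_lengths l.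
Hypothesis hsigma : renaming sigma.
Hypothesis hp : p false ^+ 2 != p true ^+ 2.
Hypothesis hq : q false ^+ 2 != q true ^+ 2.
Hypothesis hstd : std_lengths l sigma p q.
Local Notation vec := 'rV[R]_4.
Implicit Types (P : vertex -> vec) (x : edge -> option R) (u v : vertex) (w : R).

Definition curve := {c : R * (bool -> R) * (bool -> R) | on_curve p q c.1.1 c.1.2 c.2}.
Definition curve_w (c : curve) := (proj1_sig c).1.1.
Definition curve_Y (c : curve) := (proj1_sig c).1.2.
Definition curve_Z (c : curve) := (proj1_sig c).2.

Definition curve_y (k : nat) (c : curve) : R := match k with
  | 0%N => curve_Y c false | 1%N => curve_Z c false
  | 2%N => curve_Y c true | 3%N => curve_Z c true | _ => 0 end.

Definition curve_h (k : nat) : {poly R} := match k with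
  | 0%N => 'X - (p false ^+ 2)%:P | 1%N => (1 - q false ^+ 2)%:P - 'X
  | 2%N => 'X - (p true ^+ 2)%:P | 3%N => (1 - q true ^+ 2)%:P - 'X | _ => 0 end.

Lemma curve_y_sqr k c : curve_y k c ^+ 2 = (curve_h k).[curve_w c].
Proof.
case: c => -[[w Y] Z] [hw hY hZ]; rewrite /curve_y /curve_w /curve_Y /curve_Z /=.
by case: k => [|[|[|[|k]]]]; rewrite /= ?hY ?hZ !hornerE //; ring.
Qed.

Lemma curve_simple_root k : (k < 4)%N ->
  exists2 r, simple_root r (curve_h k) & forall j, (j < k)%N -> (curve_h j).[r] != 0.
Proof.
have pq i j := pq_lt1 hl hsigma hstd i j.
have r1 r : simple_root r ('X - r%:P).
  by exists 1; [rewrite mulr1|rewrite hornerE oner_eq0].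
have r2 r : simple_root r (r%:P - 'X).
  exists (- 1); first by ring.
  by rewrite !hornerE oppr_eq0 oner_eq0.
case: k => [|[|[|[|]]]] //= _.
- by exists (p false ^+ 2).
- exists (1 - q false ^+ 2) => // -[|] //= _; rewrite !hornerE.
  by rewrite gt_eqF //; have := pq false false; lra.
- exists (p true ^+ 2) => // -[|[|]] //= _; rewrite !hornerE.
    by rewrite subr_eq0 eq_sym.
  by rewrite gt_eqF //; have := pq true false; lra.
- exists (1 - q true ^+ 2) => // -[|[|[|]]] //= _; rewrite !hornerE.
  + by rewrite gt_eqF //; have := pq false true; lra.
  + rewrite subr_eq0; apply: contra hq => /eqP h; apply/eqP; lra.
  + by rewrite gt_eqF //; have := pq true true; lra.
Qed.

Lemma curve_tower_main : infinite_set (range curve_w) -> forall k, (k <= 4)%N ->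
  vanishing_extends curve_w curve_y k /\
  ((k < 4)%N -> tower_nonsquare curve_w curve_y k (curve_h k)).
Proof.
move=> winf k k4.
have ns j : (j < 4)%N -> nonsquare_upto curve_h j (curve_h j).
  by move=> /curve_simple_root [r r1 r2]; exact: simple_root_upto r1 r2.
have [] := tower_main curve_y_sqr winf (k := k).
  by move=> j jk; apply: ns; exact: leq_trans jk k4.
by move=> v n; split=> // k4'; apply: n; exact: ns.
Qed.

Local Notation tow := (tower curve_w curve_y).

Lemma towM f g : tow 4 f -> tow 4 g -> tow 4 (fun c => f c * g c).
Proof. exact: (towerM curve_y_sqr). Qed.

Lemma towB f g : tow 4 f -> tow 4 g -> tow 4 (fun c => f c - g c).
Proof. exact: (towerB curve_y_sqr). Qed.

Lemma tower_Y i : tow 4 (fun c => curve_Y c i).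
Proof.
by case: i; [apply: (@tower_le _ _ _ _ 3 4) => //; exact: (tower_gen _ _ 2)
            |apply: (@tower_le _ _ _ _ 1 4) => //; exact: (tower_gen _ _ 0)].
Qed.

Lemma tower_Z j : tow 4 (fun c => curve_Z c j).
Proof.
by case: j; [exact: (tower_gen _ _ 3)
            |apply: (@tower_le _ _ _ _ 2 4) => //; exact: (tower_gen _ _ 1)].
Qed.

Lemma tower_w : tow 4 curve_w.
Proof.
by apply: (tower_ext (tower_poly _ _ 4 'X)) => c; rewrite hornerX.
Qed.

Definition curve_pair (e : edge) (C S K : curve -> R) :=
  [/\ tow 4 C, tow 4 S, tow 4 K, forall c, 0 < K c &
   forall c P x, curve_octahedron sigma p q P (curve_w c) (curve_Y c) (curve_Z c) ->
     has_half_tangents P x ->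
     x e = tan_half (C c / K c) (S c / K c) /\ C c ^+ 2 + S c ^+ 2 = K c ^+ 2].

Lemma curve_pair01 i j : exists2 kappa : R, kappa != 0 &
  curve_pair (edge_of (sigma (vtx 0 i)) (sigma (vtx 1 j)))
    (fun c => 2 * curve_w c - 1 - p i ^+ 2 + q j ^+ 2)
    (fun c => kappa * (curve_Y c i * curve_Z c j)) (fun=> 1 - p i ^+ 2 - q j ^+ 2).
Proof.
have [f _ _ [_ [_ ok]]] := vtx_face i j false.
have pq := pq_lt1 hl hsigma hstd i j.
have [sg sg2 hs] := curve_half_tangents hl hsigma hstd.
have tC (a : R) : tow 4 (fun=> a) by exact: tower_cst.
exists (- (sg * orient R (vtx 0 i) (vtx 1 j) (vtx 2 false) * 2)).
  have sg0 : sg != 0 by rewrite -sqrf_eq0 sg2 oner_eq0.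
  rewrite oppr_eq0 !mulf_neq0 ?pnatr_eq0 //.
  by rewrite /orient; case: ifP => _; rewrite ?oppr_eq0 oner_eq0.
split=> //.
- apply: (tower_ext (towerD (towM (tC 2) tower_w) (tC (- 1 - p i ^+ 2 + q j ^+ 2)))).
  by move=> c /=; ring.
- by apply: towM => //; apply: towM; [exact: tower_Y|exact: tower_Z].
move=> c P x cP hx; have hc : on_curve p q (curve_w c) (curve_Y c) (curve_Z c).
  by rewrite /curve_w /curve_Y /curve_Z; case: (c).
have [] := hs P x _ _ _ hc cP hx _ _ _ f; rewrite ok => ex e1.
have [u1 d01 d02 d12] := std_standard_dots hc.
set S := std_vertex _ _ _ _ _ in ex e1 u1 d01 d02 d12.
have g k k' : gram (S (vtx 0 i)) (S (vtx 1 j)) (S (vtx 2 k)) (S (vtx 2 k')) =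
    dot (S (vtx 2 k)) (S (vtx 2 k')) - p i ^+ 2 - (if k == k' then q j ^+ 2 else - q j ^+ 2).
  by rewrite /gram d01 !d02 !d12; case: k; case: k' => /=; ring.
have n1 : gram_norm (S (vtx 0 i)) (S (vtx 1 j)) (S (vtx 2 false)) (S (vtx 2 true)) =
    1 - p i ^+ 2 - q j ^+ 2.
  by rewrite /gram_norm !g !u1 !eqxx -expr2 sqrtr_sqr ger0_norm // ltW.
have c1 : dihedral_cos S (vtx 0 i) (vtx 1 j) (vtx 2 false) (vtx 2 true) =
    (2 * curve_w c - 1 - p i ^+ 2 + q j ^+ 2) / (1 - p i ^+ 2 - q j ^+ 2).
  by rewrite /dihedral_cos n1 g std_dot22 //= opprK.
have s1 : sg * dihedral_sin S (vtx 0 i) (vtx 1 j) (vtx 2 false) (vtx 2 true) =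
    - (sg * orient R (vtx 0 i) (vtx 1 j) (vtx 2 false) * 2) * (curve_Y c i * curve_Z c j)
    / (1 - p i ^+ 2 - q j ^+ 2).
  by rewrite /dihedral_sin n1 std_det01 // d01 expr0n subr0 sqrtr1; ring.
rewrite c1 s1 in ex e1; split=> //.
move: e1; rewrite !expr_div_n -mulrDl => e1.
have nz : (1 - p i ^+ 2 - q j ^+ 2) ^+ 2 != 0 by rewrite expf_neq0 // gt_eqF.
by apply: (mulIf (invr_neq0 nz)); rewrite e1 divff.
Qed.

Lemma tan_half_scaled (z : option R) (C S K M : R) : M != 0 -> K != 0 ->
  z = tan_half (C / K) (S / K) -> (C / K) ^+ 2 + (S / K) ^+ 2 = 1 ->
  z = tan_half (M * C / (M * K)) (M * S / (M * K)) /\ (M * C) ^+ 2 + (M * S) ^+ 2 = (M * K) ^+ 2.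
Proof.
move=> M0 K0 ex e1.
have [-> ->] : M * C / (M * K) = C / K /\ M * S / (M * K) = S / K.
  by split; field; rewrite M0 K0.
split=> //; move: e1; rewrite !expr_div_n -mulrDl => e1.
have nz : K ^+ 2 != 0 by rewrite expf_neq0.
by rewrite !exprMn -mulrDr; congr (_ * _); apply: (mulIf (invr_neq0 nz)); rewrite e1 divff.
Qed.

Lemma curve_pair12 j k : exists C S K,
  curve_pair (edge_of (sigma (vtx 1 j)) (sigma (vtx 2 k))) C S K.
Proof.
have [_ f _ [oi _]] := vtx_face false j k.
have [sg sg2 hs] := curve_half_tangents hl hsigma hstd.
have tC (a : R) : tow 4 (fun=> a) by exact: tower_cst.
have pq i := pq_lt1 hl hsigma hstd i j.
pose q1 := if k then - q j else q j.
have q12 : q1 ^+ 2 = q j ^+ 2 by rewrite /q1; case: (k); ring.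
pose N := Num.sqrt ((1 - q1 ^+ 2 - p false ^+ 2) * (1 - q1 ^+ 2 - p true ^+ 2)).
have N0 : 0 < N.
  by rewrite sqrtr_gt0 q12 mulr_gt0 //; [have := pq false|have := pq true]; lra.
pose ka : R := - (sg * orient R (vtx 1 j) (vtx 2 k) (vtx 0 false)) * Num.sqrt (1 - q1 ^+ 2)
  * (if k then 1 else -1).
exists (fun c => (1 - q1 ^+ 2) * (p false * p true + curve_Y c false * curve_Y c true)
   - p false * p true * curve_w c),
 (fun c => ka * (curve_Z c j * (p false * curve_Y c true - p true * curve_Y c false))),
 (fun c => curve_w c * N).
have tY i := tower_Y i; have tZ := tower_Z j; have tw := tower_w.
split=> //.
- apply: towB; apply: towM => //; apply: towerD => //; exact: towM.
- apply: towM => //; apply: towM => //; apply: towB; exact: towM.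
- exact: towM.
- by move=> c; rewrite mulr_gt0 // /curve_w; case: c => c [] /= /andP [].
move=> c P x cP hx; have hc : on_curve p q (curve_w c) (curve_Y c) (curve_Z c).
  by rewrite /curve_w /curve_Y /curve_Z; case: (c).
have [w0 w1] := curve_neq0 hc.
have [] := hs P x _ _ _ hc cP hx _ _ _ f; rewrite oi => ex e1.
have [u1 d01 d02 d12] := std_standard_dots hc.
set S := std_vertex _ _ _ _ _ in ex e1 u1 d01 d02 d12.
have d10 i : dot (S (vtx 1 j)) (S (vtx 0 i)) = 0 by rewrite dotC d01.
have d20 i : dot (S (vtx 2 k)) (S (vtx 0 i)) = p i by rewrite dotC d02.
have g i i' : gram (S (vtx 1 j)) (S (vtx 2 k)) (S (vtx 0 i)) (S (vtx 0 i')) =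
    dot (S (vtx 0 i)) (S (vtx 0 i')) * (1 - q1 ^+ 2) - p i * p i'.
  by rewrite /gram d12 !d10 !d20 -/q1; ring.
have n1 : gram_norm (S (vtx 1 j)) (S (vtx 2 k)) (S (vtx 0 false)) (S (vtx 0 true)) = N.
  by rewrite /gram_norm /N !g !u1; congr Num.sqrt; ring.
have Nn : N != 0 by rewrite gt_eqF.
pose w := curve_w c; pose D := (p false * p true + curve_Y c false * curve_Y c true) / w.
have c1 : dihedral_cos S (vtx 1 j) (vtx 2 k) (vtx 0 false) (vtx 0 true) =
    (D * (1 - q1 ^+ 2) - p false * p true) / N.
  by rewrite /dihedral_cos n1 g std_dot00.
have s1 : sg * dihedral_sin S (vtx 1 j) (vtx 2 k) (vtx 0 false) (vtx 0 true) =
    (ka * (curve_Z c j * (p false * curve_Y c true - p true * curve_Y c false)) / w) / N.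
  by rewrite /dihedral_sin n1 std_det12 // d12 -/q1 /ka -/w; field; rewrite w0 Nn.
rewrite c1 s1 in ex e1; have [ex' e1'] := tan_half_scaled w0 Nn ex e1.
have eC : w * (D * (1 - q1 ^+ 2) - p false * p true) =
    (1 - q1 ^+ 2) * (p false * p true + curve_Y c false * curve_Y c true) - p false * p true * w.
  by rewrite /D; field.
have eS : w * (ka * (curve_Z c j * (p false * curve_Y c true - p true * curve_Y c false)) / w) =
    ka * (curve_Z c j * (p false * curve_Y c true - p true * curve_Y c false)) by field.
by rewrite -/w eC eS in ex' e1'.
Qed.

Lemma curve_pair02 i k : exists C S K,
  curve_pair (edge_of (sigma (vtx 0 i)) (sigma (vtx 2 k))) C S K.
Proof.
have [_ _ f [_ [oj _]]] := vtx_face i false k.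
have [sg sg2 hs] := curve_half_tangents hl hsigma hstd.
have tC (a : R) : tow 4 (fun=> a) by exact: tower_cst.
have pq j := pq_lt1 hl hsigma hstd i j.
pose N := Num.sqrt ((1 - p i ^+ 2 - q false ^+ 2) * (1 - p i ^+ 2 - q true ^+ 2)).
have N0 : 0 < N.
  by rewrite sqrtr_gt0 mulr_gt0.
pose ka : R := sg * orient R (vtx 0 i) (vtx 2 k) (vtx 1 false) * Num.sqrt (1 - p i ^+ 2).
exists (fun c => (1 - p i ^+ 2) * (q false * q true + curve_Z c false * curve_Z c true)
   - q false * q true * (1 - curve_w c)),
 (fun c => ka * (curve_Y c i * (q false * curve_Z c true - q true * curve_Z c false))),
 (fun c => (1 - curve_w c) * N).
have tY := tower_Y i; have tZ j := tower_Z j; have tw : tow 4 (fun c => 1 - curve_w c).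
  by apply: towB => //; exact: tower_w.
split=> //.
- apply: towB; apply: towM => //; apply: towerD => //; exact: towM.
- apply: towM => //; apply: towM => //; apply: towB; exact: towM.
- exact: towM.
- by move=> c; rewrite mulr_gt0 // subr_gt0 /curve_w; case: c => c [] /= /andP [].
move=> c P x cP hx; have hc : on_curve p q (curve_w c) (curve_Y c) (curve_Z c).
  by rewrite /curve_w /curve_Y /curve_Z; case: (c).
have [w0 w1] := curve_neq0 hc.
have [] := hs P x _ _ _ hc cP hx _ _ _ f; rewrite oj => ex e1.
have [u1 d01 d02 d12] := std_standard_dots hc.
set S := std_vertex _ _ _ _ _ in ex e1 u1 d01 d02 d12.
have d21 j : dot (S (vtx 2 k)) (S (vtx 1 j)) = if k then - q j else q j by rewrite dotC d12.
have g j j' : gram (S (vtx 0 i)) (S (vtx 2 k)) (S (vtx 1 j)) (S (vtx 1 j')) =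
    dot (S (vtx 1 j)) (S (vtx 1 j')) * (1 - p i ^+ 2) - q j * q j'.
  by rewrite /gram d02 !d01 !d21; case: (k); ring.
have n1 : gram_norm (S (vtx 0 i)) (S (vtx 2 k)) (S (vtx 1 false)) (S (vtx 1 true)) = N.
  by rewrite /gram_norm /N !g !u1; congr Num.sqrt; ring.
have Nn : N != 0 by rewrite gt_eqF.
pose w := 1 - curve_w c; pose D := (q false * q true + curve_Z c false * curve_Z c true) / w.
have c1 : dihedral_cos S (vtx 0 i) (vtx 2 k) (vtx 1 false) (vtx 1 true) =
    (D * (1 - p i ^+ 2) - q false * q true) / N.
  by rewrite /dihedral_cos n1 g std_dot11.
have s1 : sg * dihedral_sin S (vtx 0 i) (vtx 2 k) (vtx 1 false) (vtx 1 true) =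
    (ka * (curve_Y c i * (q false * curve_Z c true - q true * curve_Z c false)) / w) / N.
  by rewrite /dihedral_sin n1 std_det02 // d02 /ka -/w; field; rewrite w1 Nn.
rewrite c1 s1 in ex e1; have [ex' e1'] := tan_half_scaled w1 Nn ex e1.
have eC : w * (D * (1 - p i ^+ 2) - q false * q true) =
    (1 - p i ^+ 2) * (q false * q true + curve_Z c false * curve_Z c true) - q false * q true * w.
  by rewrite /D; field.
have eS : w * (ka * (curve_Y c i * (q false * curve_Z c true - q true * curve_Z c false)) / w) =
    ka * (curve_Y c i * (q false * curve_Z c true - q true * curve_Z c false)) by field.
by rewrite -/w eC eS in ex' e1'.
Qed.

Lemma curve_pair_edge (e : edge) : exists C S K, curve_pair e C S K.
Proof.
have [u [v [t [f ->]]]] := edge_ofP e; have [uv _ _] := face_idx f.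
rewrite -(renamingK hsigma u) -(renamingK hsigma v).
move: uv; rewrite -[in u.1](renamingK hsigma u) -[in v.1](renamingK hsigma v) renaming_idx //.
elim/vertex_ind: (sigma u) => i; elim/vertex_ind: (sigma v) => j; rewrite vtx_idx //= => _.
- by have [ka _ h] := curve_pair01 i j; do 3 eexists; exact: h.
- exact: curve_pair02.
- by rewrite edge_ofC; have [ka _ h] := curve_pair01 j i; do 3 eexists; exact: h.
- exact: curve_pair12.
- by rewrite edge_ofC; exact: curve_pair02.
- by rewrite edge_ofC; exact: curve_pair12.
Qed.

Definition curve_point (c : curve) x := exists2 P,
  curve_octahedron sigma p q P (curve_w c) (curve_Y c) (curve_Z c) & has_half_tangents P x.

Local Notation hpoly := (mpoly (#|{: edge}| + #|{: edge}|) R).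

(* A polynomial vanishing at infinitely many points of the curve of octahedra
   vanishes on it: near a given point, the homogeneous coordinates (sin phi : 1 + cos phi)
   or (1 - cos phi : sin phi) of the half tangents are elements of the tower. *)
Lemma vanishing_on_curve (F : hpoly) (A : set curve) : multihomogeneous F ->
  infinite_set (curve_w @` A) ->
  (forall c, A c -> exists2 x, curve_point c x & meval (hcoord x) F = 0) ->
  forall c x, curve_point c x -> meval (hcoord x) F = 0.
Proof.
move=> hF Ainf hA c0 x0 [P0 cP0 hx0].
have winf : infinite_set (range curve_w).
  by apply: sub_infinite_set Ainf; apply: image_subset.
have [vE _] := curve_tower_main winf (leqnn 4).
have /choice [C /choice [S /choice [K hCSK]]] := curve_pair_edge.
have rep e c P x (cP : curve_octahedron sigma p q P (curve_w c) (curve_Y c) (curve_Z c))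
    (hx : has_half_tangents P x) : exists m n,
    [/\ S e c = m * homX (x e), K e c + C e c = m * homY (x e),
        K e c - C e c = n * homX (x e), S e c = n * homY (x e) & m != 0 \/ n != 0].
  have [_ _ _ K0 hh] := hCSK e; have [-> e1] := hh c P x cP hx.
  exact: tan_half_prop.
pose good e := K e c0 + C e c0 != 0.
pose num e c := if good e then S e c else K e c - C e c.
pose den e c := if good e then K e c + C e c else S e c.
pose hc (c : curve) (k : 'I_(#|{: edge}| + #|{: edge}|)) := match fintype.split k with
  | inl i => num (enum_val i) c | inr i => den (enum_val i) c end.
have hcX c e : hc c (idxX e) = num e c by rewrite /hc split_idxX enum_rankK.
have hcY c e : hc c (idxY e) = den e c by rewrite /hc split_idxY enum_rankK.
have hX x e : hcoord x (idxX e) = homX (x e) by rewrite /hcoord split_idxX enum_rankK.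
have hY x e : hcoord x (idxY e) = homY (x e) by rewrite /hcoord split_idxY enum_rankK.
have scale c P x : curve_octahedron sigma p q P (curve_w c) (curve_Y c) (curve_Z c) ->
    has_half_tangents P x -> exists lam, (forall e, num e c = lam e * homX (x e) /\ den e c = lam e * homY (x e)) /\ (c = c0 -> forall e, lam e != 0).
  move=> cP hx.
  have : forall e, exists lam, (num e c = lam * homX (x e) /\ den e c = lam * homY (x e)) /\
      (c = c0 -> lam != 0).
    move=> e; have [m [n [e1 e2 e3 e4 mn]]] := rep e c P x cP hx.
    rewrite /num /den; case: (boolP (good e)) => ge.
      exists m; split=> // cc; apply: contraNneq ge => m0.
      by rewrite /good -cc e2 m0 mul0r.
    exists n; split=> // cc; case: mn => // m0; apply: contraNneq (m0) => n0.
    have [_ _ _ K0 _] := hCSK e.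
    move: ge; rewrite /good negbK -cc => /eqP z.
    by move: e3 (K0 c); rewrite n0 mul0r; lra.
  by move=> /choice [lam hlam]; exists lam; split=> [e|cc e]; have [] := hlam e => // _; exact.
have tw : tower curve_w curve_y 4 (fun c => meval (hc c) F).
  pose trm m c := mcoeff m F * \prod_i hc c i ^+ fun_of_multinom m i.
  apply: (@tower_ext _ _ _ _ _ (fun c => \sum_(m <- msupp F) trm m c)); last first.
    by move=> c; rewrite mevalE.
  apply: tower_sum => m.
  apply: (towM (f := fun=> mcoeff m F) (g := fun c => \prod_i hc c i ^+ fun_of_multinom m i)).
    exact: tower_cst.
  apply: (@tower_prod _ _ _ _ _ curve_y_sqr 4 _ _ (fun i c => hc c i ^+ fun_of_multinom m i)) => i.
  apply: (@towerX _ _ _ _ _ curve_y_sqr 4 (fun c => hc c i)).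
  rewrite /hc; case: (fintype.split i) => j; rewrite /num /den; case: (good _);
    have [tC tS tK _ _] := hCSK (enum_val j); [exact: tS|exact: towB|exact: towerD|exact: tS].
have hc0 : forall c, meval (hc c) F = 0.
  apply: (vE _ A tw Ainf) => c /hA [x [P cP hx] Fx].
  have [lam [hlam _]] := scale c P x cP hx.
  have [|k _ ->] := @multihomogeneous_scale _ _ F (hcoord x) (hc c) lam hF.
    by move=> e; rewrite hcX hcY hX hY; exact: hlam.
  by rewrite Fx mulr0.
have [lam [hlam lam0]] := scale c0 P0 x0 cP0 hx0.
have [|k kn e] := @multihomogeneous_scale _ _ F (hcoord x0) (hc c0) lam hF.
  by move=> e; rewrite hcX hcY hX hY; exact: hlam.
have /eqP := hc0 c0; rewrite e mulf_eq0 (negPf (kn _)) //=; last exact: lam0.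
by move=> /eqP.
Qed.

End CurveFunctions.

(** * Irreducible sets and function fields *)

Section IrreducibleSets.
Variables (R : realType) (I : finType).
Local Notation point := (I -> option R).
Local Notation hpoly := (mpoly (#|I| + #|I|) R).
Implicit Types (Z G : set point) (e : I).

Definition coord_eq (e : I) (o : option R) : hpoly :=
  homY o *: mpolyX R (mnm1 (idxX e)) - homX o *: mpolyX R (mnm1 (idxY e)).

Lemma coord_eq_multihomogeneous e o : multihomogeneous (coord_eq e o).
Proof.
exists (fun e' => (e' == e) : nat) => m /msuppB_le; rewrite mem_cat => /orP [] /msuppZ_le;
  rewrite msuppX inE => /eqP -> e'; rewrite !mnm1E /idxX /idxY.
  by rewrite eq_lshift eq_lrshift addn0 (inj_eq enum_rank_inj) eq_sym.
by rewrite eq_rlshift eq_rshift add0n (inj_eq enum_rank_inj) eq_sym.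
Qed.

Lemma coord_eqE e o (x : point) : meval (hcoord x) (coord_eq e o) = 0 <-> x e = o.
Proof.
rewrite /coord_eq mevalB !mevalZ !mevalXU /hcoord split_idxX split_idxY !enum_rankK.
case: (x e) => [a|]; case: o => [b|] /=; rewrite ?mulr1 ?mul1r ?mul0r ?mulr0 ?subr0 ?sub0r.
- by split=> [/eqP|[->]]; [rewrite subr_eq0 => /eqP ->|rewrite subrr].
- by split=> [/eqP|//]; rewrite oppr_eq0 oner_eq0.
- by split=> [/eqP|//]; rewrite oner_eq0.
- by rewrite /= ?subrr; split.
Qed.

Lemma finite_coord_const Z e (A : set (option R)) : zirreducible Z -> finite_set A ->
  (forall x, Z x -> A (x e)) -> exists o, forall x, Z x -> x e = o.
Proof.
move=> Zirr /finite_seqP [s sA] ZA.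
have [|x Zx|o ho] := @zirreducible_prod R I Z _ s (coord_eq e) Zirr.
- by move=> t; exact: coord_eq_multihomogeneous.
- rewrite rmorph_prod /=; apply/eqP; rewrite prodf_seq_eq0; apply/hasP; exists (x e).
    by have := ZA x Zx; rewrite sA.
  by apply/eqP/coord_eqE.
- by exists o => x /ho /coord_eqE.
Qed.

Lemma finite_irreducible Z : zirreducible Z -> finite_set Z -> forall x y, Z x -> Z y -> x = y.
Proof.
move=> Zirr Zfin x y Zx Zy; apply/funext => e.
have [|o ho] := @finite_coord_const Z e [set x e | x in Z] Zirr (finite_image _ Zfin).
  by move=> z Zz; exists z.
by rewrite !ho.
Qed.

Lemma dimension1_infinite G : has_dimension G 1 -> infinite_set G.
Proof.
move=> [[Z [hZ sZ]] _] Gfin.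
have [_ irr0 _] := hZ 0%N isT; have [_ irr1 Z1G] := hZ 1%N isT.
have [Z01 nZ01] := sZ 0%N isT; have [[x Zx] _] := irr0.
apply: nZ01 => y Zy.
by rewrite -(finite_irreducible irr1 (sub_finite_set Z1G Gfin) (Z01 _ Zx) Zy).
Qed.

Lemma affine_part_infinite G : zirreducible G -> infinite_set G ->
  (forall e, ~ (forall x, G x -> x e = None)) -> infinite_set (affine_part G).
Proof.
move=> Girr Ginf Gfin Afin; apply: Ginf.
have Gc e : exists o, forall x, G x -> x e = o.
  have /finite_seqP [s sA] := finite_image (fun v : I -> R => Some (v e)) Afin.
  pose f (t : I + option R) := match t with inl e' => coord_eq e' None | inr o => coord_eq e o end.
  have [|x Gx|[e'|o] ho] :=
    @zirreducible_prod R I G _ (map inl (enum I) ++ map inr s) f Girr.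
  - by case=> t; exact: coord_eq_multihomogeneous.
  - rewrite rmorph_prod /=; apply/eqP; rewrite prodf_seq_eq0; apply/hasP.
    have [[e' xe']|xfin] := pselect (exists e', x e' = None).
      exists (inl e'); last by apply/eqP/coord_eqE.
      by rewrite mem_cat map_f ?mem_enum.
    have xE : x = fun e => Some (odflt 0 (x e)).
      apply/funext => e'; case xe: (x e') => [a|] //; by case: xfin; exists e'.
    exists (inr (x e)); last by apply/eqP/coord_eqE.
    rewrite mem_cat; apply/orP; right; apply/map_f.
    have : [set Some (v e) | v in affine_part G] (x e).
      by exists (fun e => odflt 0 (x e)); [rewrite /affine_part /= -xE|rewrite [in RHS]xE].
    by rewrite sA.
  - by case: (Gfin e') => x /ho /coord_eqE.
  - by exists o => x /ho /coord_eqE.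
have [[x0 Gx0] _] := Girr.
apply: (sub_finite_set _ (finite_set1 x0)) => x Gx; apply/funext => e.
by have [b hb] := Gc e; rewrite !hb.
Qed.

End IrreducibleSets.

Lemma fraction_repr (D : idomainType) (x : {fraction D}) : exists n d,
  d != 0 /\ x = FracField.tofrac n / FracField.tofrac d.
Proof.
elim/quotW: x => x; exists (frac x).1, (frac x).2; split; first exact: denom_ratioP.
have d0 : FracField.tofrac (frac x).2 != 0 by rewrite tofrac_eq0 denom_ratioP.
apply: (mulIf d0); rewrite mulfVK //.
apply/eqP; rewrite !piE /FracField.equivf /FracField.mulf /=.
by rewrite !numden_Ratio ?mulf_neq0 ?oner_eq0 ?denom_ratioP // ?mulr1 ?mul1r mulrC.
Qed.

Section RegularFunctions.
Variables (R : realType) (I : finType) (A : irr_affine R I).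
Local Notation apoly := (mpoly #|I| R).
Local Notation FF := (function_field A).

Lemma regular_zmod : zmod_morphism (@regular R I A).
Proof. by move=> f g; rewrite /regular /residue !rmorphB. Qed.

Lemma regular_monoid : monoid_morphism (@regular R I A).
Proof. by split; [rewrite /regular /residue !rmorph1|move=> f g; rewrite /regular /residue !rmorphM]. Qed.

HB.instance Definition _ := GRing.isZmodMorphism.Build _ _ (@regular R I A) regular_zmod.
HB.instance Definition _ := GRing.isMonoidMorphism.Build _ _ (@regular R I A) regular_monoid.

Lemma const_zmod : zmod_morphism (@const_fun R I A).
Proof. by move=> a b; rewrite /const_fun !rmorphB. Qed.

Lemma const_monoid : monoid_morphism (@const_fun R I A).
Proof. by split; [rewrite /const_fun !rmorph1|move=> a b; rewrite /const_fun !rmorphM]. Qed.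

HB.instance Definition _ := GRing.isZmodMorphism.Build _ _ (@const_fun R I A) const_zmod.
HB.instance Definition _ := GRing.isMonoidMorphism.Build _ _ (@const_fun R I A) const_monoid.

Definition const : {rmorphism R -> FF} := @const_fun R I A.

Lemma meval_coord (v : I -> R) e : meval (acoord v) (mpolyX R (mnm1 (enum_rank e))) = v e.
Proof. by rewrite mevalXU /acoord enum_rankK. Qed.

Lemma subfield_top (L : set FF) : is_subfield L -> (forall c, L (const c)) ->
  (forall e, L (coordinate A e)) -> forall x, L x.
Proof.
move=> sL Lc Le x.
have Lr (f : apoly) : L (regular A f).
  elim/mpolyind: f => [|c m f _ _ IHf].
    by rewrite rmorph0; exact: subfield0.
  rewrite rmorphD; apply: (subfieldD sL) => //.
  rewrite -mul_mpolyC rmorphM; apply: (subfieldM sL); first exact: Lc.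
  rewrite mpolyXE_id rmorph_prod.
  apply: big_ind; [exact: subfield1|exact: subfieldM|move=> i _].
  rewrite rmorphXn; apply: (subfieldX sL).
  by have := Le (enum_val i); rewrite /coordinate enum_valK.
have [n [d [_ ->]]] := fraction_repr x.
have toE (z : coord_ring A) : FracField.tofrac z = regular A (repr z).
  by rewrite /regular /residue reprK.
rewrite !toE; apply: (subfield_div sL); exact: Lr.
Qed.

Lemma pointwise_coordinate_eq (f g : apoly) :
  (forall v, irr_set A v -> meval (acoord v) f = meval (acoord v) g) <-> regular A f = regular A g.
Proof.
split=> h.
  apply/eqP; rewrite -subr_eq0 -rmorphB; apply/eqP/regular_eq0 => v Av.
  by rewrite mevalB h // subrr.
move=> v Av; apply/eqP; rewrite -subr_eq0 -mevalB; apply/eqP.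
have /regular_eq0 : regular A (f - g) = 0 by rewrite rmorphB /= h subrr.
exact.
Qed.

Lemma coordinate_poly e (g : {poly R}) : exists f : apoly,
  regular A f = (map_poly const g).[coordinate A e] /\
  forall v, meval (acoord v) f = g.[v e].
Proof.
elim/poly_ind: g => [|g c [f [ef ev]]].
  by exists 0; split=> [|v]; rewrite ?rmorph0 ?horner0 ?meval0.
exists (f * mpolyX R (mnm1 (enum_rank e)) + mpolyC _ c); split=> [|v].
  by rewrite rmorphD rmorphM /= ef !evE.
by rewrite mevalD mevalM ev meval_coord mevalC !hornerE.
Qed.

End RegularFunctions.

Section CurvePoints.
Variables (R : realType) (l : edge -> R) (sigma : vertex -> vertex) (p q : bool -> R).
Hypothesis hl : nondegenerate_lengths l.
Hypothesis hsigma : renaming sigma.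
Hypothesis hp : p false ^+ 2 != p true ^+ 2.
Hypothesis hq : q false ^+ 2 != q true ^+ 2.
Hypothesis hstd : std_lengths l sigma p q.
Implicit Types (x : edge -> option R).
Local Notation curve := (curve p q).
Local Notation point := (curve_point sigma).

Lemma configuration_curve_point x : configuration_space l x -> exists c : curve, point c x.
Proof.
move=> [_ [P [oP lP hx]]].
have [g [w [Y [Z [rg hc Pg]]]]] := realization_std hsigma hp hq hstd oP lP.
by exists (exist _ (w, Y, Z) hc), P => //; exists g.
Qed.

Lemma curve_point_unique (c c' : curve) x x' : proj1_sig c = proj1_sig c' ->
  point c x -> point c' x' -> x = x'.
Proof.
move=> cc [P cP hx] [P' cP' hx'].
have {}cc : c = c' by case: c c' cc {cP cP'} => [c hc] [c' hc'] /= E; exact: eq_exist.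
apply/funext => e; have [C [S [K [_ _ _ _ h]]]] := curve_pair_edge hl hsigma hstd e.
by have [-> _] := h _ _ _ cP hx; have [-> _] := h _ _ _ cP' hx'; rewrite cc.
Qed.

Lemma curve_w_infinite (X : set (edge -> option R)) : infinite_set X ->
  (forall x, X x -> exists c : curve, point c x) ->
  infinite_set (@curve_w R p q @` [set c | exists2 x, X x & point c x]).
Proof.
move=> Xinf hX Wfin; apply: Xinf; set W := image _ _ in Wfin.
pose sg (b : bool) : R := if b then -1 else 1.
pose K (a : R * (bool * bool * bool * bool)) (c : curve) := let: (w, (b0, b1, b2, b3)) := a in
  [/\ curve_w c = w, curve_Y c = (fun i => sg (if i then b1 else b0) * Num.sqrt (w - p i ^+ 2)) &
      curve_Z c = (fun j => sg (if j then b3 else b2) * Num.sqrt (1 - q j ^+ 2 - w))].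
pose f a := xget (fun=> None) [set x | exists2 c, K a c & point c x].
have Dfin : finite_set (W `*` [set: bool * bool * bool * bool]).
  by apply: finite_setX => //; exact: finite_finset.
apply: sub_finite_set (finite_image f Dfin) => x Xx.
have [c hc] := hX x Xx; have [hw hY hZ] := proj2_sig c.
have sgn (z r : R) : z ^+ 2 = r -> exists b, z = sg b * Num.sqrt r.
  by move=> /sign_sqrt [d [] -> ->]; [exists false|exists true].
have [b0 e0] := sgn _ _ (hY false); have [b1 e1] := sgn _ _ (hY true).
have [b2 e2] := sgn _ _ (hZ false); have [b3 e3] := sgn _ _ (hZ true).
pose a := (curve_w c, (b0, b1, b2, b3)).
have Kc : K a c.
  by split=> //; apply/funext; case; [exact: e1|exact: e0|exact: e3|exact: e2].
exists a; first by split=> //=; exists c => //; exists x.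
rewrite /f; case: xgetP => [x' -> [c' [w' Y' Z'] hc']|none]; last first.
  by case: (none x); exists c.
apply: curve_point_unique hc' hc.
case: Kc => wE YE ZE; move: w' Y' Z'; rewrite /curve_w /curve_Y /curve_Z in wE YE ZE *.
by move: (proj1_sig c') (proj1_sig c) wE YE ZE => [[w' Y'] Z'] [[w Y] Z] /= _ -> -> -> -> ->.
Qed.

Lemma curve_point01 i j : exists2 kappa : R, kappa != 0 &
  forall (c : curve) x t, point c x ->
    x (edge_of (sigma (vtx 0 i)) (sigma (vtx 1 j))) = Some t ->
    curve_Y c i != 0 /\ t = kappa * curve_Z c j / curve_Y c i.
Proof.
have [kappa k0 [_ _ _ K0 h]] := curve_pair01 hl hsigma hstd i j.
exists (kappa / 2); first by rewrite mulf_neq0 // invr_eq0 pnatr_eq0.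
move=> c x t [P cP hx] xt; have [] := h c P x cP hx; have Kc := K0 c.
rewrite xt /tan_half; set K := 1 - _ - _ in Kc *.
have Kn : K != 0 by rewrite gt_eqF.
have -> : 1 + (2 * curve_w c - 1 - p i ^+ 2 + q j ^+ 2) / K = 2 * curve_Y c i ^+ 2 / K.
  by have [_ -> _] := proj2_sig c; rewrite /K; field; rewrite -/K.
rewrite !mulf_eq0 invr_eq0 pnatr_eq0 (negPf Kn) orbF /= orbb.
case: eqVneq => // Y0 [->] _; split=> //.
by field; rewrite Kn Y0.
Qed.

End CurvePoints.

Section Component.
Variables (R : realType) (l : edge -> R) (G : set (edge -> option R)).
Hypothesis hl : nondegenerate_lengths l.
Hypothesis hG : essential_component l G.
Local Notation A := (component_chart hG).
Local Notation FF := (function_field A).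
Local Notation iota := (const A).
Local Notation T := (fun u v => coordinate A (edge_of u v)).
Local Notation apoly := (mpoly #|{: edge}| R).

Lemma component_configuration x : G x -> configuration_space l x.
Proof. by case: (ess_component hG) => _ _ + _; apply. Qed.

Lemma component_infinite : infinite_set G.
Proof. by apply: dimension1_infinite; exact: ess_dim hG. Qed.

Lemma chart_infinite : infinite_set (irr_set A).
Proof.
apply: affine_part_infinite; [exact: ess_irreducible hG|exact: component_infinite|].
exact: ess_not_infty hG.
Qed.

Lemma chartP v : irr_set A v -> G (fun e => Some (v e)).
Proof. by []. Qed.

Lemma coordinate_neq0 e : coordinate A e != 0.
Proof.
apply/eqP => /regular_eq0 h; apply: (ess_not_zero hG (e := e)).
pose f (t : option edge) := if t is Some e' then coord_eq e' (None : option R) else coord_eq e (Some (0 : R)).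
have [|x Gx|[e'|] hf] :=
  @zirreducible_prod R _ G _ (None :: map Some (enum {: edge})) f (ess_irreducible hG).
- by case=> [e'|]; exact: coord_eq_multihomogeneous.
- rewrite rmorph_prod /=; apply/eqP; rewrite prodf_seq_eq0; apply/hasP.
  have [[e' xe']|xfin] := pselect (exists e', x e' = None).
    exists (Some e'); last by apply/eqP/coord_eqE.
    by rewrite inE /= mem_map ?mem_enum // => ? ? [].
  have xE : x = fun e => Some (odflt 0 (x e)).
    apply/funext => e'; case xe: (x e') => [a|] //; by case: xfin; exists e'.
  exists None; first by rewrite inE.
  apply/eqP/coord_eqE; have := h (fun e => odflt 0 (x e)).
  rewrite meval_coord => xe0; rewrite xE; congr Some; apply: xe0.
  by change (G (fun e => Some (odflt 0 (x e)))); rewrite -xE.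
- by case: (ess_not_infty hG (e := e')) => x /hf /coord_eqE.
- by move=> x /hf /coord_eqE.
Qed.

Lemma biquadratic_pointwise e1 e2 (a b c d e : R) :
  (forall v, irr_set A v -> a * v e1 ^+ 2 * v e2 ^+ 2 + b * v e1 ^+ 2 + 2 * c * v e1 * v e2
     + d * v e2 ^+ 2 + e = 0) ->
  iota a * coordinate A e1 ^+ 2 * coordinate A e2 ^+ 2 + iota b * coordinate A e1 ^+ 2
    + 2 * iota c * coordinate A e1 * coordinate A e2 + iota d * coordinate A e2 ^+ 2 + iota e = 0.
Proof.
move=> h; pose X e : apoly := mpolyX R (mnm1 (enum_rank e)).
pose f : apoly := mpolyC _ a * X e1 ^+ 2 * X e2 ^+ 2 + mpolyC _ b * X e1 ^+ 2
  + mpolyC _ (2 * c) * X e1 * X e2 + mpolyC _ d * X e2 ^+ 2 + mpolyC _ e.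
have f0 : regular A f = 0.
  apply/regular_eq0 => v Av.
  rewrite /f !(mevalD, mevalM, rmorphXn, mevalC) /= !meval_coord -(h v Av); ring.
have regC t : regular A (mpolyC _ t) = iota t by [].
by rewrite -f0 /f !(rmorphD, rmorphM, rmorphXn) /= !regC /coordinate; ring.
Qed.

Lemma vertex_relation u v1 v2 : is_face u v1 v2 ->
  let v3 := opp_vertex v1 in
  let v4 := opp_vertex v2 in
  let fa := face_angle l in
  let ca := cos (fa u v1 v2) in let sa := sin (fa u v1 v2) in
  let cb := cos (fa u v2 v3) in let sb := sin (fa u v2 v3) in
  let cc := cos (fa u v3 v4) in
  let cd := cos (fa u v4 v1) in let sd := sin (fa u v4 v1) in
  iota (vertexA ca sa cb sb cc cd sd) * T u v1 ^+ 2 * T u v2 ^+ 2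
  + iota (vertexB ca sa cb sb cc cd sd) * T u v1 ^+ 2
  + 2 * iota (vertexC sb sd) * T u v1 * T u v2
  + iota (vertexD ca sa cb sb cc cd sd) * T u v2 ^+ 2
  + iota (vertexE ca sa cb sb cc cd sd) = 0.
Proof.
move=> f; cbv zeta; apply: biquadratic_pointwise => v /chartP /component_configuration [h _].
by have /vertex_equationE := h u v1 v2 f; rewrite /= !expr1n !mulr1 => E; rewrite -[RHS]E; ring.
Qed.

(* The dihedral angle at the edge u v is determined by the distance from w to its opposite and
   by the two angles at u, which the hypotheses make the same (up to s) for v and its opposite. *)
Lemma opposite_edges u v w (s : R) : is_face u v w -> s ^+ 2 = 1 ->
  cos (face_angle l u (opp_vertex v) w) = s * cos (face_angle l u v w) ->
  cos (face_angle l u (opp_vertex v) (opp_vertex w)) = s * cos (face_angle l u v (opp_vertex w)) ->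
  T u (opp_vertex v) = T u v \/ T u (opp_vertex v) = - T u v.
Proof.
move=> f s2 e1 e2.
set v' := opp_vertex v in e1 e2 *; set w' := opp_vertex w in e2.
have f1 : is_face u v' w by exact: is_face_opp2.
have f2 : is_face u v w' by exact: is_face_opp.
have f3 : is_face u v' w' by exact: is_face_opp.
have sineq (t t' : vertex * vertex) : is_face u t.1 t.2 -> is_face u t'.1 t'.2 ->
   cos (face_angle l u t.1 t.2) = s * cos (face_angle l u t'.1 t'.2) ->
   sin (face_angle l u t.1 t.2) = sin (face_angle l u t'.1 t'.2).
  move=> g g' ec; have [s0 q0] := face_angle_sin hl g; have [s0' q0'] := face_angle_sin hl g'.
  by apply: sine_eq s0 s0' q0 q0' _; rewrite ec exprMn s2 mul1r.
have s1 := sineq (v', w) (v, w) f1 f e1; have s3 := sineq (v', w') (v, w') f3 f2 e2.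
have pt t : irr_set A t -> t (edge_of u v') ^+ 2 = t (edge_of u v) ^+ 2.
  move=> /chartP /component_configuration [_ [P [oP lP hx]]].
  have [xe1 c1] := half_tangent_face hl oP lP hx f.
  have [xe2 c2] := half_tangent_face hl oP lP hx f1.
  have [_ ->] := tan_half_some c1 (esym xe1); have [_ ->] := tan_half_some c2 (esym xe2).
  suff -> : dihedral_cos P u v' w (opp_vertex w) = dihedral_cos P u v w (opp_vertex w) by [].
  rewrite !(dihedral_cosE hl oP lP) // -/w' e1 e2 s1 s3.
  have -> : s * cos (face_angle l u v w) * (s * cos (face_angle l u v w')) =
     s ^+ 2 * (cos (face_angle l u v w) * cos (face_angle l u v w')) by ring.
  by rewrite s2 mul1r.
have : T u v' ^+ 2 = T u v ^+ 2.
  rewrite /coordinate -!rmorphXn; apply/pointwise_coordinate_eq => t At.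
  by rewrite !rmorphXn /= !meval_coord pt.
by move=> /eqP; rewrite eqf_sqr => /orP [] /eqP; [left|right].
Qed.

End Component.

(** * Degrees for the standard family *)

Local Opaque vtx face_angle cos sin.

Section NormalForms.
Variables (R : realType) (F : fieldType) (iota : {rmorphism R -> F}).

Lemma kite_normal_form (X Y : F) (a b c d e z z' a' d' : R) : z != 0 -> Y != 0 ->
  a = 2 * z * a' -> b = 0 -> c = - 2 * z * z' -> d = 2 * z * d' -> e = 0 ->
  iota a * X ^+ 2 * Y ^+ 2 + iota b * X ^+ 2 + 2 * iota c * X * Y + iota d * Y ^+ 2 + iota e = 0 ->
  2 * iota (- z') * X + Y * (iota a' * X ^+ 2 + iota d') = 0.
Proof.
move=> z0 Y0 -> -> -> -> -> E.
have k0 : iota (2 * z) * Y != 0 by rewrite mulf_neq0 // fmorph_eq0 mulf_neq0 // pnatr_eq0.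
by apply: (mulfI k0); rewrite mulr0 -E; ring.
Qed.

Lemma antikite_normal_form (X Y : F) (a b c d e z z' b' e' : R) : z != 0 ->
  a = 0 -> b = - (2 * z * b') -> c = - 2 * z * z' -> d = 0 -> e = - (2 * z * e') ->
  iota a * X ^+ 2 * Y ^+ 2 + iota b * X ^+ 2 + 2 * iota c * X * Y + iota d * Y ^+ 2 + iota e = 0 ->
  iota b' * X ^+ 2 + iota e' + 2 * iota z' * X * Y = 0.
Proof.
move=> z0 -> -> -> -> -> E.
have k0 : iota (- (2 * z)) != 0 by rewrite fmorph_eq0 oppr_eq0 mulf_neq0 // pnatr_eq0.
by apply: (mulfI k0); rewrite mulr0 -E; ring.
Qed.

End NormalForms.

Section StandardComponent.
Variables (R : realType) (l : edge -> R) (G : set (edge -> option R)).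
Hypothesis hl : nondegenerate_lengths l.
Hypothesis hG : essential_component l G.
Variables (sigma : vertex -> vertex) (p q : bool -> R).
Hypothesis hsigma : renaming sigma.
Hypothesis hp : p false ^+ 2 != p true ^+ 2.
Hypothesis hq : q false ^+ 2 != q true ^+ 2.
Hypothesis hstd : std_lengths l sigma p q.
Local Notation A := (component_chart hG).
Local Notation FF := (function_field A).
Local Notation iota := (const A).
Local Notation T := (fun u v => coordinate A (edge_of u v)).
Local Notation fa := (face_angle l).
Local Notation AA := (fun i => sigma (vtx 0 i)).
Local Notation BB := (fun j => sigma (vtx 1 j)).
Local Notation CC := (fun k => sigma (vtx 2 k)).

Lemma renamed_face i j k : [/\ is_face (AA i) (BB j) (CC k), is_face (AA i) (CC k) (BB j),
  is_face (BB j) (CC k) (AA i) & is_face (BB j) (AA i) (CC k)].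
Proof.
have [f1 f2 f3 _] := vtx_face i j k; rewrite !renaming_face //; split=> //.
exact: is_faceC.
Qed.

Lemma renamed_opp b : [/\ opp_vertex (AA b) = AA (~~ b), opp_vertex (BB b) = BB (~~ b) &
  opp_vertex (CC b) = CC (~~ b)].
Proof.
by have [_ _ _ [h0 [h1 h2]]] := vtx_face b b b; rewrite !renaming_opp // h0 h1 h2.
Qed.

Lemma angle_at_B j : exists2 s, 0 < s & forall k i, cos (fa (BB j) (CC k) (AA i)) = p i / s.
Proof.
exists (sinl l (BB j) (CC false)); first exact: sinl_gt0.
move=> k i; have [h01 h02 h12] := hstd.
have [f _ _ _] := renamed_face i j k.
have [[x0 _ d0] _ [ex _ ed] _ _ lj _ _ _ _ _ _] := face_triangle hl f.
have s1 : sinl l (AA i) (BB j) = 1.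
  by apply: pos_sqr_eq => //; rewrite ex h01 expr0n subr0 expr1n.
have sd : sinl l (BB j) (CC false) = sinl l (BB j) (CC k).
  apply: pos_sqr_eq => //; first exact: sinl_gt0.
  by rewrite ed sinl_sqr !h12; case: (k); ring.
rewrite sd face_angleC -[p i](h02 i k) lj h01 s1 mul0r add0r mul1r mulrC mulKf //.
by rewrite gt_eqF.
Qed.

Lemma angle_at_A i : exists2 s, 0 < s &
  forall k j, cos (fa (AA i) (CC k) (BB j)) = (if k then - q j else q j) / s.
Proof.
exists (sinl l (AA i) (CC false)); first exact: sinl_gt0.
move=> k j; have [h01 h02 h12] := hstd.
have [f _ _ _] := renamed_face i j k.
have [[x0 a0 _] _ [ex ea _] _ _ _ li _ _ _ _ _] := face_triangle hl f.
have s1 : sinl l (AA i) (BB j) = 1.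
  by apply: pos_sqr_eq => //; rewrite ex h01 expr0n subr0 expr1n.
have sa : sinl l (AA i) (CC false) = sinl l (AA i) (CC k).
  apply: pos_sqr_eq => //; first exact: sinl_gt0.
  by rewrite ea sinl_sqr !h02.
rewrite sa face_angleC -(h12 j k) li h01 s1 mul0r add0r mul1r mulrC mulKf //.
by rewrite gt_eqF.
Qed.

Lemma angle_at_B_gt0 j k i : 0 < sin (fa (BB j) (CC k) (AA i)) /\
  sin (fa (BB j) (CC k) (AA i)) ^+ 2 = 1 - cos (fa (BB j) (CC k) (AA i)) ^+ 2.
Proof. by have [_ _ f _] := renamed_face i j k; exact: face_angle_sin. Qed.

Lemma angle_at_A_gt0 j k i : 0 < sin (fa (AA i) (CC k) (BB j)) /\
  sin (fa (AA i) (CC k) (BB j)) ^+ 2 = 1 - cos (fa (AA i) (CC k) (BB j)) ^+ 2.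
Proof. by have [_ f _ _] := renamed_face i j k; exact: face_angle_sin. Qed.

Lemma B_relation j : exists (z : bool -> R) (a d : R), [/\ forall i, z i != 0, a != 0, d != 0 &
  forall i, 2 * iota (- z (~~ i)) * T (BB j) (CC false) + T (AA i) (BB j) *
    (iota a * T (BB j) (CC false) ^+ 2 + iota (if i then - d else d)) = 0].
Proof.
have [s s0 hs] := angle_at_B j.
pose z i := sin (fa (BB j) (CC false) (AA i)).
have z0 i : 0 < z i by case: (angle_at_B_gt0 j false i).
have z2 i : z i ^+ 2 = 1 - (p i / s) ^+ 2 by rewrite -(hs false); case: (angle_at_B_gt0 j false i).
have zt i : sin (fa (BB j) (CC true) (AA i)) = z i.
  have [s0' e] := angle_at_B_gt0 j true i.
  by apply: (pos_sqr_eq s0' (z0 i)); rewrite e z2 hs.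
pose a := z false * (p true / s) + p false / s * z true.
pose d := z false * (p true / s) - p false / s * z true.
have ad : a * d != 0.
  have -> : a * d = z false ^+ 2 * (p true / s) ^+ 2 - (p false / s) ^+ 2 * z true ^+ 2.
    by rewrite /a /d; ring.
  rewrite !z2; have -> : (1 - (p false / s) ^+ 2) * (p true / s) ^+ 2 -
    (p false / s) ^+ 2 * (1 - (p true / s) ^+ 2) = (p true ^+ 2 - p false ^+ 2) / s ^+ 2.
    by field; rewrite gt_eqF.
  by apply: mulf_neq0; [rewrite subr_eq0 eq_sym|rewrite invr_neq0 // expf_neq0 // gt_eqF].
move: (ad); rewrite mulf_eq0 negb_or => /andP [a0 d0].
exists z, a, d; split=> // [i|i]; first by rewrite gt_eqF.
have [_ _ f _] := renamed_face i j false.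
have := vertex_relation hG f; have [oA _ _] := renamed_opp i; have [_ _ oC] := renamed_opp false.
cbv zeta; rewrite /= in oC; rewrite oA oC.
rewrite (face_angleC l (BB j) (AA i) (CC true)).
rewrite (face_angleC l (BB j) (AA (~~ i)) (CC false)).
rewrite (hs false i).
rewrite (hs true i).
rewrite (hs true (~~i)).
rewrite (hs false (~~i)).
rewrite (zt i).
rewrite -/(z i).
rewrite -/(z (~~ i)).
have [eb ee ea ed _] := @eq_coefs R (p i / s) (z i) (p i / s) (z i) (p (~~ i) / s) (z (~~ i))
  (p (~~ i) / s) (z (~~ i)) (z2 _) (z2 _) (erefl _) (erefl _) (erefl _) (erefl _).
rewrite (edge_ofC (BB j) (AA i)).
apply: (@kite_normal_form _ _ _ _ _ _ _ _ _ _ (z i)) (coordinate_neq0 hG _) _ eb _ _ ee.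
- by rewrite gt_eqF.
- by rewrite ea /a; case: (i) => /=; ring.
- by rewrite /vertexC.
- by rewrite ed /d; case: (i) => /=; ring.
Qed.

Lemma A_relation i : exists (z : bool -> R) (b e : R), [/\ forall j, z j != 0, b != 0, e != 0 &
  forall j, iota b * T (AA i) (CC false) ^+ 2 + iota (if j then - e else e) +
    2 * iota (z (~~ j)) * T (AA i) (CC false) * T (AA i) (BB j) = 0].
Proof.
have [s s0 hs] := angle_at_A i.
pose z j := sin (fa (AA i) (CC false) (BB j)).
have z0 j : 0 < z j by case: (angle_at_A_gt0 j false i).
have z2 j : z j ^+ 2 = 1 - (q j / s) ^+ 2 by have [_] := angle_at_A_gt0 j false i; rewrite hs.
have zt j : sin (fa (AA i) (CC true) (BB j)) = z j.
  have [s0' e] := angle_at_A_gt0 j true i.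
  by apply: (pos_sqr_eq s0' (z0 j)); rewrite e z2 hs; ring.
pose b := z false * (q true / s) + q false / s * z true.
pose e := z false * (q true / s) - q false / s * z true.
have be : b * e != 0.
  have -> : b * e = z false ^+ 2 * (q true / s) ^+ 2 - (q false / s) ^+ 2 * z true ^+ 2.
    by rewrite /b /e; ring.
  rewrite !z2; have -> : (1 - (q false / s) ^+ 2) * (q true / s) ^+ 2 -
    (q false / s) ^+ 2 * (1 - (q true / s) ^+ 2) = (q true ^+ 2 - q false ^+ 2) / s ^+ 2.
    by field; rewrite gt_eqF.
  by apply: mulf_neq0; [rewrite subr_eq0 eq_sym|rewrite invr_neq0 // expf_neq0 // gt_eqF].
move: (be); rewrite mulf_eq0 negb_or => /andP [b0 e0].
exists z, b, e; split=> // [j|j]; first by rewrite gt_eqF.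
have [_ f _ _] := renamed_face i j false.
have := vertex_relation hG f; have [_ oB _] := renamed_opp j; have [_ _ oC] := renamed_opp false.
cbv zeta; rewrite /= in oC; rewrite oB oC.
rewrite (face_angleC l (AA i) (BB j) (CC true)) (face_angleC l (AA i) (BB (~~ j)) (CC false)).
rewrite (hs false j) (hs true j) (hs true (~~ j)) (hs false (~~ j)) (zt j).
rewrite -/(z j) -/(z (~~ j)) !mulNr.
have [ea ed eb ee _] := @supp_coefs R (q j / s) (z j) (- (q j / s)) (z j) (- (q (~~ j) / s))
  (z (~~ j)) (q (~~ j) / s) (z (~~ j)) (z2 _) (z2 _) (erefl _) (erefl _) (erefl _) (erefl _).
apply: (@antikite_normal_form _ _ _ _ _ _ _ _ _ _ (z j)) ea _ _ ed _.
- by rewrite gt_eqF.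
- by rewrite eb /b; case: (j) => /=; ring.
- by rewrite /vertexC.
- by rewrite ee /e; case: (j) => /=; ring.
Qed.

Lemma opposite_B j : T (BB j) (CC true) = T (BB j) (CC false) \/
  T (BB j) (CC true) = - T (BB j) (CC false).
Proof.
have [s s0 hs] := angle_at_B j; have [_ _ f _] := renamed_face false j false.
have [oA _ _] := renamed_opp false; have [_ _ oC] := renamed_opp false.
have := @opposite_edges _ _ _ hl hG _ _ _ 1 f (expr1n _ _).
by rewrite oA oC !hs !mul1r; apply.
Qed.

Lemma opposite_A i : T (AA i) (CC true) = T (AA i) (CC false) \/
  T (AA i) (CC true) = - T (AA i) (CC false).
Proof.
have [s s0 hs] := angle_at_A i; have [_ f _ _] := renamed_face i false false.
have [_ oB _] := renamed_opp false; have [_ _ oC] := renamed_opp false.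
have := @opposite_edges _ _ _ hl hG _ _ _ (-1) f.
by rewrite oB oC !hs /= sqrrN expr1n; apply=> //; ring.
Qed.

Local Notation curve := (curve p q).
Local Notation t_ := (fun i j => edge_of (AA i) (BB j)).
Local Notation tow := (tower (@curve_w R p q) (@curve_y R p q)).
Local Notation cY := (@curve_Y R p q).
Local Notation cZ := (@curve_Z R p q).

Definition chart_curve : set curve :=
  [set c | exists2 x, ((fun v : edge -> R => fun e => Some (v e)) @` irr_set A) x & curve_point sigma c x].

Lemma chart_curve_infinite : infinite_set (@curve_w R p q @` chart_curve).
Proof.
apply: (curve_w_infinite hl hsigma hstd).
  move=> fin; apply: (chart_infinite (hG := hG)).
  pose back (x : edge -> option R) : edge -> R := fun e => odflt 0 (x e).
  by apply: sub_finite_set (finite_image back fin) => v Av; exists (fun e => Some (v e)) => //; exists v.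
move=> _ [v Av <-]; apply: (configuration_curve_point hsigma hp hq hstd).
exact: (component_configuration hG (chartP Av)).
Qed.

Lemma chart_curve_point v : irr_set A v -> exists2 c, chart_curve c & curve_point sigma c (fun e => Some (v e)).
Proof.
move=> Av; have hx := component_configuration hG (chartP Av).
have [c hc] := configuration_curve_point hsigma hp hq hstd hx.
by exists c => //; exists (fun e => Some (v e)) => //; exists v.
Qed.

Definition homogenization (kappa : R) (n : nat) (g : {poly R}) (c : curve) : R :=
  \sum_(i < n) g`_i * kappa ^+ i * cZ c false ^+ i * cY c false ^+ (n - i).

Lemma homogenizationE kappa n (g : {poly R}) c : (size g <= n)%N -> cY c false != 0 ->
  homogenization kappa n g c = cY c false ^+ n * g.[kappa * cZ c false / cY c false].
Proof.
move=> sg Y0; rewrite (horner_coef_wide _ sg) big_distrr /=; apply: eq_bigr => i _.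
have -> : cY c false ^+ n = cY c false ^+ (n - i) * cY c false ^+ i.
  by rewrite -exprD subnK // ltnW.
have Yi : cY c false ^+ i != 0 by rewrite expf_neq0.
by rewrite expr_div_n exprMn; field.
Qed.

Lemma tower_homogenization kappa n g : tow 2 (homogenization kappa n g).
Proof.
apply: (@tower_sum _ _ _ _ 2 _ _ (fun (i : 'I_n) c =>
  g`_i * kappa ^+ i * cZ c false ^+ i * cY c false ^+ (n - i))) => i.
have tM := @towerM R curve (@curve_w R p q) (@curve_y R p q) (@curve_h R p q) (@curve_y_sqr R p q) 2.
have tX := @towerX R curve (@curve_w R p q) (@curve_y R p q) (@curve_h R p q) (@curve_y_sqr R p q) 2.
have tC (a : R) : tow 2 (fun=> a) by exact: tower_cst.
have tY : tow 2 (fun c => cY c false).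
  by apply: (@tower_le _ _ _ _ 1 2) => //; exact: (tower_gen _ _ 0).
have tZ : tow 2 (fun c => cZ c false) by exact: (tower_gen _ _ 1).
apply: (tM (fun c => g`_i * kappa ^+ i * cZ c false ^+ i) (fun c => cY c false ^+ (n - i))).
  apply: (tM (fun c => g`_i * kappa ^+ i) (fun c => cZ c false ^+ i)) => //.
  exact: (tX (fun c => cZ c false)).
exact: (tX (fun c => cY c false)).
Qed.

Lemma horner_chart_eq0 e (g : {poly R}) : (forall v, irr_set A v -> g.[v e] = 0) ->
  (map_poly iota g).[coordinate A e] = 0.
Proof.
move=> h; have [f [<- fv]] := coordinate_poly A e g.
by apply/regular_eq0 => v Av; rewrite fv h.
Qed.

Lemma homogenization_eq0 kappa n (g : {poly R}) : kappa != 0 -> (size g <= n)%N ->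
  (forall (c : curve) x t, curve_point sigma c x -> x (t_ false false) = Some t ->
     cY c false != 0 /\ t = kappa * cZ c false / cY c false) ->
  (forall c, homogenization kappa n g c = 0) ->
  (map_poly iota g).[coordinate A (t_ false false)] = 0.
Proof.
move=> k0 sg hk h; apply: horner_chart_eq0 => v Av.
have [c _ hc] := chart_curve_point Av; have [Y0 ->] := hk _ _ _ hc (erefl _).
by have := h c; rewrite homogenizationE // => /eqP; rewrite mulf_eq0 expf_eq0 (negPf Y0) andbF => /eqP.
Qed.

Lemma coordinate_independence (g a b : {poly R}) :
  (map_poly iota g).[coordinate A (t_ false false)] * coordinate A (t_ false true) =
    (map_poly iota a).[coordinate A (t_ false false)]
    + (map_poly iota b).[coordinate A (t_ false false)] * coordinate A (t_ true false) ->
  (map_poly iota g).[coordinate A (t_ false false)] = 0.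
Proof.
move=> EF.
have E v : irr_set A v -> g.[v (t_ false false)] * v (t_ false true) =
    a.[v (t_ false false)] + b.[v (t_ false false)] * v (t_ true false).
  have [fg [eg hg]] := coordinate_poly A (t_ false false) g.
  have [fa' [ea ha]] := coordinate_poly A (t_ false false) a.
  have [fb [eb hb]] := coordinate_poly A (t_ false false) b.
  move: EF; rewrite -eg -ea -eb /coordinate -!rmorphM -rmorphD => /pointwise_coordinate_eq EF.
  by move=> /EF; rewrite !(mevalD, mevalM) hg ha hb !meval_coord.
have [k00 k00n h00] := curve_point01 hl hsigma hstd false false.
have [k01 k01n h01] := curve_point01 hl hsigma hstd false true.
have [k10 k10n h10] := curve_point01 hl hsigma hstd true false.
pose n := maxn (size g) (maxn (size a) (size b)).
have [sg sa sb] : [/\ (size g <= n)%N, (size a <= n)%N & (size b <= n)%N].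
  by rewrite /n !leq_max !leqnn !orbT.
apply: (homogenization_eq0 k00n sg h00).
pose hom := homogenization k00 n.
have tM k := @towerM R curve (@curve_w R p q) (@curve_y R p q) (@curve_h R p q) (@curve_y_sqr R p q) k.
have tB k := @towerB R curve (@curve_w R p q) (@curve_y R p q) (@curve_h R p q) (@curve_y_sqr R p q) k.
have tC k (r : R) : tow k (fun=> r) by exact: tower_cst.
have tY0 : tow 3 (fun c => cY c false).
  by apply: (@tower_le _ _ _ _ 1 3) => //; exact: (tower_gen _ _ 0).
have tZ0 : tow 3 (fun c => cZ c false).
  by apply: (@tower_le _ _ _ _ 2 3) => //; exact: (tower_gen _ _ 1).
have tY1 : tow 3 (fun c => cY c true) by exact: (tower_gen _ _ 2).
have th2 f : tow 2 (hom f) by exact: tower_homogenization.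
have th f : tow 3 (hom f) by exact: towerS.
pose a3 c := 0 - (hom a c * cY c false * cY c true + hom b c * k10 * cZ c false * cY c false).
pose b3 c := hom g c * k01 * cY c true.
have ta3 : tow 3 a3.
  apply: (tB 3 (fun=> 0)) => //; apply: towerD.
    apply: (tM 3 (fun c => hom a c * cY c false)) => //; exact: (tM 3).
  apply: (tM 3 (fun c => hom b c * k10 * cZ c false)) => //.
  apply: (tM 3 (fun c => hom b c * k10)) => //; exact: (tM 3).
have tb3 : tow 3 b3 by apply: (tM 3 (fun c => hom g c * k01)) => //; exact: (tM 3).
have winf : infinite_set (range (@curve_w R p q)).
  by apply: sub_infinite_set chart_curve_infinite; apply: image_subset.
have main k := curve_tower_main hl hsigma hp hq hstd winf (k := k).
have z4 : forall c, a3 c + b3 c * cZ c true = 0.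
  have [v4 _] := main 4 (leqnn 4).
  apply: (v4 (fun c => a3 c + b3 c * cZ c true) chart_curve _ chart_curve_infinite).
    by exists a3, b3.
  move=> c [_ [v Av <-] hc].
  have [Y0 e0] := h00 _ _ _ hc (erefl _); have [_ e1] := h01 _ _ _ hc (erefl _).
  have [Y1 e2] := h10 _ _ _ hc (erefl _).
  have := E v Av; rewrite e1 e2 e0 => E'.
  rewrite /a3 /b3 /hom !homogenizationE //.
  set x := _ / _ in E' *.
  transitivity (cY c false ^+ n.+1 * cY c true * (g.[x] * (k01 * cZ c true / cY c false)
    - (a.[x] + b.[x] * (k10 * cZ c false / cY c true)))).
    by rewrite exprS; field; rewrite Y0 Y1.
  by rewrite E' subrr mulr0.
have [_ n3] := main 3 isT.
have [_ b30] := tower_indep (@curve_y_sqr R p q) (n3 isT) ta3 tb3 z4.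
have [_ n2] := main 2 isT.
have [||_ g0] := @tower_indep _ _ _ _ _ (@curve_y_sqr R p q) 2 (fun=> 0)
  (fun c => hom g c * k01) (n2 isT) (tC _ _).
- exact: (tM 2).
- by move=> c; rewrite add0r; exact: b30.
by move=> c; have /eqP := g0 c; rewrite mulf_eq0 (negPf k01n) orbF => /eqP.
Qed.

Lemma coordinate_irrational (g a : {poly R}) :
  (map_poly iota g).[coordinate A (t_ false false)] * coordinate A (t_ true false) =
    (map_poly iota a).[coordinate A (t_ false false)] ->
  (map_poly iota g).[coordinate A (t_ false false)] = 0.
Proof.
move=> EF.
have E v : irr_set A v -> g.[v (t_ false false)] * v (t_ true false) = a.[v (t_ false false)].
  have [fg [eg hg]] := coordinate_poly A (t_ false false) g.
  have [fa' [ea ha]] := coordinate_poly A (t_ false false) a.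
  move: EF; rewrite -eg -ea /coordinate -!rmorphM => /pointwise_coordinate_eq EF.
  by move=> /EF; rewrite !mevalM hg ha !meval_coord.
have [k00 k00n h00] := curve_point01 hl hsigma hstd false false.
have [k10 k10n h10] := curve_point01 hl hsigma hstd true false.
pose n := maxn (size g) (size a).
have [sg sa] : (size g <= n)%N /\ (size a <= n)%N by rewrite /n !leq_max !leqnn !orbT.
apply: (homogenization_eq0 k00n sg h00).
pose hom := homogenization k00 n.
have tM k := @towerM R curve (@curve_w R p q) (@curve_y R p q) (@curve_h R p q) (@curve_y_sqr R p q) k.
have tB k := @towerB R curve (@curve_w R p q) (@curve_y R p q) (@curve_h R p q) (@curve_y_sqr R p q) k.
have tC k (r : R) : tow k (fun=> r) by exact: tower_cst.
have tZ0 : tow 2 (fun c => cZ c false) by exact: (tower_gen _ _ 1).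
have th f : tow 2 (hom f) by exact: tower_homogenization.
pose a2 c := hom g c * k10 * cZ c false.
pose b2 c := 0 - hom a c.
have ta2 : tow 2 a2 by apply: (tM 2 (fun c => hom g c * k10)) => //; exact: (tM 2).
have tb2 : tow 2 b2 by apply: (tB 2 (fun=> 0)).
have winf : infinite_set (range (@curve_w R p q)).
  by apply: sub_infinite_set chart_curve_infinite; apply: image_subset.
have main k := curve_tower_main hl hsigma hp hq hstd winf (k := k).
have z3 : forall c, a2 c + b2 c * cY c true = 0.
  have [v3 _] := main 3 isT.
  apply: (v3 (fun c => a2 c + b2 c * cY c true) chart_curve _ chart_curve_infinite).
    by exists a2, b2.
  move=> c [_ [v Av <-] hc].
  have [Y0 e0] := h00 _ _ _ hc (erefl _); have [Y1 e2] := h10 _ _ _ hc (erefl _).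
  have := E v Av; rewrite e2 e0 => E'.
  rewrite /a2 /b2 /hom !homogenizationE //.
  set x := _ / _ in E' *.
  transitivity (cY c false ^+ n * cY c true * (g.[x] * (k10 * cZ c false / cY c true) - a.[x])).
    by field; rewrite Y1.
  by rewrite E' subrr mulr0.
have [_ n2] := main 2 isT; have [v2 _] := main 2 isT.
have [a20 _] := tower_indep (@curve_y_sqr R p q) (n2 isT) ta2 tb2 z3.
have tg : tow 2 (fun c => hom g c * k10) by exact: (tM 2).
have [g0|Z0] := tower_domain winf v2 tg tZ0 a20.
  by move=> c; have /eqP := g0 c; rewrite mulf_eq0 (negPf k10n) orbF => /eqP.
have [_ n1] := main 1 isT.
have [|_ one] := @tower_indep _ _ _ _ _ (@curve_y_sqr R p q) 1 (fun=> 0)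
  (fun=> 1) (n1 isT) (tC _ _) (tC _ _).
  by move=> c; rewrite add0r mul1r; exact: Z0.
by move=> c; have /eqP := one c; rewrite oner_eq0.
Qed.

Lemma coordinate_transcendental : transcendental iota (coordinate A (t_ false false)).
Proof.
move=> g gT; apply: contrapT => /eqP g0.
have [k00 k00n h00] := curve_point01 hl hsigma hstd false false.
have gv v : irr_set A v -> g.[v (t_ false false)] = 0.
  have [f [ef hf]] := coordinate_poly A (t_ false false) g.
  by move: gT; rewrite -ef => /regular_eq0 h /h; rewrite hf.
have rfin : finite_set [set r : R | g.[r] = 0].
  by apply: contrapT => inf; move/eqP: g0; apply; apply: (poly_infinite_roots inf).
apply: chart_curve_infinite.
pose back (t : R) := (k00 ^+ 2 * (1 - q false ^+ 2) + p false ^+ 2 * t ^+ 2) / (k00 ^+ 2 + t ^+ 2).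
apply: sub_finite_set (finite_image back rfin) => _ [c [_ [v Av <-] hc] <-].
exists (v (t_ false false)); first exact: gv.
have [Y0 ->] := h00 _ _ _ hc (erefl _); have [_ hY hZ] := proj2_sig c.
have Y2 : cY c false ^+ 2 = curve_w c - p false ^+ 2 := hY false.
have Z2 : cZ c false ^+ 2 = 1 - q false ^+ 2 - curve_w c := hZ false.
have pq := pq_lt1 hl hsigma hstd false false.
rewrite /back expr_div_n exprMn Z2.
have Y20 : cY c false ^+ 2 != 0 by rewrite expf_neq0.
transitivity ((k00 ^+ 2 * (1 - q false ^+ 2) * cY c false ^+ 2 + p false ^+ 2 * (k00 ^+ 2 * (1 - q false ^+ 2 - curve_w c)))
  / (k00 ^+ 2 * (1 - p false ^+ 2 - q false ^+ 2))).
  have -> : 1 - p false ^+ 2 - q false ^+ 2 = cY c false ^+ 2 + (1 - q false ^+ 2 - curve_w c).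
    by rewrite Y2; ring.
  field; rewrite Y0 /= k00n /=.
  have -> : cY c false ^+ 2 + (1 - q false ^+ 2 - curve_w c) = 1 - p false ^+ 2 - q false ^+ 2.
    by rewrite Y2; ring.
  have nz : 1 - p false ^+ 2 - q false ^+ 2 != 0 by rewrite gt_eqF.
  rewrite nz; have -> : (k00 * cY c false) ^+ 2 + k00 ^+ 2 * (1 - q false ^+ 2 - (sval c).1.1) =
    k00 ^+ 2 * (1 - p false ^+ 2 - q false ^+ 2).
    by rewrite exprMn Y2 /curve_w; ring.
  by rewrite mulf_neq0 // expf_neq0.
by rewrite Y2; field; rewrite k00n gt_eqF.
Qed.

End StandardComponent.

Section StandardField.
Variables (R : realType) (F : fieldType) (iota : {rmorphism R -> F}).
Variables (X W : bool -> F) (y : bool -> bool -> F).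
Local Notation K := (rational_in iota (y false false)).

Lemma kite_rational x t (z a d : R) : x != 0 -> z != 0 ->
  2 * iota (- z) * x + t * (iota a * x ^+ 2 + iota d) = 0 -> rational_in iota x t.
Proof.
move=> x0 z0 e.
have sK := rational_in_subfield iota x; have Kc := rational_in_cst iota x.
have Kx := rational_in_gen iota x.
have zx : 2 * iota z * x != 0.
  by rewrite !mulf_neq0 ?fmorph_eq0 // -(rmorph_nat iota) fmorph_eq0 pnatr_eq0.
have e' : t * (iota a * x ^+ 2 + iota d) = 2 * iota z * x.
  by move: e; rewrite rmorphN mulrN mulNr addrC => /eqP; rewrite subr_eq0 => /eqP.
have den0 : iota a * x ^+ 2 + iota d != 0.
  by apply: contraNneq zx => h; rewrite -e' h mulr0.
have -> : t = 2 * iota z * x / (iota a * x ^+ 2 + iota d) by rewrite -e' mulfK.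
apply: (subfield_div sK).
  by do ?apply: (subfieldM sK) => //; exact: subfield_nat.
by apply: (subfieldD sK) => //; apply: (subfieldM sK) => //; exact: subfieldX.
Qed.

Lemma antikite_rational x t (z b e : R) : x != 0 -> z != 0 ->
  iota b * x ^+ 2 + iota e + 2 * iota z * x * t = 0 -> rational_in iota x t.
Proof.
move=> x0 z0 h.
have sK := rational_in_subfield iota x; have Kc := rational_in_cst iota x.
have Kx := rational_in_gen iota x.
have zx : 2 * iota z * x != 0.
  by rewrite !mulf_neq0 ?fmorph_eq0 // -(rmorph_nat iota) fmorph_eq0 pnatr_eq0.
have -> : t = - (iota b * x ^+ 2 + iota e) / (2 * iota z * x).
  apply: (mulfI zx); rewrite mulrCA divff // mulr1; apply/eqP; rewrite -subr_eq0 -h.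
  by apply/eqP; ring.
apply: (subfield_div sK); last by do ?apply: (subfieldM sK) => //; exact: subfield_nat.
apply: (subfieldN sK); apply: (subfieldD sK) => //; apply: (subfieldM sK) => //; exact: subfieldX.
Qed.

Hypotheses (X0 : forall j, X j != 0) (W0 : forall i, W i != 0) (y0 : forall i j, y i j != 0).
Hypothesis hX : forall j, exists (z : bool -> R) (a d : R), [/\ forall i, z i != 0, a != 0, d != 0 &
  forall i, 2 * iota (- z (~~ i)) * X j + y i j * (iota a * X j ^+ 2 + iota (if i then - d else d)) = 0].
Hypothesis hW : forall i, exists (z : bool -> R) (b e : R), [/\ forall j, z j != 0, b != 0, e != 0 &
  forall j, iota b * W i ^+ 2 + iota (if j then - e else e) + 2 * iota (z (~~ j)) * W i * y i j = 0].
Hypothesis hy : exists2 r : R, r != 0 & y true true * y false false = iota r * y false true * y true false.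
Hypothesis ytr : transcendental iota (y false false).
Local Notation ev f := ((map_poly iota f).[y false false]).
Hypothesis yirr : forall g a : {poly R}, ev g * y true false = ev a -> ev g = 0.
Hypothesis yind : forall g a b : {poly R},
  ev g * y false true = ev a + ev b * y true false -> ev g = 0.
Hypothesis top : forall L : set F, is_subfield L -> (forall c, L (iota c)) ->
  (forall j, L (X j)) -> (forall i, L (W i)) -> (forall i j, L (y i j)) -> forall x, L x.

Lemma y10_notin : ~ K (y true false).
Proof.
move=> [a [g [g0 e]]]; move/eqP: (g0); apply; apply: (yirr (a := a)).
by rewrite e mulrCA divff // mulr1.
Qed.

Lemma y01_notin : ~ adjoin K (y true false) (y false true).
Proof.
move=> [_ [_ [[a [g [g0 ->]]] [b [h [h0 ->]]] e]]].
have : ev (g * h) != 0 by rewrite evM mulf_neq0.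
move/eqP; apply; apply: (yind (a := a * h) (b := b * g)).
by rewrite e !evM; field; rewrite g0 h0.
Qed.

Lemma two_neq0 : 2 != 0 :> F.
Proof. by rewrite -(rmorph_nat iota) fmorph_eq0 pnatr_eq0. Qed.

Lemma standard_degrees : let t := X false in let u := W false in let v := y false false in
  [/\ rational_in iota v = rational_in iota t `&` rational_in iota u,
      extension_degree setT (rational_in iota v) 4,
      extension_degree setT (rational_in iota t) 2 /\ extension_degree setT (rational_in iota u) 2 &
      extension_degree (rational_in iota t) (rational_in iota v) 2 /\
        extension_degree (rational_in iota u) (rational_in iota v) 2].
Proof.
move=> t u v.
have yX i j : rational_in iota (X j) (y i j).
  have [z [a [d [z0 _ _ h]]]] := hX j; exact: kite_rational (X0 j) (z0 _) (h i).
have yW i j : rational_in iota (W i) (y i j).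
  have [z [b [e [z0 _ _ h]]]] := hW i; exact: antikite_rational (W0 i) (z0 _) (h j).
have sK := rational_in_subfield iota v; have Kc := rational_in_cst iota v.
have Kv : rational_in iota v v := rational_in_gen iota v.
have K2 : rational_in iota v 2 by exact: subfield_nat.
have sT := rational_in_subfield iota t; have sU := rational_in_subfield iota u.
have [z [a [d [z0 a0 d0 hz]]]] := hX false.
have [z' [b [e [z0' b0 e0 hz']]]] := hW false.
have tv : ~ rational_in iota v t.
  have zn : - z true != 0 by rewrite oppr_eq0.
  exact: (quadratic_irrational ytr a0 d0 zn (hz false)).
have [ia ib] : iota a != 0 /\ iota b != 0 by rewrite !fmorph_eq0.
have v0 : v != 0 by exact: y0.
have et : t ^+ 2 = (2 * iota (z true) / (iota a * v)) * t + - (iota d / iota a).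
  apply: (mulfI (mulf_neq0 ia v0)).
  transitivity (2 * iota (z true) * t - v * iota d).
    have := hz false; rewrite /= -/t -/v => h; apply/eqP; rewrite -subr_eq0 -h; apply/eqP.
    by rewrite rmorphN; ring.
  by field; rewrite ia v0.
have eu : u ^+ 2 = (- (2 * iota (z' true) * v) / iota b) * u + - (iota e / iota b).
  apply: (mulfI ib).
  transitivity (- (2 * iota (z' true) * u * v) - iota e).
    have := hz' false; rewrite /= -/u -/v => h; apply/eqP; rewrite -subr_eq0 -h; apply/eqP.
    by ring.
  by field.
have Kr : rational_in iota v (2 * iota (z true) / (iota a * v)).
  by apply: (subfield_div sK); apply: (subfieldM sK).
have Ks : rational_in iota v (- (iota d / iota a)).
  by apply: (subfieldN sK); exact: subfield_div.
have Kr' : rational_in iota v (- (2 * iota (z' true) * v) / iota b).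
  apply: (subfield_div sK) => //; apply: (subfieldN sK).
  by apply: (subfieldM sK) => //; exact: subfieldM.
have Ks' : rational_in iota v (- (iota e / iota b)).
  by apply: (subfieldN sK); exact: subfield_div.
have Lt : rational_in iota t = adjoin (rational_in iota v) t.
  exact: (rational_in_adjoin (yX false false) tv Kr Ks et).
have tu : ~ rational_in iota t u.
  move=> Ltu; have : rational_in iota t (y false true).
    exact: (rational_in_min sT (rational_in_cst iota t) Ltu (yW false true)).
  have := yX true false; rewrite -/t Lt => -[c [c' [Kc1 Kc1' e10]]] [f [f' [Kf Kf' e01]]].
  have c0 : c' != 0.
    by apply/eqP => c0; apply: y10_notin; rewrite e10 c0 mul0r addr0.
  apply: y01_notin; exists (f - f' * c / c'), (f' / c'); split.
  - apply: (subfieldB sK) => //; apply: (subfield_div sK) => //; exact: subfieldM.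
  - exact: subfield_div.
  - by rewrite e01 e10; field.
apply: (quartic_degrees (r := 2 * iota (z true) / (iota a * v)) (s := - (iota d / iota a))
  (r' := - (2 * iota (z' true) * v) / iota b) (s' := - (iota e / iota b))) => //.
- exact: yX.
- exact: yW.
move=> L sL Lc LX LW; have minL x w : L x -> rational_in iota x w -> L w.
  by move=> Lx; apply: rational_in_min.
have Ly00 : L (y false false) by apply: minL LX (yX _ _).
have Ly10 : L (y true false) by apply: minL LX (yX _ _).
have Ly01 : L (y false true) by apply: minL LW (yW _ _).
have Ly11 : L (y true true).
  have [r r0 er] := hy.
  have -> : y true true = iota r * y false true * y true false / y false false.
    by rewrite -er mulfK.
  by apply: (subfield_div sL) => //; do ?apply: (subfieldM sL).
have Ly i j : L (y i j) by case: i; case: j.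
apply: (top sL Lc) => //.
- case=> //; have [z1 [a1 [d1 [z10 a10 d10 h]]]] := hX true.
  have /= h0 := h false; have /= h1 := h true.
  set x := X true in h0 h1 *.
  have E : x * (iota (z1 true) * y true true - iota (z1 false) * y false true) =
      y false true * y true true * iota d1.
    apply: (mulfI two_neq0); apply/eqP; rewrite -subr_eq0; apply/eqP.
    transitivity (- y true true * 0 + y false true * 0); last by ring.
    by rewrite -{1}h0 -h1 !rmorphN; ring.
  have den0 : iota (z1 true) * y true true - iota (z1 false) * y false true != 0.
    apply/eqP => den; move/eqP: E; rewrite den mulr0 eq_sym !mulf_eq0.
    by rewrite !(negPf (y0 _ _)) fmorph_eq0 (negPf d10).
  have -> : x = y false true * y true true * iota d1 /
      (iota (z1 true) * y true true - iota (z1 false) * y false true) by rewrite -E mulfK.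
  apply: (subfield_div sL); first by do ?apply: (subfieldM sL).
  by apply: (subfieldB sL); exact: subfieldM.
case=> //; have [z1 [b1 [e1 [z10 b10 e10 h]]]] := hW true.
have /= h0 := h false; have /= h1 := h true.
set x := W true in h0 h1 *.
have E : x * (iota (z1 false) * y true true - iota (z1 true) * y true false) = iota e1.
  apply: (mulfI two_neq0); apply/eqP; rewrite -subr_eq0; apply/eqP.
  transitivity (- 0 + 0 : F); last by ring.
  by rewrite -{1}h0 -h1 !rmorphN; ring.
have den0 : iota (z1 false) * y true true - iota (z1 true) * y true false != 0.
  apply/eqP => den; move/eqP: E; rewrite den mulr0 eq_sym.
  by rewrite fmorph_eq0 (negPf e10).
have -> : x = iota e1 / (iota (z1 false) * y true true - iota (z1 true) * y true false).
  by rewrite -E mulfK.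
by apply: (subfield_div sL) => //; apply: (subfieldB sL); exact: subfieldM.
Qed.

End StandardField.

Section Backward.
Variables (R : realType) (l : edge -> R) (G : set (edge -> option R)).
Hypothesis hl : nondegenerate_lengths l.
Hypothesis hG : essential_component l G.
Variables (sigma : vertex -> vertex) (p q : bool -> R).
Hypothesis hsigma : renaming sigma.
Hypothesis hp : p false ^+ 2 != p true ^+ 2.
Hypothesis hq : q false ^+ 2 != q true ^+ 2.
Hypothesis hstd : std_lengths l sigma p q.
Local Notation A := (component_chart hG).
Local Notation iota := (const A).
Local Notation T := (fun u v => coordinate A (edge_of u v)).
Local Notation AA := (fun i => sigma (vtx 0 i)).
Local Notation BB := (fun j => sigma (vtx 1 j)).
Local Notation CC := (fun k => sigma (vtx 2 k)).

Lemma equator_relation : exists2 r : R, r != 0 &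
  T (AA true) (BB true) * T (AA false) (BB false) =
    iota r * T (AA false) (BB true) * T (AA true) (BB false).
Proof.
have [k00 k00n h00] := curve_point01 hl hsigma hstd false false.
have [k01 k01n h01] := curve_point01 hl hsigma hstd false true.
have [k10 k10n h10] := curve_point01 hl hsigma hstd true false.
have [k11 k11n h11] := curve_point01 hl hsigma hstd true true.
exists (k11 * k00 / (k01 * k10)).
  by rewrite mulf_neq0 ?invr_neq0 // mulf_neq0.
rewrite /coordinate -[iota _]/(regular A (mpolyC _ _)) -!rmorphM.
apply/pointwise_coordinate_eq => v Av.
have [c _ hc] := chart_curve_point hsigma hp hq hstd Av.
rewrite !mevalM mevalC !meval_coord.
have [Y0 ->] := h00 _ _ _ hc (erefl _); have [_ ->] := h01 _ _ _ hc (erefl _).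
have [Y1 ->] := h10 _ _ _ hc (erefl _); have [_ ->] := h11 _ _ _ hc (erefl _).
by field; rewrite k01n k10n Y0 Y1.
Qed.

Lemma all_coordinates (L : set (function_field A)) : is_subfield L ->
  (forall c, L (iota c)) -> (forall j, L (T (BB j) (CC false))) ->
  (forall i, L (T (AA i) (CC false))) -> (forall i j, L (T (AA i) (BB j))) -> forall x, L x.
Proof.
move=> sL Lc LX LW Ly.
have LX' j : L (T (BB j) (CC true)).
  by case: (opposite_B hl hG hsigma hstd j) => ->; [|apply: (subfieldN sL)]; exact: LX.
have LW' i : L (T (AA i) (CC true)).
  by case: (opposite_A hl hG hsigma hstd i) => ->; [|apply: (subfieldN sL)]; exact: LW.
have LXk j k : L (T (BB j) (CC k)) by case: k; [exact: LX'|exact: LX].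
have LWk i k : L (T (AA i) (CC k)) by case: k; [exact: LW'|exact: LW].
apply: (subfield_top sL Lc) => e.
have [u [v [t [f ->]]]] := edge_ofP e; have [uv _ _] := face_idx f.
rewrite -(renamingK hsigma u) -(renamingK hsigma v).
move: uv; rewrite -[in u.1](renamingK hsigma u) -[in v.1](renamingK hsigma v) renaming_idx //.
elim/vertex_ind: (sigma u) => i; elim/vertex_ind: (sigma v) => j; rewrite vtx_idx //= => _.
- by rewrite edge_ofC.
- by rewrite edge_ofC.
- by rewrite edge_ofC.
Qed.

Lemma standard_component_degrees :
  let t := T (BB false) (CC false) in let u := T (AA false) (CC false) in
  let v := T (AA false) (BB false) in
  [/\ rational_in iota v = rational_in iota t `&` rational_in iota u,
      extension_degree setT (rational_in iota v) 4,
      extension_degree setT (rational_in iota t) 2 /\ extension_degree setT (rational_in iota u) 2 &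
      extension_degree (rational_in iota t) (rational_in iota v) 2 /\
        extension_degree (rational_in iota u) (rational_in iota v) 2].
Proof.
apply: (@standard_degrees R (function_field A) iota (fun j => T (BB j) (CC false))
  (fun i => T (AA i) (CC false)) (fun i j => T (AA i) (BB j))).
- by move=> j; exact: coordinate_neq0.
- by move=> j; exact: coordinate_neq0.
- by move=> i j; exact: coordinate_neq0.
- exact: (B_relation hl hG hsigma hp hstd).
- exact: (A_relation hl hG hsigma hq hstd).
- exact: equator_relation.
- exact: (coordinate_transcendental hl hsigma hp hq hstd).
- exact: (coordinate_irrational hl hsigma hp hq hstd).
- exact: (coordinate_independence hl hsigma hp hq hstd).
- exact: all_coordinates.
Qed.

End Backward.

(** * Lengths from degrees *)

Section AbstractDegrees.
Variables (R : realType) (F : fieldType) (iota : {rmorphism R -> F}).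
Implicit Types (t u y : F).

Lemma degree2_irrational t y : extension_degree (rational_in iota t) (rational_in iota y) 2 ->
  rational_in iota t y /\ ~ rational_in iota y t.
Proof.
move=> d; have sy := rational_in_subfield iota y; split.
  by case: d => h _; apply: h; exact: rational_in_gen.
move=> h; apply: (degree2_neq sy d); exact: (rational_in_min sy (rational_in_cst iota y) h).
Qed.

Lemma intersection_irrational t u y :
  rational_in iota y = rational_in iota t `&` rational_in iota u ->
  ~ rational_in iota y u -> ~ rational_in iota t u.
Proof.
by move=> e yu tu; apply: yu; rewrite e; split=> //; exact: rational_in_gen.
Qed.

Lemma half_biquadratics_absurd t u y (c1 a1 b1 c2 a2 b2 a b c d e : R) : transcendental iota t ->
  ~ rational_in iota t u -> t != 0 -> u != 0 -> y != 0 ->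
  ~ rational_in iota y t -> ~ rational_in iota y u -> c1 != 0 -> c2 != 0 -> c != 0 ->
  2 * iota c1 * t + y * (iota a1 * t ^+ 2 + iota b1) = 0 ->
  2 * iota c2 * u + y * (iota a2 * u ^+ 2 + iota b2) = 0 ->
  iota a * t ^+ 2 * u ^+ 2 + iota b * t ^+ 2 + 2 * iota c * t * u
    + iota d * u ^+ 2 + iota e = 0 -> False.
Proof.
move=> tr tu t0 u0 y0 yt yu c10 c20 c0 e1 e2 rel.
have [a10 b10] := half_biquadratic_neq0 t0 y0 yt c10 e1.
have [a20 b20] := half_biquadratic_neq0 u0 y0 yu c20 e2.
apply: (@no_mixed_term _ _ iota t u a b c d e (c1 * a2) (- (c2 * a1)) (- (c2 * b1)) (c1 * b2)) => //.
- by rewrite mulf_neq0.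
- by rewrite oppr_eq0 mulf_neq0.
- by rewrite oppr_eq0 mulf_neq0.
apply: (mulfI y0); rewrite mulr0.
transitivity (iota c1 * t * 0 - iota c2 * u * 0 : F); last by ring.
by rewrite -{1}e2 -e1; ring.
Qed.

Lemma inv_irrational t y : ~ rational_in iota y t -> ~ rational_in iota y^-1 t.
Proof.
move=> h h'; apply: h; have s := rational_in_subfield iota y.
apply: (rational_in_min s (rational_in_cst iota y)) h'.
by apply: (subfieldV s); exact: rational_in_gen.
Qed.

Lemma half_equal t y (a b c d e : R) : y != 0 -> b = 0 -> e = 0 ->
  iota a * t ^+ 2 * y ^+ 2 + iota b * t ^+ 2 + 2 * iota c * t * y
    + iota d * y ^+ 2 + iota e = 0 -> 2 * iota c * t + y * (iota a * t ^+ 2 + iota d) = 0.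
Proof. by move=> y0 -> -> E; apply: (mulfI y0); rewrite mulr0 -E; ring. Qed.

Lemma scaled_biquadratic (s1 s2 : R) t u (a b c d e : R) : s1 ^+ 2 = 1 -> s2 ^+ 2 = 1 ->
  iota a * (iota s1 * t) ^+ 2 * (iota s2 * u) ^+ 2 + iota b * (iota s1 * t) ^+ 2
    + 2 * iota c * (iota s1 * t) * (iota s2 * u) + iota d * (iota s2 * u) ^+ 2 + iota e = 0 ->
  iota a * t ^+ 2 * u ^+ 2 + iota b * t ^+ 2 + 2 * iota (s1 * s2 * c) * t * u
    + iota d * u ^+ 2 + iota e = 0.
Proof.
move=> e1 e2; rewrite !exprMn -!(rmorphXn iota) e1 e2 rmorph1 !mul1r => E.
by rewrite -[RHS]E; ring.
Qed.

Lemma half_supp t y (a b c d e : R) : y != 0 -> a = 0 -> d = 0 ->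
  iota a * t ^+ 2 * y ^+ 2 + iota b * t ^+ 2 + 2 * iota c * t * y
    + iota d * y ^+ 2 + iota e = 0 -> 2 * iota c * t + y^-1 * (iota b * t ^+ 2 + iota e) = 0.
Proof. by move=> y0 -> -> E; apply: (mulfI y0); rewrite mulr0 -E; field. Qed.

End AbstractDegrees.

Section Forward.
Variables (R : realType) (l : edge -> R) (G : set (edge -> option R)).
Hypothesis hl : nondegenerate_lengths l.
Hypothesis hG : essential_component l G.
Local Notation A := (component_chart hG).
Local Notation iota := (const A).
Local Notation T := (fun u v => coordinate A (edge_of u v)).
Local Notation fa := (face_angle l).

Lemma constant_coordinate e (p : {poly R}) : p != 0 ->
  (map_poly iota p).[coordinate A e] = 0 -> exists c, coordinate A e = iota c.
Proof.
move=> p0 hp.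
have rootv v : irr_set A v -> root p (v e).
  have [f [ef fv]] := coordinate_poly A e p; move=> Av; rewrite rootE -fv; apply/eqP.
  by move: v Av; apply/regular_eq0; rewrite ef.
have /finite_seqP [s hs] : finite_set [set x | root p x].
  by apply: contrapT => inf; move/eqP: p0; apply; apply: (poly_infinite_roots inf) => x /rootP.
have : (map_poly iota (\prod_(c <- s) ('X - c%:P))).[coordinate A e] = 0.
  apply: horner_chart_eq0 => v Av; apply/eqP; rewrite -rootE root_prod_XsubC.
  by have : [set x | root p x] (v e) := rootv v Av; rewrite hs.
rewrite rmorph_prod horner_prod => /eqP; rewrite prodf_seq_eq0 => /hasP [c _] /=.
rewrite rmorphB /= map_polyX map_polyC hornerD hornerN hornerX hornerC subr_eq0 => /eqP h.
by exists c.
Qed.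

Definition equal_angles u v w := let w' := opp_vertex w in let v' := opp_vertex v in
  [/\ cos (fa u w' v) = cos (fa u w v), cos (fa u w' v') = cos (fa u w v') &
      cos (fa u w v) ^+ 2 != cos (fa u w v') ^+ 2].

Definition supplementary_angles u v w := let w' := opp_vertex w in let v' := opp_vertex v in
  [/\ cos (fa u w' v) = - cos (fa u w v), cos (fa u w' v') = - cos (fa u w v') &
      cos (fa u w v) ^+ 2 != cos (fa u w v') ^+ 2].

Lemma vertex_type u v w : is_face u v w -> transcendental iota (T u w) ->
  rational_in iota (T u w) (T u v) -> ~ rational_in iota (T u v) (T u w) ->
  (equal_angles u v w /\ exists c a b, c != 0 /\
     2 * iota c * T u w + T u v * (iota a * T u w ^+ 2 + iota b) = 0) \/
  (supplementary_angles u v w /\ exists c a b, c != 0 /\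
     2 * iota c * T u w + (T u v)^-1 * (iota a * T u w ^+ 2 + iota b) = 0).
Proof.
move=> f tr ty yt.
have f' : is_face u w v by rewrite /is_face; case/and3P: f => h1 h2 h3;
  rewrite eq_sym h3 eq_sym h2 eq_sym h1.
have y0 := coordinate_neq0 hG (edge_of u v).
have := vertex_relation hG f'; cbv zeta; set v' := opp_vertex v; set w' := opp_vertex w.
rewrite (face_angleC l u v w') (face_angleC l u v' w).
have [s10 q1] := face_angle_sin hl f'.
have [s20 q2] : 0 < sin (fa u w' v) /\ sin (fa u w' v) ^+ 2 = 1 - cos (fa u w' v) ^+ 2.
  exact: (face_angle_sin hl (is_face_opp2 f')).
have [s30 q3] : 0 < sin (fa u w' v') /\ sin (fa u w' v') ^+ 2 = 1 - cos (fa u w' v') ^+ 2.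
  exact: (face_angle_sin hl (is_face_opp (is_face_opp2 f'))).
have [s40 q4] : 0 < sin (fa u w v') /\ sin (fa u w v') ^+ 2 = 1 - cos (fa u w v') ^+ 2.
  exact: (face_angle_sin hl (is_face_opp f')).
have c0 := vertexC_neq0 s20 s40; move=> rel.
have [[A0 D0]|[B0 E0]] := biquadratic_split tr ty yt c0 rel.
  right; have [eb es ec es'] := vertexAD0 s10 s20 s30 s40 q1 q2 q3 q4 A0 D0.
  have [_ _ _ _ BE] := supp_coefs q1 q4 eb es ec es'.
  have hrel := half_supp y0 A0 D0 rel.
  have yn : (T u v)^-1 != 0 by rewrite invr_neq0.
  have [b0 e0] := half_biquadratic_neq0 (coordinate_neq0 hG _) yn (inv_irrational yt) c0 hrel.
  split; last by eexists; eexists; eexists; split; [exact: c0|exact: hrel].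
  apply: And3 eb ec _; have := mulf_neq0 b0 e0; rewrite BE; apply: contra => /eqP ->.
  by rewrite subrr mulr0.
left; have [eb es ec es'] := vertexBE0 s10 s20 s30 s40 q1 q2 q3 q4 B0 E0.
have [_ _ _ _ AD] := eq_coefs q1 q4 eb es ec es'.
have hrel := half_equal y0 B0 E0 rel.
have [a0 d0] := half_biquadratic_neq0 (coordinate_neq0 hG _) y0 yt c0 hrel.
split; last by eexists; eexists; eexists; split; [exact: c0|exact: hrel].
apply: And3 eb ec _; have := mulf_neq0 a0 d0; rewrite AD; apply: contra => /eqP ->.
by rewrite subrr mulr0.
Qed.

Section MixedTypes.
Variable sigma : vertex -> vertex.
Hypothesis hsigma : renaming sigma.
Local Notation AA := (fun i => sigma (vtx 0 i)).
Local Notation BB := (fun j => sigma (vtx 1 j)).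
Local Notation CC := (fun k => sigma (vtx 2 k)).
Hypothesis typeB : equal_angles (BB false) (AA false) (CC false).
Hypothesis typeA : supplementary_angles (AA false) (BB false) (CC false).
Hypothesis tr : transcendental iota (T (BB false) (CC false)).
Hypothesis irr : ~ rational_in iota (T (BB false) (CC false)) (T (AA false) (CC false)).

Lemma apex_angles : exists2 eps : R, eps = 1 \/ eps = -1 & forall i j,
  cos (fa (CC true) (AA i) (BB j)) = eps * cos (fa (CC false) (AA i) (BB j)).
Proof.
have [eA eA' _] := typeA; have [eB eB' _] := typeB.
have [oA oB oC] := renamed_opp hsigma false.
rewrite /= in oA oB oC; rewrite oA oC in eB eB'; rewrite oB oC in eA eA'.
have [f1 f2 f3 f4] := renamed_face hsigma false false false.
have [s1 hs1 TB] : exists2 s, s = 1 \/ s = -1 & T (CC true) (BB false) = iota s * T (BB false) (CC false).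
  have := opposite_edges hl hG f3 (expr1n _ 2).
  rewrite oA oC eB eB' !mul1r => /(_ (erefl _) (erefl _)) [] h; rewrite edge_ofC h.
    by exists 1; [left|rewrite rmorph1 mul1r].
  by exists (-1); [right|rewrite rmorphN1 mulN1r].
have [s2 hs2 TA] : exists2 s, s = 1 \/ s = -1 & T (CC true) (AA false) = iota s * T (AA false) (CC false).
  have := @opposite_edges _ _ _ hl hG _ _ _ (-1) f2.
  rewrite oB oC eA eA' !mulN1r sqrrN expr1n => /(_ (erefl _) (erefl _) (erefl _)) [] h; rewrite edge_ofC h.
    by exists 1; [left|rewrite rmorph1 mul1r].
  by exists (-1); [right|rewrite rmorphN1 mulN1r].
have [q1 q2] : s1 ^+ 2 = 1 /\ s2 ^+ 2 = 1.
  by case: hs1 => ->; case: hs2 => ->; rewrite ?sqrrN !expr1n.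
pose eps := s1 * s2.
have heps : eps = 1 \/ eps = -1.
  by rewrite /eps; case: hs1 => ->; case: hs2 => ->; rewrite ?mulN1r ?opprK ?mul1r; auto.
exists eps => //.
have face k i j : is_face (CC k) (BB j) (AA i).
  have [_ _ g _] := renamed_face hsigma i j k.
  exact: is_faceC.
have rel0 := vertex_relation hG (face false false false).
have rel1 := vertex_relation hG (face true false false).
cbv zeta in rel0; cbv zeta in rel1; rewrite oA oB !(edge_ofC (CC false)) in rel0.
rewrite oA oB TA TB in rel1.
have q k i j := face_angle_sin hl (face k i j).
have rel2 := scaled_biquadratic q1 q2 rel1.
have sn k i j : 0 < sin (fa (CC k) (BB j) (AA i)) by case: (q k i j).
have sn' k i j : 0 < sin (fa (CC k) (AA i) (BB j)) by rewrite face_angleC.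
have sq k i j : sin (fa (CC k) (BB j) (AA i)) ^+ 2 = 1 - cos (fa (CC k) (BB j) (AA i)) ^+ 2.
  by case: (q k i j).
have sq' k i j : sin (fa (CC k) (AA i) (BB j)) ^+ 2 = 1 - cos (fa (CC k) (AA i) (BB j)) ^+ 2.
  by rewrite face_angleC.
have c0 k : vertexC (sin (fa (CC k) (AA false) (BB true))) (sin (fa (CC k) (AA true) (BB false))) != 0.
  exact: vertexC_neq0.
have e0 : eps != 0 by case: heps => ->; rewrite ?oppr_eq0 oner_neq0.
have [hA hB hD hE] := biquadratic_unique tr irr (c0 false) (mulf_neq0 e0 (c0 true)) rel0 rel2.
have e2 : eps ^+ 2 = 1 by rewrite /eps exprMn q1 q2 mulr1.
have [g1 g2 g3 g4] := proportional_angles (sn false _ _) (sn' false _ _) (sn' false _ _)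
  (sq false _ _) (sq' false _ _) (sq' false _ _) (sn true _ _) (sn' true _ _) (sn' true _ _)
  (sq true _ _) (sq' true _ _) (sq' true _ _) e2 hA hB hD hE.
have C i j k : fa (CC k) (AA i) (BB j) = fa (CC k) (BB j) (AA i) := face_angleC l _ _ _.
by case=> [] []; [rewrite !C; exact: g3|exact: g4|exact: g2|rewrite !C; exact: g1].
Qed.

Lemma mixed_std_lengths : exists p q : bool -> R,
  [/\ std_lengths l sigma p q, p false ^+ 2 != p true ^+ 2 & q false ^+ 2 != q true ^+ 2].
Proof.
have [eA eA' nA] := typeA; have [eB eB' nB] := typeB.
have [oA oB oC] := renamed_opp hsigma false.
rewrite /= in oA oB oC; rewrite oA oC in eB eB'; rewrite oB oC in eA eA'.
rewrite oA in nB; rewrite oB in nA.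
have [eps heps hG'] := apex_angles.
pose p i := cosl l (AA i) (CC false); pose q j := cosl l (BB j) (CC false).
have tri k i j : is_face (AA i) (BB j) (CC k) by have [] := renamed_face hsigma i j k.
pose J k i j := cos (fa (BB j) (AA i) (CC k)); pose I k i j := cos (fa (AA i) (BB j) (CC k)).
have J_eq i : J true i false = J false i false.
  by rewrite /J !(face_angleC l _ (AA i)); case: i.
have I_supp j : I true false j = - I false false j.
  by rewrite /I !(face_angleC l _ (BB j)); case: j.
have J_neq : J false false false ^+ 2 != J false true false ^+ 2.
  by rewrite /J !(face_angleC l _ (AA _)).
have I_neq : I false false false ^+ 2 != I false false true ^+ 2.
  by rewrite /I !(face_angleC l _ (BB _)).
have [h01 h02 h12] := @orthogonal_lengths R
  (fun i j => cosl l (AA i) (BB j)) (fun i j => sinl l (AA i) (BB j))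
  (fun i => cosl l (AA i) (CC false)) (fun i => sinl l (AA i) (CC false))
  (fun i => cosl l (AA i) (CC true)) (fun i => sinl l (AA i) (CC true))
  (fun j => cosl l (BB j) (CC false)) (fun j => sinl l (BB j) (CC false))
  (fun j => cosl l (BB j) (CC true)) (fun j => sinl l (BB j) (CC true))
  (I false) (fun i j => sin (fa (AA i) (BB j) (CC false)))
  (J false) (fun i j => sin (fa (BB j) (AA i) (CC false)))
  (fun i j => cos (fa (CC false) (AA i) (BB j))) (fun i j => sin (fa (CC false) (AA i) (BB j)))
  (I true) (fun i j => sin (fa (AA i) (BB j) (CC true)))
  (J true) (fun i j => sin (fa (BB j) (AA i) (CC true)))
  (fun i j => cos (fa (CC true) (AA i) (BB j))) (fun i j => sin (fa (CC true) (AA i) (BB j)))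
  eps (fun i j => face_triangle hl (tri false i j)) (fun i j => face_triangle hl (tri true i j)) heps
  J_eq I_supp hG' J_neq I_neq.
have hstd : std_lengths l sigma p q.
  by split=> // [i|j] [].
exists p, q; split=> //.
  have [s s0 hs] := angle_at_B hl hsigma hstd false.
  by apply: contra nB => /eqP E; rewrite !hs !expr_div_n E.
have [s s0 hs] := angle_at_A hl hsigma hstd false.
by apply: contra nA => /eqP E; rewrite !hs !expr_div_n E.
Qed.

End MixedTypes.

End Forward.

Section Equivalence.
Variables (R : realType) (l : edge -> R) (G : set (edge -> option R)).
Hypothesis hl : nondegenerate_lengths l.
Hypothesis hG : essential_component l G.
Local Notation A := (component_chart hG).
Local Notation iota := (const A).
Local Notation T := (fun u v => coordinate A (edge_of u v)).
Local Notation Rt := (fun u v => rational_in iota (T u v)).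

Lemma sqr_norm_neq (x y : R) : (x ^+ 2 != y ^+ 2) = (`|x| != `|y|).
Proof. by rewrite -[x ^+ 2]real_normK ?num_real // -[y ^+ 2]real_normK ?num_real // eqrXn2. Qed.

Lemma irrational_transcendental e (t : function_field A) :
  ~ rational_in iota t (coordinate A e) -> transcendental iota (coordinate A e).
Proof.
move=> irr p hp; apply: contrapT => /eqP p0; apply: irr.
by have [c ->] := constant_coordinate p0 hp; exact: rational_in_cst.
Qed.

Lemma degrees_std_lengths : Rt a1 a2 = Rt a2 a3 `&` Rt a3 a1 ->
  extension_degree (Rt a2 a3) (Rt a1 a2) 2 -> extension_degree (Rt a3 a1) (Rt a1 a2) 2 ->
  exists sigma (p q : bool -> R), [/\ renaming sigma, std_lengths l sigma p q,
    p false ^+ 2 != p true ^+ 2 & q false ^+ 2 != q true ^+ 2].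
Proof.
move=> RR /degree2_irrational [r1 i1] /degree2_irrational [r2 i2].
have i12 := intersection_irrational RR i2.
have i21 : ~ Rt a3 a1 (T a2 a3) by apply: intersection_irrational i1; rewrite setIC.
have tr1 := irrational_transcendental i1; have tr2 := irrational_transcendental i2.
rewrite (edge_ofC a3 a1) in r2 i2 i12 i21 tr2.
have f2 : is_face a2 a1 a3 by []. have f1 : is_face a1 a2 a3 by [].
have := vertex_type hl f2 tr1; rewrite (edge_ofC a2 a1) => /(_ r1 i1) type2.
have type1 := vertex_type hl f1 tr2 r2 i2.
have [E0 E1 E2] := vtx_named; have [S0 S1 S2] := vtx_swapped false.
have f3 : is_face a3 a2 a1 by [].
have rel3 := vertex_relation hG f3; cbv zeta in rel3.
rewrite !(edge_ofC a3) in rel3.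
have c0 : vertexC (sin (face_angle l a3 a1 (opp_vertex a2))) (sin (face_angle l a3 (opp_vertex a1) a2)) != 0.
  have g1 : is_face a3 a1 (opp_vertex a2) by [].
  have g2 : is_face a3 (opp_vertex a1) a2 by [].
  by have [h1 _] := face_angle_sin hl g1; have [h2 _] := face_angle_sin hl g2; exact: vertexC_neq0.
have t0 := coordinate_neq0 hG (edge_of a2 a3); have u0 := coordinate_neq0 hG (edge_of a1 a3).
have y0 := coordinate_neq0 hG (edge_of a1 a2).
have y0' : (coordinate A (edge_of a1 a2))^-1 != 0 by rewrite invr_neq0.
have absurd := half_biquadratics_absurd tr1 i12 t0 u0.
case: type2 type1 => -[type2 [c2 [x2 [y2 [c20 rel2]]]]] [] [type1 [c1 [x1 [y1 [c10 rel1]]]]].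
- by case: (absurd _ _ _ _ _ _ _ _ _ _ _ _ y0 i1 i2 c20 c10 c0 rel2 rel1 rel3).
- have hs : renaming id by left.
  have := @mixed_std_lengths _ _ _ hl hG id hs.
  rewrite E0 E1 E2 => H; have [p [q [h1 h2 h3]]] := H type2 type1 tr1 i12.
  exists id, p, q.
  exact: And4 hs h1 h2 h3.
- have hs : renaming swap12 by right.
  have := @mixed_std_lengths _ _ _ hl hG swap12 hs; rewrite S0 S1 S2 E0 E1 E2.
  move=> H; have [p [q [h1 h2 h3]]] := H type1 type2 tr2 i21.
  exists swap12, p, q.
  exact: And4 hs h1 h2 h3.
- by case: (absurd _ _ _ _ _ _ _ _ _ _ _ _ y0' (inv_irrational i1) (inv_irrational i2)
    c20 c10 c0 rel2 rel1 rel3).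
Qed.

Lemma std_lengths_flexion sigma (p q : bool -> R) P : renaming sigma -> std_lengths l sigma p q ->
  p false ^+ 2 != p true ^+ 2 -> q false ^+ 2 != q true ^+ 2 ->
  flexion l G P <-> exists (g : 'M[R]_4) (d1 d2 e1 e2 theta : R),
    [/\ is_rotation g, [/\ is_sign d1, is_sign d2, is_sign e1 & is_sign e2],
        admissible (p false) (p true) (q false) (q true) theta &
        forall u, P (sigma u) = standard_octahedron (p false) (p true) (q false) (q true)
          d1 d2 e1 e2 theta u *m g].
Proof.
move=> hsigma hstd hp hq; split.
  move=> [oP lP _]; have [g [w [Y [Z [rg hc Pg]]]]] := realization_std hsigma hp hq hstd oP lP.
  have [d1 [d2 [e1 [e2 [theta [sg [adm e]]]]]]] := parameters_of_std_vertex hc.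
  by exists g, d1, d2, e1, e2, theta; split=> // u; rewrite e.
move=> [g [d1 [d2 [e1 [e2 [theta [rg [s1 s2 s3 s4] adm Pg]]]]]]].
have [w [Y [Z [hc e]]]] := std_vertex_of_parameters s1 s2 s3 s4 adm.
have cP : curve_octahedron sigma p q P w Y Z by exists g => // u; rewrite -e.
have [oP lP] := curve_octahedronP hl hsigma hstd hc cP; split=> //.
have [x hx] := half_tangents_exist hl oP lP; exists x => //.
pose c : curve p q := exist _ (w, Y, Z) hc.
have hcx : curve_point sigma c x by exists P.
have [[F Fh GE] _ _ _] := ess_component hG.
rewrite GE => f Ff.
have conf y : G y -> exists c : curve p q, curve_point sigma c y.
  by move=> Gy; apply: (configuration_curve_point hsigma hp hq hstd); exact: component_configuration hG _ Gy.
have inf := curve_w_infinite hl hsigma hstd (component_infinite hG) conf.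
apply: (vanishing_on_curve hl hsigma hp hq hstd (Fh _ Ff) inf) hcx.
by move=> c' [y Gy hy]; exists y => //; move: Gy; rewrite GE; apply.
Qed.

Lemma parametrization_std_lengths : admits_parametrization l G ->
  exists sigma (p q : bool -> R), [/\ renaming sigma, std_lengths l sigma p q,
    p false ^+ 2 != p true ^+ 2 & q false ^+ 2 != q true ^+ 2].
Proof.
move=> [sigma [p1 [p2 [q1 [q2 [hsigma hp hq hP]]]]]].
pose p (b : bool) := if b then p2 else p1; pose q (b : bool) := if b then q2 else q1.
exists sigma, p, q; split=> //; rewrite ?sqr_norm_neq //.
have [v Av] := irr_nonempty A.
have [_ [P [oP lP hx]]] := component_configuration hG (chartP Av).
have /hP : flexion l G P by split=> //; exists (fun e => Some (v e)) => //; exact: chartP.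
move=> [g [d1 [d2 [e1 [e2 [theta [rg [s1 s2 s3 s4] adm Pg]]]]]]].
have [w [Y [Z [hc e]]]] := @std_vertex_of_parameters _ p q _ _ _ _ _ s1 s2 s3 s4 adm.
have [_ h01 h02 h12] := std_standard_dots hc.
have dg u v' : u.1 != v'.1 -> cosl l (sigma u) (sigma v') =
    dot (std_vertex p q w Y Z u) (std_vertex p q w Y Z v').
  by move=> uv; rewrite -(dot_cosl oP lP) ?renaming_idx // !Pg dot_rotation // -!e.
by split=> i j; rewrite dg ?vtx_idx.
Qed.

End Equivalence.

Theorem theorem4p1 (R : realType) (l : edge -> R) (G : set (edge -> option R))
    (hl : nondegenerate_lengths l) (hG : essential_component l G) :
  let RG : set (function_field (component_chart hG)) := setT in
  let Rt (u v : vertex) :=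
    generated_subfield (coordinate (component_chart hG) (edge_of u v)) in
  let Rt1 := Rt a2 a3 in
  let Rt2 := Rt a3 a1 in
  let Rt3 := Rt a1 a2 in
  [/\ Rt3 = Rt1 `&` Rt2,
      extension_degree RG Rt3 4,
      extension_degree RG Rt1 2 /\ extension_degree RG Rt2 2 &
      extension_degree Rt1 Rt3 2 /\ extension_degree Rt2 Rt3 2]
  <-> admits_parametrization l G.
Proof.
cbv zeta; split.
  move=> [RR _ _ [d1 d2]].
  have [sigma [p [q [hsigma hstd hp hq]]]] := degrees_std_lengths hl RR d1 d2.
  exists sigma, (p false), (p true), (q false), (q true); split=> //; rewrite -?sqr_norm_neq //.
  by move=> P; exact: std_lengths_flexion.
move=> /(parametrization_std_lengths hG) [sigma [p [q [hsigma hstd hp hq]]]].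
have := standard_component_degrees hl hG hsigma hp hq hstd.
have [E0 E1 E2] := vtx_named; have [S0 S1 S2] := vtx_swapped false.
case: hsigma => -> /=; rewrite ?S0 ?S1 ?S2 E0 E1 E2 (edge_ofC a3 a1) => -[RR d3 [d1 d2] [d1' d2']].
  exact: And4 RR d3 (conj d1 d2) (conj d1' d2').
rewrite setIC (edge_ofC a1 a2).
exact: And4 RR d3 (conj d2 d1) (conj d2' d1').
Qed.
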